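(* For $\alpha\ge 1$ and $b>0$ let $$\hat\Sigma_{\alpha,b}=a_o\big(S+HL\Psi(L)H^{\top}\big),\qquad \Psi(L)=b\,\frac{L^{-\alpha}}{\mathrm{tr}(L^{-\alpha})},\qquad a_o=\frac{1}{K^{*}v},$$ and let $\hat\Sigma_{a_o}=a_oS$. Assume that $E_{\theta,\Sigma}[\mathrm{tr}(\Sigma^{-1}S)]$, $E_{\theta,\Sigma}[\mathrm{tr}(\Sigma S^{+})]$, $E_{\theta,\Sigma}[\|\Sigma^{-1}HL\Psi(L)H^{\top}\|_F^2]$ and $E_{\theta,\Sigma}[\|H\Psi(L)H^{\top}\|_F^2]$ are finite. Then $\hat\Sigma_{\alpha,b}$ improves over $\hat\Sigma_{a_o}$, that is, $R(\hat\Sigma_{\alpha,b},\Sigma)\le R(\hat\Sigma_{a_o},\Sigma)$, as soon as $$0<b\le\frac{2(r-1)}{v-r+1}.$$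
   Context: Let $n,p,q$ be positive integers with $q<n$, and let $m=n-q$, $r=\min\{p,m\}$, $v=\max\{p,m\}$. Let $Z$ ($q\times p$) and $U$ ($m\times p$) be random matrices with joint Lebesgue density $$(z,u)\mapsto |\Sigma|^{-n/2} f\big(\mathrm{tr}\,(z-\theta)\Sigma^{-1}(z-\theta)^{\top}+\mathrm{tr}\,u\Sigma^{-1}u^{\top}\big),$$ where $\theta$ is an unknown $q\times p$ matrix, $\Sigma$ is an unknown $p\times p$ positive definite matrix and $f$ is a non-negative function. Assumptions and conclusions are understood for all $\theta$ and $\Sigma$. $E_{\theta,\Sigma}$ denotes expectation with respect to this density. Set $F^{*}(t)=\frac12\int_t^{\infty}f(\nu)\,d\nu$ for $t\ge0$, and let $K^{*}$ (assumed finite) be the normalizing constant making $$(z,u)\mapsto \frac{1}{K^{*}}|\Sigma|^{-n/2}F^{*}\big(\mathrm{tr}\,(z-\theta)\Sigma^{-1}(z-\theta)^{\top}+\mathrm{tr}\,u\Sigma^{-1}u^{\top}\big)$$ a probability density. Let $S=U^{\top}U$, with Moore–Penrose inverse $S^{+}$, and let $S=HLH^{\top}$ be its (almost surely defined) eigenvalue decomposition, where $H$ is $p\times r$ with $H^{\top}H=I_r$ and $L=\mathrm{diag}(l_1,\dots,l_r)$ with $l_1>\cdots>l_r>0$ the positive eigenvalues of $S$; $L^{-\alpha}=\mathrm{diag}(l_1^{-\alpha},\dots,l_r^{-\alpha})$. $\|\cdot\|_F$ is the Frobenius norm. The risk of an estimator $\hat\Sigma$ of $\Sigma$ under the data-based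 loss is $R(\hat\Sigma,\Sigma)=E_{\theta,\Sigma}\big[\mathrm{tr}\big(S^{+}\Sigma(\Sigma^{-1}\hat\Sigma-I_p)^2\big)\big]$. *)

(* Defs.v *)
From HB Require Import structures.
From mathcomp Require Import all_boot all_order all_algebra.
From mathcomp Require Import all_classical all_reals all_analysis.

Set Implicit Arguments.
Unset Strict Implicit.
Unset Printing Implicit Defensive.

Import Order.TTheory GRing.Theory Num.Theory.
Import numFieldNormedType.Exports.

Local Open Scope classical_set_scope.
Local Open Scope ring_scope.

Section sigma_finite_product.
Context d1 d2 (T1 : measurableType d1) (T2 : measurableType d2) (R : realType).
Variables (m1 : {sigma_finite_measure set T1 -> \bar R}).
Variables (m2 : {sigma_finite_measure set T2 -> \bar R}).

(* An alias of the product measure for which the sigma_finite_measure structure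
   can be inferred: for m1 \x m2 itself, inference only finds the instance for
   (sub)probabilities. *)
Definition sigma_finite_product : set (T1 * T2) -> \bar R := (m1 \x m2)%E.

HB.instance Definition _ := Measure.copy sigma_finite_product (m1 \x m2)%E.

Let sigma_finite_productT : sigma_finite setT sigma_finite_product.
Proof.
have /sigma_finiteP[F [TF ndF Foo]] := sigma_finiteT m1.
have /sigma_finiteP[G [TG ndG Goo]] := sigma_finiteT m2.
exists (fun n => F n `*` G n).
  rewrite -setXTT TF TG predeqE => -[x y]; split.
    move=> [/= [n _ Fnx] [k _ Gky]]; exists (maxn n k) => //; split.
    - by move: x Fnx; exact/subsetPset/ndF/leq_maxl.
    - by move: y Gky; exact/subsetPset/ndG/leq_maxr.
  by move=> [n _ []/= ? ?]; split; exists n.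
move=> k; have [? ?] := Foo k; have [? ?] := Goo k.
split; first exact: measurableX.
rewrite /sigma_finite_product product_measure1E//.
by rewrite lte_mul_pinfty// ge0_fin_numE.
Qed.

HB.instance Definition _ := Measure_isSigmaFinite.Build _ _ _
  sigma_finite_product sigma_finite_productT.

End sigma_finite_product.

Section can_pushforward.
Context d1 d2 (T1 : measurableType d1) (T2 : measurableType d2) (R : realType).
Variables (mu : {sigma_finite_measure set T1 -> \bar R}).
Variables (f : T1 -> T2) (g : T2 -> T1).
Hypotheses (mf : measurable_fun setT f) (mg : measurable_fun setT g).
Hypothesis fK : cancel f g.

(* The image of a sigma-finite measure under a map with a measurable left
   inverse is sigma-finite. *)
Definition can_pushforward of measurable_fun setT f & measurable_fun setT g
  & cancel f g : set T2 -> \bar R := pushforward mu f.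

Local Notation nu := (can_pushforward mf mg fK).

Let can_pushforward0 : nu set0 = 0%E.
Proof. by rewrite /can_pushforward /pushforward preimage_set0 measure0. Qed.

Let can_pushforward_ge0 A : (0 <= nu A)%E.
Proof. exact: measure_ge0. Qed.

Let can_pushforward_sigma_additive : semi_sigma_additive nu.
Proof.
move=> F mF tF mUF; rewrite /can_pushforward /pushforward preimage_bigcup.
apply: measure_semi_sigma_additive.
- by move=> n; rewrite -[X in measurable X]setTI; exact: mf.
- apply/trivIsetP => /= i j _ _ ij; rewrite -preimage_setI.
  by move/trivIsetP : tF => /(_ _ _ _ _ ij) ->//; rewrite preimage_set0.
- by rewrite -preimage_bigcup -[X in measurable X]setTI; exact: mf.
Qed.

HB.instance Definition _ := isMeasure.Build _ _ _ nu
  can_pushforward0 can_pushforward_ge0 can_pushforward_sigma_additive.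

Let can_pushforward_sigma_finite : sigma_finite setT nu.
Proof.
have [F TF Foo] := sigma_finiteT mu.
exists (fun i => g @^-1` F i).
  by rewrite -preimage_bigcup -TF preimage_setT.
move=> i; have [mFi Fioo] := Foo i; split.
  by rewrite -[X in measurable X]setTI; exact: mg.
rewrite /can_pushforward /pushforward.
rewrite (_ : f @^-1` _ = F i)//.
by apply/seteqP; split => x /=; rewrite fK.
Qed.

HB.instance Definition _ := Measure_isSigmaFinite.Build _ _ _ nu
  can_pushforward_sigma_finite.

End can_pushforward.

Section lebesgue_tuple.
Context (R : realType).
Let X := measurableTypeR R.

Definition pair_tuple n (x : (X * n.-tuple X)%type) : n.+1.-tuple X :=
  [tuple of x.1 :: x.2].

Definition tuple_pair n (t : n.+1.-tuple X) : X * n.-tuple X :=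
  (thead t, [tuple of behead t]).

Lemma measurable_pair_tuple n : measurable_fun setT (@pair_tuple n).
Proof. exact: (measurable_cons measurable_fst measurable_snd). Qed.

Lemma measurable_tuple_pair n : measurable_fun setT (@tuple_pair n).
Proof.
by apply: measurable_fun_pair; [exact: measurable_tnth|exact: measurable_behead].
Qed.

Lemma pair_tupleK n : cancel (@pair_tuple n) (@tuple_pair n).
Proof. by case=> x t; congr pair; apply: val_inj. Qed.

Fixpoint lebesgue_tuple n : {sigma_finite_measure set (n.-tuple X) -> \bar R} :=
  match n with
  | 0 => dirac ([tuple] : 0.-tuple X)
  | k.+1 => can_pushforward (sigma_finite_product lebesgue_measure (lebesgue_tuple k))
      (@measurable_pair_tuple k) (@measurable_tuple_pair k) (@pair_tupleK k)
  end.

End lebesgue_tuple.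

Section matrix_measurable.
Context (R : realType) (m n : nat).
Let X := measurableTypeR R.

Definition tuple_of_mx (A : 'M[R]_(m, n)) : (m * n).-tuple X :=
  [tuple mxvec A 0 k | k < m * n].

Definition mx_of_tuple (t : (m * n).-tuple X) : 'M[R]_(m, n) :=
  vec_mx (\row_k (tnth t k : R)).

Lemma tuple_of_mxK : cancel tuple_of_mx mx_of_tuple.
Proof.
move=> A; rewrite /mx_of_tuple -[RHS]mxvecK; congr vec_mx.
by apply/rowP => k; rewrite mxE tnth_mktuple.
Qed.

Lemma mx_of_tupleK : cancel mx_of_tuple tuple_of_mx.
Proof.
by move=> t; apply: eq_from_tnth => k; rewrite tnth_mktuple vec_mxK mxE.
Qed.

Definition measurable_mx : set (set 'M[R]_(m, n)) :=
  preimage_set_system setT tuple_of_mx measurable.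

Let sigma_algebra_mx : sigma_algebra setT measurable_mx.
Proof. exact/sigma_algebra_preimage/sigma_algebra_measurable. Qed.

Let measurable_mx0 : measurable_mx set0.
Proof. by case: sigma_algebra_mx. Qed.

Let measurable_mxC A : measurable_mx A -> measurable_mx (~` A).
Proof. by case: sigma_algebra_mx => _ mC _ /mC; rewrite setTD. Qed.

Let measurable_mx_bigcup (F : (set 'M[R]_(m, n))^nat) :
  (forall i, measurable_mx (F i)) -> measurable_mx (\bigcup_i F i).
Proof. by case: sigma_algebra_mx => _ _; exact. Qed.

(* The sigma-algebra generated by the entries. *)
HB.instance Definition _ := @isMeasurable.Build default_measure_display
  'M[R]_(m, n) measurable_mx measurable_mx0 measurable_mxC measurable_mx_bigcup.

Lemma measurable_tuple_of_mx : measurable_fun setT tuple_of_mx.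
Proof. by move=> _ Y mY; exists Y. Qed.

Lemma measurable_mx_of_tuple : measurable_fun setT mx_of_tuple.
Proof.
move=> _ _ [Y mY <-]; rewrite !setTI -comp_preimage.
by rewrite (_ : tuple_of_mx \o _ = id)//; apply/funext => t; exact: mx_of_tupleK.
Qed.

Definition lebesgue_mx : {sigma_finite_measure set 'M[R]_(m, n) -> \bar R} :=
  can_pushforward (lebesgue_tuple R (m * n))
    measurable_mx_of_tuple measurable_tuple_of_mx mx_of_tupleK.

End matrix_measurable.

Section linear_algebra.
Context (R : realType).

Definition posdef p (A : 'M[R]_p) : Prop :=
  A^T = A /\ forall x : 'rV[R]_p, x != 0 -> 0 < (x *m A *m x^T) 0 0.

Definition frobenius m n (A : 'M[R]_(m, n)) : R :=
  Num.sqrt (\sum_i \sum_j A i j ^+ 2).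

Definition is_moore_penrose m n (A : 'M[R]_(m, n)) (X : 'M[R]_(n, m)) : Prop :=
  [/\ A *m X *m A = A, X *m A *m X = X,
      (A *m X)^T = A *m X & (X *m A)^T = X *m A].

(* The Penrose conditions have a unique solution for every real matrix, so the
   default value 0 is never used. *)
Definition moore_penrose m n (A : 'M[R]_(m, n)) : 'M[R]_(n, m) :=
  xget 0 [set X | is_moore_penrose A X].

(* The row vector l holds the diagonal of L. *)
Definition is_evd p r (S : 'M[R]_p) (Hl : 'M[R]_(p, r) * 'rV[R]_r) : Prop :=
  let: (H, l) := Hl in
  [/\ H^T *m H = 1%:M, S = H *m diag_mx l *m H^T,
      forall i, 0 < l 0 i & forall i j : 'I_r, (i < j)%N -> l 0 j < l 0 i].

(* H is determined only up to the signs of its columns; evd picks one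
   decomposition.  When there is none, its value is irrelevant, as
   this happens only on a null set in the application. *)
Definition evd p r (S : 'M[R]_p) : 'M[R]_(p, r) * 'rV[R]_r :=
  xget (0, 0) [set Hl | is_evd S Hl].

End linear_algebra.

Section elliptical_model.
Context (R : realType) (n q m p : nat).
Implicit Types (theta : 'M[R]_(q, p)) (Sigma : 'M[R]_p).

Local Notation space := ('M[R]_(q, p) * 'M[R]_(m, p))%type.

Definition lebesgue_zu : set space -> \bar R :=
  sigma_finite_product (@lebesgue_mx R q p) (@lebesgue_mx R m p).

HB.instance Definition _ := SigmaFiniteMeasure.on lebesgue_zu.

Definition quad theta Sigma (x : space) : R :=
  \tr ((x.1 - theta) *m invmx Sigma *m (x.1 - theta)^T) +
  \tr (x.2 *m invmx Sigma *m x.2^T).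

Definition elliptic (g : R -> \bar R) theta Sigma (x : space) : \bar R :=
  ((\det Sigma `^ (- n%:R / 2))%:E * g (quad theta Sigma x))%E.

Definition is_density (h : space -> \bar R) : Prop :=
  (forall x, 0 <= h x)%E /\ (\int[lebesgue_zu]_x h x = 1)%E.

Definition expect (f : R -> R) theta Sigma (h : space -> R) : \bar R :=
  (\int[lebesgue_zu]_x ((h x)%:E * elliptic (EFin \o f) theta Sigma x))%E.

Definition Fstar (f : R -> R) (t : R) : \bar R :=
  ((2^-1)%:E * \int[lebesgue_measure]_(nu in `[t, +oo[) (f nu)%:E)%E.

Definition Smx (x : space) : 'M[R]_p := x.2^T *m x.2.

Definition risk (f : R -> R) theta Sigma (Sigmahat : space -> 'M[R]_p) :
    \bar R :=
  expect f theta Sigma (fun x =>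
    \tr (moore_penrose (Smx x) *m Sigma *m
         (invmx Sigma *m Sigmahat x - 1%:M) ^+ 2)).

End elliptical_model.

Section estimators.
Context (R : realType) (p r : nat) (alpha b a : R).
Implicit Types (S : 'M[R]_p) (l : 'rV[R]_r).

Definition diag_powN l : 'M[R]_r := diag_mx (\row_i (l 0 i `^ (- alpha))).

Definition Psi l : 'M[R]_r := (b / \tr (diag_powN l)) *: diag_powN l.

Definition HPsiH S : 'M[R]_p :=
  let: (H, l) := evd r S in H *m Psi l *m H^T.

Definition HLPsiH S : 'M[R]_p :=
  let: (H, l) := evd r S in H *m diag_mx l *m Psi l *m H^T.

Definition Sigma_alpha_b S : 'M[R]_p := a *: (S + HLPsiH S).

End estimators.

(* Main.v *)
Require Import Defs.
From HB Require Import structures.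
From mathcomp Require Import all_boot all_order all_algebra.
From mathcomp Require Import all_classical all_reals all_analysis.
From mathcomp Require Import measurable_realfun complex polyrcf ring lra.

Set Implicit Arguments.
Unset Strict Implicit.
Unset Printing Implicit Defensive.

Import Order.TTheory GRing.Theory Num.Theory.
Import numFieldNormedType.Exports.

Local Open Scope classical_set_scope.
Local Open Scope ring_scope.

(* Off a null set S has a decomposition H L H^T with distinct positive
   eigenvalues, and there the two losses differ by a_o^2 h - 2 a_o b, where
   h = tr(Sigma^-1 H L (2 Psi + Psi^2) H^T).  Hence the claim is the bound
   E h <= K* C with C = (v - r + 1) (2 b + b^2), because the hypothesis on b says
   exactly that C <= 2 b v.

   Write Q for the quadratic form in the density.  Both Q and h are homogeneous of
   degree 2 about (theta, 0), so the distribution of Q weighted by h and the volume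
   of the sublevel sets of Q are proportional measures on the half line.  Therefore
   \int f(Q) h <= C \int F*(Q), which is the bound on E h, holds for every f as soon
   as it holds for one, and f = 2 (1 - t)_+ is compactly supported.

   For this f the inequality is Stein's identity.  Let X = U if p <= m and
   X = U^T otherwise, a v x r matrix, and A = X^T X.  The field to integrate by parts
   is X (2 Psi + Psi^2)(A); to avoid differentiating eigenvectors, A^(-alpha) is
   replaced by the partial sums of the binomial series in 1 - s A, whose divergence is
   a finite algebraic expression.  It is at most C plus an error that vanishes in the
   limit since alpha >= 1. *)

(** * Affine changes of variables *)

(** The constant C has two sources. Differentiating the factor X contributes v times a trace.
    Differentiating the function of A produces divided differences over pairs of eigenvalues: each
    of the r - 1 partners of an eigenvalue gives back about one unit, which turns v into v - r + 1,
    while the diagonal pairs absorb the derivative of the normalization by the trace. The factor 2 b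
    + b^2 then comes from tr Psi = b and tr Psi^2 <= b^2. The binomial series suits this because its
    coefficients are positive and, for alpha >= 1, nondecreasing: Abel summation bounds the divided
    differences of every partial sum from below, with a single boundary term. Divided by the trace,
    that term is at most alpha, so it is dominated, and it tends to 0 because all eigenvalues are
    positive. Two further obstacles shape the argument. Eigenvectors are chosen without any
    regularity, so the measurability of h and of the losses comes from limits of polynomial
    expressions and from cofactor formulas, off the zero set of a discriminant. And the risks are
    compared as integrals with values in [0, +oo], so the identity between the losses is integrated
    without subtraction. *)

Section rescaling.
Local Open Scope ereal_scope.

(** The number [k] is the Jacobian of [phi]. As an identity on measurable sets it passes to products
    and to image measures, so the affine maps of the sample space are reached from the line
    alone. *)
Definition rescales d (T : measurableType d) (R : realType)
    (mu : {measure set T -> \bar R}) (phi : T -> T) (k : R) :=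
  forall A, measurable A -> k%:E * mu (phi @^-1` A) = mu A.

Lemma ge0_integral_rescales d (T : measurableType d) (R : realType)
    (mu : {measure set T -> \bar R}) (phi : T -> T) (k : R)
    (g : T -> \bar R) :
  (0 <= k)%R -> measurable_fun setT phi -> rescales mu phi k ->
  measurable_fun [set: T] g -> (forall x, 0 <= g x) ->
  k%:E * \int[mu]_x g (phi x) = \int[mu]_x g x.
Proof.
move=> k0 mphi muphi mg g0.
pose phi_mixin := isMeasurableFun.Build _ _ _ _ _ mphi.
pose phi' : {mfun T >-> T} := HB.pack phi phi_mixin.
rewrite [RHS](eq_measure_integral (mscale (NngNum k0) (pushforward mu phi'))); last first.
  by move=> A mA _; rewrite /= /mscale/= -muphi.
rewrite ge0_integral_mscale// (ge0_integral_pushforward mphi)//.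
Qed.

(** The rescaled image of the product measure factors on rectangles, and a product measure is
    determined by its values there. *)
Lemma rescales_product d1 d2 (T1 : measurableType d1) (T2 : measurableType d2)
    (R : realType) (m1 : {sigma_finite_measure set T1 -> \bar R})
    (m2 : {sigma_finite_measure set T2 -> \bar R}) phi1 phi2
    (k1 k2 : R) :
  (0 <= k1)%R -> (0 <= k2)%R ->
  measurable_fun setT phi1 -> measurable_fun setT phi2 ->
  rescales m1 phi1 k1 -> rescales m2 phi2 k2 ->
  rescales (sigma_finite_product m1 m2)
    (fun x => (phi1 x.1, phi2 x.2)) (k1 * k2)%R.
Proof.
move=> k10 k20 mphi1 mphi2 s1 s2 A mA; rewrite /= /sigma_finite_product.
have mphi : measurable_fun setT (fun x : T1 * T2 => (phi1 x.1, phi2 x.2)).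
  by apply: measurable_fun_pair; apply: measurableT_comp.
pose phi_mixin := isMeasurableFun.Build _ _ _ _ _ mphi.
pose phi' : {mfun (T1 * T2)%type >-> (T1 * T2)%type} := HB.pack
  (fun x : T1 * T2 => (phi1 x.1, phi2 x.2)) phi_mixin.
rewrite [RHS](product_measure_unique (m' := mscale (NngNum (mulr_ge0 k10 k20))
  (pushforward (sigma_finite_product m1 m2) phi')))// => B C mB mC.
rewrite /= /mscale/= /pushforward /sigma_finite_product/=.
rewrite (_ : _ @^-1` _ = (phi1 @^-1` B) `*` (phi2 @^-1` C))//.
rewrite product_measure1E//; last 2 first.
  by rewrite -[X in measurable X]setTI; exact: mphi1.
  by rewrite -[X in measurable X]setTI; exact: mphi2.
by rewrite -[m1 B]s1// -[m2 C]s2// EFinM muleACA.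
Qed.

Lemma rescales_can_pushforward d1 d2 (T1 : measurableType d1)
    (T2 : measurableType d2) (R : realType)
    (mu : {sigma_finite_measure set T1 -> \bar R}) f g
    (mf : measurable_fun setT f) (mg : measurable_fun setT g)
    (fK : cancel f g) phi1 phi2 (k : R) :
  (forall x, phi2 (f x) = f (phi1 x)) -> rescales mu phi1 k ->
  @rescales _ T2 R (can_pushforward mu mf mg fK) phi2 k.
Proof.
move=> fphi s A mA; rewrite /= /can_pushforward /pushforward.
rewrite -[RHS]s; last by rewrite -[X in measurable X]setTI; exact: mf.
by congr (_ * mu _); apply/funext => x; rewrite /preimage/= fphi.
Qed.

Lemma rescales_affine (R : realType) (c d : R) (c0 : (0 < c)%R) :
  rescales (@lebesgue_measure R) (fun x => c * x + d)%R c.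
Proof.
have mphi : measurable_fun [set: measurableTypeR R]
    (fun x => c * x + d : measurableTypeR R)%R.
  exact/measurable_funD.
pose phi_mixin := isMeasurableFun.Build _ _ _ _ _ mphi.
pose phi : {mfun measurableTypeR R >-> measurableTypeR R} :=
  HB.pack (fun x => c * x + d : measurableTypeR R)%R phi_mixin.
move=> A mA; rewrite [RHS](lebesgue_measure_unique (mu := mscale
  (NngNum (ltW c0)) (pushforward lebesgue_measure phi)))//.
move=> _ [[a b]] _ <-; rewrite /= /mscale/= /pushforward.
rewrite (_ : _ @^-1` _ = `](a - d) / c, (b - d) / c]%classic)%R; last first.
  apply/seteqP; split => x /=; rewrite !in_itv/= ltr_pdivrMr// ler_pdivlMr//;
  by rewrite ltrBlDr lerBrDr mulrC.
rewrite !lebesgue_measure_itv/= !lte_fin ltr_pM2r ?invr_gt0// ltrD2r.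
case: ifPn => _; last by rewrite mule0.
rewrite -!EFinD -EFinM; congr EFin.
by rewrite -mulrBl mulrCA divff ?gt_eqF// mulr1; ring.
Qed.

End rescaling.

Section lebesgue_affine.
Context (R : realType).
Let X := measurableTypeR R.

Definition tuple_affine (c : R) n (d t : n.-tuple X) : n.-tuple X :=
  [tuple c * tnth t i + tnth d i | i < n].

Lemma measurable_tuple_affine c n d :
  measurable_fun setT (@tuple_affine c n d).
Proof.
apply/measurable_fun_tnthP => i; rewrite (_ : _ \o _ = fun t => c * tnth t i + tnth d i).
  apply: measurable_funD => //; apply: measurable_funM => //.
  exact: measurable_tnth.
by apply/funext => t /=; rewrite tnth_mktuple.
Qed.

Lemma rescales_lebesgue_tuple (c : R) (c0 : 0 < c) n (d : n.-tuple X) :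
  rescales (lebesgue_tuple R n) (tuple_affine c d) (c ^+ n).
Proof.
elim: n d => [|n IH] d.
  move=> A mA; rewrite expr0 mul1e; congr (_ _); apply/seteqP.
  by split => t /=; rewrite /preimage/= [tuple_affine _ _ _]tuple0 [t]tuple0.
rewrite exprS.
apply: (@rescales_can_pushforward _ _ _ _ R
  (sigma_finite_product lebesgue_measure (lebesgue_tuple R n)) _ _
  (@measurable_pair_tuple R n) (@measurable_tuple_pair R n)
  (@pair_tupleK R n)
  (fun x => (c * x.1 + thead d, tuple_affine c [tuple of behead d] x.2))).
  move=> x; apply: eq_from_tnth => i; rewrite tnth_mktuple.
  case: (unliftP ord0 i) => [j ->|->]; last by rewrite !tnth0.
  rewrite !tnthS tnth_mktuple.
  have -> // : tnth d (lift ord0 j) = tnth [tuple of behead d] j.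
  case: (tupleP d) => y d'; rewrite tnthS; congr (tnth _ j).
  exact: val_inj.
apply: (@rescales_product _ _ _ _ R lebesgue_measure (lebesgue_tuple R n)
  (fun x => c * x + thead d) (tuple_affine c [tuple of behead d])) => //.
- exact: ltW.
- exact/exprn_ge0/ltW.
- exact/measurable_funD.
- exact: measurable_tuple_affine.
- exact: rescales_affine.
Qed.

Definition tuple_box n (B : R) : set (n.-tuple X) :=
  [set t | forall i, `|tnth t i : R| <= B].

Lemma lebesgue_tuple_box_lty n (B : R) :
  (lebesgue_tuple R n (@tuple_box n B) < +oo)%E.
Proof.
elim: n => [|n IH]; first by rewrite /= /dirac indicE; case: (_ \in _); rewrite ltry.
rewrite /= /can_pushforward /pushforward /sigma_finite_product.
rewrite (_ : _ @^-1` _ = `[- B, B] `*` @tuple_box n B); last first.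
  apply/seteqP; split => -[x t] /=.
    move=> h; split; first by have := h ord0; rewrite tnth0/= ler_norml in_itv.
    by move=> i; have := h (lift ord0 i); rewrite tnthS.
  rewrite in_itv/= -ler_norml => -[xB tB] i.
  by case: (unliftP ord0 i) => [j ->|->]; rewrite ?tnthS// tnth0.
rewrite product_measure1E//.
  have lB : (lebesgue_measure [set` `[- B, B]%R] < +oo)%E.
    by rewrite lebesgue_measure_itv/=; case: ifPn => _; rewrite -?EFinD ltry.
  by apply: lte_mul_pinfty => //; rewrite ge0_fin_numE.
rewrite (_ : tuple_box B = \bigcap_(i in [set: 'I_n]) ((fun t => `|tnth t i|) @^-1` `]-oo, B])).
  apply: fin_bigcap_measurable => // i _; rewrite -[X in measurable X]setTI.
  have mt : measurable_fun setT (fun t : n.-tuple X => `|tnth t i : R|).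
    exact: measurableT_comp (measurable_tnth i).
  exact: mt.
by apply/seteqP; split => [t h i _|t h i] /=; [rewrite in_itv/=; exact: h|have := h i I; rewrite /= in_itv].
Qed.

End lebesgue_affine.

Section matrix_space.
Context (R : realType).

Lemma tnth_tuple_of_mx m n (A : 'M[R]_(m, n)) i j :
  tnth (tuple_of_mx A) (mxvec_index i j) = A i j.
Proof. by rewrite tnth_mktuple mxvecE. Qed.

Lemma mx_of_tupleE m n (t : (m * n).-tuple (measurableTypeR R)) i j :
  mx_of_tuple t i j = tnth t (mxvec_index i j).
Proof. by rewrite -[in RHS](mx_of_tupleK t) tnth_tuple_of_mx. Qed.

Lemma measurable_entry m n i j : measurable_fun setT (fun A : 'M[R]_(m, n) => A i j).
Proof.
rewrite (_ : (fun A => _) = (@tnth _ _)^~ (mxvec_index i j) \o @tuple_of_mx R m n).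
  apply: measurableT_comp; first exact: measurable_tnth.
  exact: measurable_tuple_of_mx.
by apply/funext => A /=; rewrite tnth_tuple_of_mx.
Qed.

Lemma measurable_fun_mx d (T : measurableType d) m n (f : T -> 'M[R]_(m, n)) :
  (forall i j, measurable_fun setT (fun x => f x i j)) -> measurable_fun setT f.
Proof.
move=> mf; rewrite (_ : f = @mx_of_tuple R m n \o (fun x => tuple_of_mx (f x))).
  apply: measurableT_comp; first exact: measurable_mx_of_tuple.
  apply/measurable_fun_tnthP => k; case/mxvec_indexP: k => i j.
  have -> : (@tnth _ _)^~ (mxvec_index i j) \o (fun x => tuple_of_mx (f x)) =
    (fun x => f x i j) by apply/funext => x /=; rewrite tnth_tuple_of_mx.
  exact: mf.
by apply/funext => x /=; rewrite tuple_of_mxK.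
Qed.

Lemma rescales_lebesgue_mx m n (c : R) (c0 : 0 < c) (D : 'M[R]_(m, n)) :
  rescales (@lebesgue_mx R m n) (fun A => c *: A + D) (c ^+ (m * n)).
Proof.
apply: (@rescales_can_pushforward _ _ _ _ R (lebesgue_tuple R (m * n)) _ _
  (@measurable_mx_of_tuple R m n) (@measurable_tuple_of_mx R m n)
  (@mx_of_tupleK R m n) (tuple_affine c (tuple_of_mx D))).
  move=> t; apply/matrixP => i j.
  by rewrite [RHS]mx_of_tupleE tnth_mktuple tnth_tuple_of_mx mxE [X in X + _]mxE mx_of_tupleE.
exact: rescales_lebesgue_tuple.
Qed.

Definition mx_box m n (B : R) : set 'M[R]_(m, n) :=
  [set A | forall i j, `|A i j| <= B].

Lemma lebesgue_mx_box_lty m n (B : R) : (lebesgue_mx R m n (@mx_box m n B) < +oo)%E.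
Proof.
rewrite /= /can_pushforward /pushforward (_ : _ @^-1` _ = @tuple_box R _ B).
  exact: lebesgue_tuple_box_lty.
apply/seteqP; split => t /=; rewrite /preimage/= => h.
  by move=> k; case/mxvec_indexP: k => i j; rewrite -mx_of_tupleE.
by move=> i j; rewrite mx_of_tupleE.
Qed.

Lemma measurable_mx_box m n (B : R) : measurable (@mx_box m n B).
Proof.
rewrite (_ : mx_box B = \bigcap_(i in [set: 'I_m]) \bigcap_(j in [set: 'I_n])
    ((fun A : 'M[R]_(m, n) => `|A i j|) @^-1` `]-oo, B])).
  apply: fin_bigcap_measurable => // i _; apply: fin_bigcap_measurable => // j _.
  rewrite -[X in measurable X]setTI.
  have mA : measurable_fun setT (fun A : 'M[R]_(m, n) => `|A i j|).
    exact: measurableT_comp (measurable_entry i j).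
  exact: mA.
apply/seteqP; split => [A h i _ j _|A h i j] /=; first by rewrite in_itv/=; exact: h.
by have := h i I j I; rewrite /= in_itv.
Qed.

End matrix_space.

Section observation_space.
Context (R : realType) (q m p : nat).

Local Notation V := ('M[R]_(q, p) * 'M[R]_(m, p))%type.
Local Notation mu := (@lebesgue_zu R q m p).

Definition affine_zu (c : R) (d x : V) : V := (c *: x.1 + d.1, c *: x.2 + d.2).

Lemma measurable_zu1 i j : measurable_fun setT (fun x : V => x.1 i j).
Proof.
exact: measurableT_comp (measurable_entry i j) measurable_fst.
Qed.

Lemma measurable_zu2 i j : measurable_fun setT (fun x : V => x.2 i j).
Proof.
exact: measurableT_comp (measurable_entry i j) measurable_snd.
Qed.

Lemma measurable_affine_zu c d : measurable_fun setT (affine_zu c d).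
Proof.
apply: measurable_fun_pair; apply: measurable_fun_mx => i j.
  under [X in measurable_fun _ X]eq_fun do rewrite !mxE.
  by apply: measurable_funD => //; apply: measurable_funM => //; exact: measurable_zu1.
under [X in measurable_fun _ X]eq_fun do rewrite !mxE.
by apply: measurable_funD => //; apply: measurable_funM => //; exact: measurable_zu2.
Qed.

Lemma rescales_lebesgue_zu (c : R) (c0 : 0 < c) (d : V) :
  rescales mu (affine_zu c d) (c ^+ ((q + m) * p)).
Proof.
rewrite mulnDl exprD.
apply: (@rescales_product _ _ _ _ R (lebesgue_mx R q p) (lebesgue_mx R m p)
  (fun A => c *: A + d.1) (fun A => c *: A + d.2)).
- exact/exprn_ge0/ltW.
- exact/exprn_ge0/ltW.
- apply: measurable_fun_mx => i j; under [X in measurable_fun _ X]eq_fun do rewrite !mxE.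
  by apply: measurable_funD => //; apply: measurable_funM => //; exact: measurable_entry.
- apply: measurable_fun_mx => i j; under [X in measurable_fun _ X]eq_fun do rewrite !mxE.
  by apply: measurable_funD => //; apply: measurable_funM => //; exact: measurable_entry.
- exact: rescales_lebesgue_mx.
- exact: rescales_lebesgue_mx.
Qed.

Lemma ge0_integral_affine_zu (c : R) (c0 : 0 < c) (d : V) (g : V -> \bar R) :
  measurable_fun [set: V] g -> (forall x, 0 <= g x)%E ->
  ((c ^+ ((q + m) * p))%:E * \int[mu]_x g (affine_zu c d x) = \int[mu]_x g x)%E.
Proof.
move=> mg g0; apply: ge0_integral_rescales => //; first exact/exprn_ge0/ltW.
- exact: measurable_affine_zu.
- exact: rescales_lebesgue_zu.
Qed.

Definition zu_box (B : R) : set V := @mx_box R q p B `*` @mx_box R m p B.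

Lemma measurable_zu_box B : measurable (zu_box B).
Proof. by apply: measurableX; exact: measurable_mx_box. Qed.

Lemma lebesgue_zu_box_lty B : (mu (zu_box B) < +oo)%E.
Proof.
rewrite /lebesgue_zu /sigma_finite_product product_measure1E; try exact: measurable_mx_box.
by rewrite lte_mul_pinfty ?ge0_fin_numE//; exact: lebesgue_mx_box_lty.
Qed.

End observation_space.

(** * The binomial series *)

Section binomial_series.
Context (R : realType).
Implicit Types (a x y z w : R) (n N : nat).

(** The rising factorial a (a + 1) ... (a + n - 1) divided by n!. *)
Fixpoint bincoef a n : R :=
  if n is k.+1 then bincoef a k * (a + k%:R) / k.+1%:R else 1.

(* Partial sums of the series of (1 - x)^(- a). *)
Definition binsum a N x : R := \sum_(n < N.+1) bincoef a n * x ^+ n.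

Lemma bincoefS a n : n.+1%:R * bincoef a n.+1 = (a + n%:R) * bincoef a n.
Proof. by rewrite /= mulrC divfK ?pnatr_eq0// mulrC. Qed.

Lemma bincoef_gt0 a n : 0 < a -> 0 < bincoef a n.
Proof.
move=> a0; elim: n => //= n IH; rewrite divr_gt0// mulr_gt0//.
by rewrite ltr_wpDr.
Qed.

(** The ratio of consecutive coefficients is (a + n) / (n + 1). The condition alpha >= 1 enters
    mainly here. *)
Lemma bincoef_nd a n : 1 <= a -> bincoef a n <= bincoef a n.+1.
Proof.
move=> a1; have a0 : 0 < a by exact: lt_le_trans a1.
rewrite -(@ler_pM2l _ n.+1%:R)// bincoefS ler_pM2r ?bincoef_gt0//.
by rewrite -natr1 addrC lerD2r.
Qed.

(** Telescoping: a c_n = (n + 1) c_(n+1) - n c_n. *)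
Lemma bincoef_sum a N : a * (\sum_(n < N.+1) bincoef a n) = (a + N%:R) * bincoef a N.
Proof.
elim: N => [|N IH]; first by rewrite big_ord1/= addr0.
by rewrite big_ord_recr/= mulrDr IH -bincoefS -[bincoef a N * _ / _]/(bincoef a N.+1) mulrDl addrC.
Qed.

(** Rewrites the truncation error at exponent [a] as a single term of the series at exponent
    [a + 1], which is how its decay is obtained. *)
Lemma bincoef_succ a N : 0 < a ->
  a * bincoef (a + 1) N = (a + N%:R) * bincoef a N.
Proof.
move=> a0; elim: N => [|N IH]; first by rewrite /= addr0.
apply: (@mulfI _ N.+1%:R) => //; rewrite mulrCA bincoefS mulrCA IH.
rewrite -[in RHS]natr1; move: (bincoefS a N); rewrite -natr1 => E.
rewrite [RHS]mulrCA E; ring.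
Qed.

Lemma binsumS a N x : binsum a N.+1 x = binsum a N x + bincoef a N.+1 * x ^+ N.+1.
Proof. by rewrite /binsum big_ord_recr. Qed.

Lemma binsum_ge1 a N x : 0 < a -> 0 <= x -> 1 <= binsum a N x.
Proof.
move=> a0 x0; rewrite /binsum big_ord_recl/= expr0 mulr1 lerDl sumr_ge0// => i _.
by rewrite mulr_ge0 ?exprn_ge0// ltW// (bincoef_gt0 (lift ord0 i)).
Qed.

(* The divided difference (x ^ n - z ^ n) / (x - z). *)
Fixpoint divpow n x z : R := if n is k.+1 then x * divpow k x z + z ^+ k else 0.

(** The divided difference of [binsum], equal to its derivative when x = z. *)
Definition bindiv a N x z : R := \sum_(n < N.+1) bincoef a n * divpow n x z.

Lemma bindivS a N x z :
  bindiv a N.+1 x z = bindiv a N x z + bincoef a N.+1 * divpow N.+1 x z.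
Proof. by rewrite /bindiv big_ord_recr. Qed.

Lemma divpow_ge0 n x z : 0 <= x -> 0 <= z -> 0 <= divpow n x z.
Proof.
by move=> x0 z0; elim: n => //= n IH; rewrite addr_ge0 ?mulr_ge0 ?exprn_ge0.
Qed.

Lemma divpow_le n x z w : 0 <= x <= w -> 0 <= z <= w ->
  divpow n.+1 x z <= n.+1%:R * w ^+ n.
Proof.
move=> /andP[x0 xw] /andP[z0 zw]; elim: n => [|n IH].
  by rewrite /= mulr0 add0r !expr0 mulr1.
have -> : divpow n.+2 x z = x * divpow n.+1 x z + z ^+ n.+1 by [].
rewrite -[n.+2%:R]natr1 mulrDl mul1r lerD ?lerXn2r ?nnegrE//; last exact: le_trans zw.
by rewrite exprS mulrCA ler_pM ?divpow_ge0.
Qed.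

Lemma bindiv_ge0 a N x z : 0 < a -> 0 <= x -> 0 <= z -> 0 <= bindiv a N x z.
Proof.
by move=> a0 x0 z0; rewrite sumr_ge0// => i _; rewrite mulr_ge0 ?divpow_ge0// ltW// bincoef_gt0.
Qed.

(* The coefficients are nondecreasing, so Abel summation leaves only the boundary term. *)
Lemma bindiv_ge a N x z : 1 <= a -> 0 <= x -> 0 <= z ->
  binsum a N z - bincoef a N * divpow N.+1 x z <= (1 - x) * bindiv a N x z.
Proof.
move=> a1 x0 z0; have a0 : 0 < a by exact: lt_le_trans a1.
elim: N => [|N IH]; first by rewrite /binsum /bindiv !big_ord1/= expr0; lra.
rewrite binsumS bindivS [leRHS]mulrDr.
have D0 := divpow_ge0 N.+1 x0 z0; have cc := bincoef_nd N a1.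
have E : divpow N.+2 x z = x * divpow N.+1 x z + z ^+ N.+1 by [].
have h : 0 <= (bincoef a N.+1 - bincoef a N) * divpow N.+1 x z.
  by rewrite mulr_ge0// subr_ge0.
move: (bincoef a N.+1) (divpow N.+1 x z) (divpow N.+2 x z) E IH h {D0 cc} => c D D' -> IH h.
have -> : (1 - x) * (c * D) = c * D - c * (x * D + z ^+ N.+1) + c * z ^+ N.+1 by ring.
move: IH h; rewrite mulrBl; lra.
Qed.

(** Since y <= 1, the power y^N is the smallest of those in [binsum], and [bincoef_sum] evaluates
    the sum of the coefficients. The bound is uniform in N and later serves as the dominating
    constant. *)
Lemma binerr_le a N y : 1 <= a -> 0 <= y <= 1 ->
  N.+1%:R * bincoef a N * y ^+ N <= a * binsum a N y.
Proof.
move=> a1 /andP[y0 y1]; have a0 : 0 < a by exact: lt_le_trans a1.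
apply: (@le_trans _ _ (a * (\sum_(n < N.+1) bincoef a n) * y ^+ N)).
  rewrite bincoef_sum -mulrA -[leRHS]mulrA ler_wpM2r ?mulr_ge0 ?exprn_ge0//.
    by rewrite ltW// bincoef_gt0.
  by rewrite -natr1 addrC lerD2r.
rewrite -mulrA ler_wpM2l ?(ltW a0)// mulr_suml ler_sum// => i _.
rewrite ler_wpM2l ?(ltW (bincoef_gt0 _ _))//.
by rewrite ler_wiXn2l// -ltnS.
Qed.

(** The term n = 0 vanishes through the factor [n%:R], so the value of [n.-1] there is harmless. *)
Definition dbinsum a N x : R := \sum_(n < N.+1) bincoef a n * (n%:R * x ^+ n.-1).

Lemma dbinsumS a N x :
  dbinsum a N.+1 x = dbinsum a N x + bincoef a N.+1 * (N.+1%:R * x ^+ N).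
Proof. by rewrite /dbinsum big_ord_recr. Qed.

Lemma is_derive_binsum a N x : is_derive x 1 (binsum a N) (dbinsum a N x).
Proof.
elim: N => [|N IH].
  rewrite /dbinsum big_ord1/= mul0r mulr0.
  rewrite (_ : binsum a 0 = cst 1); first exact: is_derive_cst.
  by apply/funext => y; rewrite /binsum big_ord1/= expr0 mulr1.
rewrite (_ : binsum a N.+1 = binsum a N + bincoef a N.+1 \*: (id ^+ N.+1)).
  by apply: is_derive_eq; rewrite dbinsumS /GRing.scale/= mulr1.
by apply/funext => y; rewrite binsumS /= fctE; congr (_ + _ * _); rewrite fctE.
Qed.

(** The full series g solves (1 - x) g' = a g; truncation leaves only the top term. *)
Lemma dbinsumE a N x :
  (1 - x) * dbinsum a N x - a * binsum a N x = - ((a + N%:R) * bincoef a N * x ^+ N).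
Proof.
elim: N => [|N IH]; first by rewrite /dbinsum /binsum !big_ord1/= expr0; ring.
rewrite binsumS dbinsumS.
have := bincoefS a N; move: (bincoef a N.+1) => c cE.
move: IH; rewrite -cE exprS -!natr1 => IH.
transitivity ((1 - x) * dbinsum a N x - a * binsum a N x +
  (N%:R + 1) * c * x ^+ N - (a + (N%:R+ 1)) * c * (x * x ^+ N)); first ring.
by rewrite IH; ring.
Qed.

(** The mean value theorem for (1 - x)^a [binsum a N x], which is 1 at 0. By [dbinsumE] its
    derivative is just the truncation term, so the sign of the remainder and its size can both be
    read off. *)
Lemma binsum_mean a N y : 0 < a -> 0 <= y < 1 -> exists2 x, 0 <= x <= y &
  (1 - y) `^ a * binsum a N y - 1 =
  - ((1 - x) `^ (a - 1) * ((a + N%:R) * bincoef a N * x ^+ N)) * y.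
Proof.
move=> a0 /andP[y0 y1].
pose f x := (1 - x) `^ a * binsum a N x.
pose df x := - ((1 - x) `^ (a - 1) * ((a + N%:R) * bincoef a N * x ^+ N)).
have df_f x : x < 1 -> is_derive x 1 f (df x).
  move=> x1; have x10 : 0 < 1 - x by rewrite subr_gt0.
  have d1 : is_derive x 1 (fun x => 1 - x) (-1).
    by rewrite (_ : (fun _ => _) = cst 1 - id)//; apply: is_derive_eq; rewrite sub0r.
  have d2 : is_derive x 1 (fun x => (1 - x) `^ a) (- (a * (1 - x) `^ (a - 1))).
    have h := is_derive1_powR a x10.
    have := @is_derive1_comp R (fun t => t `^ a) (fun x => 1 - x) x _ _ h d1.
    by rewrite mulrN1.
  have d3 := is_derive_binsum a N x.
  have d4 := is_deriveM d2 d3; apply: (is_derive_eq d4).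
  have -> : df x = (1 - x) `^ (a - 1) * ((1 - x) * dbinsum a N x - a * binsum a N x).
    by rewrite dbinsumE mulrN.
  rewrite /GRing.scale/= -(@mulr_powRB1 _ (1 - x) a (ltW x10) a0).
  ring.
have [x xy fy] : exists2 c, c \in `[0, y] & f y - f 0 = df c * (y - 0).
  apply: MVT_segment => //.
    by move=> x; rewrite in_itv/= => /andP[_ xy]; apply: df_f; exact: lt_trans y1.
  apply: derivable_within_continuous => x; rewrite in_itv/= => /andP[_ xy].
  by apply: ex_derive; apply: df_f; exact: le_lt_trans y1.
exists x; first by move: xy; rewrite in_itv.
have f0 : f 0 = 1.
  rewrite /f subr0 powR1 mul1r /binsum big_ord_recl/= expr0 mulr1 big1 ?addr0// => i _.
  by rewrite expr0n mulr0.
by move: fy; rewrite f0 subr0.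
Qed.

Lemma binsum_le a N y : 0 < a -> 0 <= y < 1 ->
  binsum a N y <= ((1 - y) `^ a)^-1.
Proof.
move=> a0 yy; have [x /andP[x0 xy]] := binsum_mean N a0 yy.
move: yy => /andP[y0 y1] E; have p0 : 0 < (1 - y) `^ a by rewrite powR_gt0// subr_gt0.
rewrite -(ler_pM2l p0) divff ?gt_eqF// -subr_le0 E mulNr oppr_le0.
rewrite !mulr_ge0 ?powR_ge0 ?exprn_ge0//; first by rewrite addr_ge0// ltW.
by rewrite ltW// bincoef_gt0.
Qed.

(** With z halfway between y and 1, the coefficient at exponent [a + 1] times z^N is one term of a
    sum bounded by (1 - z)^(-a-1). What remains is the geometric factor (y / z)^N. *)
Lemma cvg_binerr a y : 0 < a -> 0 <= y < 1 ->
  (a + N%:R) * bincoef a N * y ^+ N @[N --> \oo] --> 0.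
Proof.
move=> a0 /andP[y0 y1]; pose z := (1 + y) / 2.
have z0 : 0 < z by rewrite /z; lra.
have z1 : 0 <= z < 1 by rewrite /z; lra.
have yz : 0 <= y / z < 1.
  by rewrite divr_ge0 ?(ltW z0)//= ltr_pdivrMr// mul1r /z; lra.
have a10 : 0 < a + 1 by lra.
pose C := a * ((1 - z) `^ (a + 1))^-1.
have h N : 0 <= (a + N%:R) * bincoef a N * y ^+ N <= C * (y / z) ^+ N.
  rewrite -bincoef_succ// !mulr_ge0 ?(ltW a0) ?exprn_ge0 ?(ltW (bincoef_gt0 _ _))//=.
  rewrite /C -!mulrA ler_wpM2l ?(ltW a0)//.
  rewrite -[y in leLHS](divfK (lt0r_neq0 z0)) exprMn mulrCA [leRHS]mulrC.
  apply: ler_wpM2l; first by rewrite exprn_ge0//; case/andP: yz.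
  apply: le_trans (binsum_le N a10 z1); rewrite /binsum big_ord_recr/= lerDr sumr_ge0// => i _.
  by rewrite mulr_ge0 ?exprn_ge0 ?(ltW z0) ?(ltW (bincoef_gt0 _ _)).
apply: (@squeeze_cvgr _ _ _ _ (fun=> 0) (fun N => C * (y / z) ^+ N)).
- by apply: nearW.
- exact: cvg_cst.
- rewrite -[X in _ --> X](mulr0 C); apply: cvgMr; apply: cvg_expr.
  by case/andP: yz => yz0 yz1; rewrite ger0_norm.
Qed.

Lemma cvg_binsum a y : 1 <= a -> 0 <= y < 1 ->
  binsum a N y @[N --> \oo] --> (1 - y) `^ (- a).
Proof.
move=> a1 yy; have a0 : 0 < a by exact: lt_le_trans a1.
have p0 : 0 < (1 - y) `^ a by case/andP: yy => ? ?; rewrite powR_gt0// subr_gt0.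
suff h : (1 - y) `^ a * binsum a N y @[N --> \oo] --> (1 : R).
  rewrite powRN -[X in _ --> X]mulr1.
  rewrite (_ : (fun N => _) = (fun N => ((1 - y) `^ a)^-1 * ((1 - y) `^ a * binsum a N y))).
    exact: cvgMr.
  by apply/funext => N; rewrite mulKf// gt_eqF.
apply/subr_cvg0.
apply: (@squeeze_cvgr _ _ _ _ (fun N => - ((a + N%:R) * bincoef a N * y ^+ N)) (fun=> 0)).
- apply: nearW => N; have [x /andP[x0 xy] ->] := binsum_mean N a0 yy.
  case/andP: yy => y0 y1; rewrite mulNr oppr_le0 lerN2.
  have b0 : 0 <= (a + N%:R) * bincoef a N.
    by rewrite mulr_ge0// ?(ltW (bincoef_gt0 _ _))// addr_ge0// ltW.
  (* The exponent a - 1 is nonnegative and the base is at most 1. *)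
  have q1 : (1 - x) `^ (a - 1) <= 1.
    have e1 : (1 : R) `^ (a - 1) = 1 by rewrite powR1.
    by rewrite -[leRHS]e1 ge0_ler_powR ?nnegrE; lra.
  have xN : x ^+ N <= y ^+ N by rewrite lerXn2r ?nnegrE.
  have xN0 : 0 <= x ^+ N by rewrite exprn_ge0.
  have q0 := powR_ge0 (1 - x) (a - 1).
  have m0 := mulr_ge0 b0 xN0; have m1 := mulr_ge0 q0 m0.
  apply/andP; split; last exact: mulr_ge0.
  apply: (@le_trans _ _ ((a + N%:R) * bincoef a N * x ^+ N)); last exact: ler_wpM2l.
  rewrite -[leRHS]mulr1 ler_pM ?(ltW y1)//.
  by rewrite -[leRHS]mul1r ler_wpM2r.
- by rewrite -oppr0; apply: cvgN; exact: cvg_binerr.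
- exact: cvg_cst.
Qed.

End binomial_series.

(** * Divergence of polynomial matrix fields *)

Section spectral_calculus.
Context (R : realType) (r : nat).
Variables (V : 'M[R]_r) (VV : V^T *m V = 1%:M).
Implicit Types (f g : 'I_r -> R).

Definition specmx (V : 'M[R]_r) f : 'M[R]_r := V *m diag_mx (\row_i f i) *m V^T.

Let VVt : V *m V^T = 1%:M.
Proof. exact: mulmx1C. Qed.

Lemma specmx_conj f : V^T *m specmx V f *m V = diag_mx (\row_i f i).
Proof. by rewrite /specmx !mulmxA VV mul1mx -mulmxA VV mulmx1. Qed.

Lemma specmx1 : specmx V (fun=> 1) = 1%:M.
Proof.
rewrite /specmx (_ : diag_mx _ = 1%:M) ?mulmx1//.
by rewrite -diag_const_mx; congr diag_mx; apply/rowP => i; rewrite !mxE.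
Qed.

Lemma specmxM f g : specmx V f *m specmx V g = specmx V (fun i => f i * g i).
Proof.
rewrite /specmx !mulmxA -[_ *m V^T *m V]mulmxA VV mulmx1.
by rewrite -[V *m _ *m _]mulmxA mulmx_diag; congr (_ *m diag_mx _ *m _); apply/rowP => i; rewrite !mxE.
Qed.

Lemma specmxZ a f : a *: specmx V f = specmx V (fun i => a * f i).
Proof.
rewrite /specmx scalemxAl scalemxAr; congr (_ *m _ *m _).
by rewrite -linearZ; congr diag_mx; apply/rowP => i; rewrite !mxE.
Qed.

Lemma specmxD f g : specmx V f + specmx V g = specmx V (fun i => f i + g i).
Proof.
rewrite /specmx -mulmxDl -mulmxDr; congr (_ *m _ *m _).
by rewrite -raddfD; congr diag_mx; apply/rowP => i; rewrite !mxE.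
Qed.

Lemma specmx_sum I (s : seq I) (F : I -> 'I_r -> R) :
  \sum_(n <- s) specmx V (F n) = specmx V (fun i => \sum_(n <- s) F n i).
Proof.
elim: s => [|n s IH].
  rewrite big_nil; apply/esym; rewrite /specmx (_ : diag_mx _ = 0) ?mulmx0 ?mul0mx//.
  by apply/matrixP => i j; rewrite !mxE big_nil mul0rn.
rewrite big_cons IH specmxD; congr (specmx V _); apply/funext => i.
by rewrite big_cons.
Qed.

Lemma specmxX f n : specmx V f ^+ n = specmx V (fun i => f i ^+ n).
Proof.
elim: n => [|n IH]; first by rewrite expr0 -[LHS]/(1%:M) -specmx1; congr (specmx V _); apply/funext.
by rewrite exprS IH [LHS]specmxM; congr (specmx V _); apply/funext => i; rewrite exprS.
Qed.

Lemma specmx_trace f : \tr (specmx V f) = \sum_i f i.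
Proof.
rewrite /specmx mxtrace_mulC mulmxA VV mul1mx mxtrace_diag.
by apply: eq_bigr => i _; rewrite mxE.
Qed.

End spectral_calculus.

Section binomial_matrix.
Context (R : realType) (r : nat).
Implicit Types (Y B : 'M[R]_r) (a : R) (n N : nat).

(** The derivative of Y^n in the direction B by the Leibniz rule, with the order of the factors kept
    because Y and B need not commute. *)
Fixpoint dpowmx Y B n : 'M[R]_r :=
  if n is k.+1 then Y *m dpowmx Y B k + B *m Y ^+ k else 0.

Definition binmx a N Y : 'M[R]_r := \sum_(n < N.+1) bincoef a n *: Y ^+ n.

Definition dbinmx a N Y B : 'M[R]_r := \sum_(n < N.+1) bincoef a n *: dpowmx Y B n.

Lemma binmx_spec (V : 'M[R]_r) (VV : V^T *m V = 1%:M) a N y :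
  binmx a N (specmx V y) = specmx V (fun i => binsum a N (y i)).
Proof.
rewrite /binmx (eq_bigr (fun n : 'I_N.+1 => specmx V (fun i => bincoef a n * y i ^+ n))).
  by rewrite specmx_sum.
by move=> n _; rewrite specmxX// specmxZ.
Qed.

(** The Daleckii-Krein formula. In an eigenbasis of Y, left and right multiplication by Y scale the
    entry (i, j) by y_i and y_j, so the recursion of [dpowmx] becomes that of [divpow]. *)
Lemma dbinmx_spec (V : 'M[R]_r) (VV : V^T *m V = 1%:M) a N y B i j :
  (V^T *m dbinmx a N (specmx V y) B *m V) i j =
  bindiv a N (y i) (y j) * (V^T *m B *m V) i j.
Proof.
have VVt : V *m V^T = 1%:M by exact: mulmx1C.
have dpowE n : (V^T *m dpowmx (specmx V y) B n *m V) i j =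
    divpow n (y i) (y j) * (V^T *m B *m V) i j.
  elim: n => [|n IH]; first by rewrite /= mulmx0 mul0mx mxE mul0r.
  rewrite [dpowmx _ _ _]/= [divpow _ _ _]/= mulmxDr mulmxDl mxE mulrDl; congr (_ + _).
    rewrite {1}/specmx !mulmxA VV mul1mx -mulmxA -mulmxA mul_diag_mx mxE mxE.
    by rewrite -mulrA -IH mulmxA.
  rewrite specmxX// /specmx !mulmxA -[_ *m V^T *m V]mulmxA VV mulmx1 mul_mx_diag mxE mxE.
  by rewrite [X in _ * X]mxE mulrC.
rewrite /dbinmx /bindiv mulmx_sumr mulmx_suml summxE mulr_suml.
apply: eq_bigr => n _.
by rewrite -scalemxAr -scalemxAl mxE dpowE mulrA.
Qed.

End binomial_matrix.

Lemma mulmx_entry (R : pzRingType) m n k (A : 'M[R]_(m, n)) (B : 'M[R]_(n, k)) i j :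
  (A *m B) i j = \sum_l A i l * B l j.
Proof. by rewrite mxE. Qed.

Lemma mul_mx_diag_entry (R : comPzRingType) m n (A : 'M[R]_(m, n)) (c : 'I_n -> R) i j :
  (A *m diag_mx (\row_k c k)) i j = A i j * c j.
Proof. by rewrite mul_mx_diag !mxE. Qed.

Section divergence_sums.
Context (R : realType) (v r : nat).
Variables (X : 'M[R]_(v, r)) (V : 'M[R]_r) (l : 'I_r -> R).
Hypotheses (VV : V^T *m V = 1%:M) (XX : X^T *m X = specmx V l).

Definition dgram (X : 'M[R]_(v, r)) (D : 'M[R]_(v, r)) : 'M[R]_r :=
  D^T *m X + X^T *m D.

Let XV := X *m V.

Let XVl k k' : \sum_i XV i k * XV i k' = l k *+ (k == k').
Proof.
have E : XV^T *m XV = diag_mx (\row_i l i).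
  by rewrite /XV trmx_mul mulmxA -[_ *m X^T *m X]mulmxA XX specmx_conj.
have := congr1 (fun M : 'M[R]_r => M k k') E; rewrite !mxE => <-.
by apply: eq_bigr => i _; rewrite !mxE.
Qed.

Let VVk k k' : \sum_j V j k * V j k' = (k == k')%:R.
Proof.
have := congr1 (fun M : 'M[R]_r => M k k') VV; rewrite !mxE => <-.
by apply: eq_bigr => i _; rewrite mxE.
Qed.

Let dgramV i j k k' : (V^T *m dgram X (delta_mx i j) *m V) k k' =
  V j k * XV i k' + XV i k * V j k'.
Proof.
rewrite /dgram mulmxDr mulmxDl mxE; congr (_ + _).
  rewrite trmx_delta -mulmxA -mulmxA -/XV mulmxA mxE (bigD1 i)//= big1 ?addr0.
    rewrite mxE (bigD1 j)//= big1 ?addr0 ?mxE ?eqxx ?mulr1//.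
    by move=> k0 /negbTE k0j; rewrite !mxE k0j mulr0.
  move=> k0 /negbTE k0j; rewrite mxE big1 ?mul0r// => k1 _.
  by rewrite !mxE k0j andbF mulr0.
rewrite mulmxA -trmx_mul -/XV mxE (bigD1 j)//= big1 ?addr0.
  rewrite mxE (bigD1 i)//= big1 ?addr0 ?mxE ?eqxx ?mulr1//.
  by move=> k0 /negbTE k0j; rewrite !mxE k0j mulr0.
move=> k0 /negbTE k0j; rewrite mxE big1 ?mul0r// => k1 _.
by rewrite !mxE k0j andbF mulr0.
Qed.

Variables (a s : R) (N : nat).
Let y i := 1 - s * l i.
Let Y := specmx V y.
Let dK i j := dbinmx a N Y (- s *: dgram X (delta_mx i j)).
Let d k k' := bindiv a N (y k) (y k').

Let dKE i j : dK i j = V *m (\matrix_(k, k') (d k k' *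
   (- s * (V j k * XV i k' + XV i k * V j k')))) *m V^T.
Proof.
have VVt : V *m V^T = 1%:M by exact: mulmx1C.
rewrite -[LHS]mul1mx -[LHS]mulmx1 -VVt -!mulmxA; congr (_ *m _); rewrite !mulmxA; congr (_ *m _).
apply/matrixP => k k'; rewrite dbinmx_spec// [RHS]mxE; congr (_ * _).
by rewrite -scalemxAr -scalemxAl mxE dgramV.
Qed.

(** Summing over i and j contracts the columns of V, which are orthonormal, and those of X V, which
    are orthogonal with squared norms l. One contraction survives only for k = k', the other for
    every pair; these give the two sums. *)
Lemma divergence_dbinmx (c1 c2 : 'I_r -> R) :
  \sum_i \sum_j (X *m specmx V c1 *m dK i j *m specmx V c2) i j =
  - (\sum_k c1 k * c2 k * d k k * (s * l k) +
     \sum_k \sum_k' c1 k * c2 k' * d k k' * (s * l k)).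
Proof.
(* The contribution of the pair of eigenvectors (k, k') to the entry (i, j). *)
pose F k k' i j := - s * (c1 k * c2 k' * d k k') *
  ((XV i k * XV i k') * (V j k * V j k') + (XV i k * XV i k) * (V j k' * V j k')).
transitivity (\sum_i \sum_j \sum_k \sum_k' F k k' i j).
  apply: eq_bigr => i _; apply: eq_bigr => j _.
  rewrite dKE /specmx !mulmxA -/XV -[_ *m V^T *m V]mulmxA VV mulmx1.
  rewrite -[_ *m V^T *m V]mulmxA VV mulmx1 mulmx_entry.
  rewrite [LHS](eq_bigr (fun k' => \sum_k F k k' i j)); first by rewrite exchange_big.
  move=> k' _; rewrite mul_mx_diag_entry mulmx_entry !mulr_suml; apply: eq_bigr => k _.
  rewrite mul_mx_diag_entry [X in _ * X * _ * _]mxE [V^T _ _]mxE /F; ring.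
transitivity (\sum_k \sum_k' \sum_i \sum_j F k k' i j).
  rewrite (eq_bigr (fun i => \sum_k \sum_j \sum_k' F k k' i j)); last first.
    by move=> i _; rewrite exchange_big.
  rewrite exchange_big; apply: eq_bigr => k _.
  rewrite (eq_bigr (fun i => \sum_k' \sum_j F k k' i j)); last first.
    by move=> i _; rewrite exchange_big.
  by rewrite exchange_big.
rewrite (eq_bigr (fun k => \sum_k' - (c1 k * c2 k' * d k k' * (s * l k)) *+ (k == k')
    - \sum_k' c1 k * c2 k' * d k k' * (s * l k))).
  rewrite sumrB opprD; congr (_ - _); rewrite -sumrN; apply: eq_bigr => k _.
  rewrite (bigD1 k)//= eqxx mulr1n big1 ?addr0// => k' /negbTE kk'.
  by rewrite eq_sym kk' mulr0n.
move=> k _; rewrite -sumrB; apply: eq_bigr => k' _.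
rewrite /F; under eq_bigr do rewrite -mulr_sumr big_split/= -!mulr_sumr !VVk eqxx.
rewrite -mulr_sumr big_split/= -!mulr_suml !XVl eqxx.
case: eqVneq => [->|_] /=; rewrite ?mulr1n ?mulr0n; ring.
Qed.

(** A trace sees only the diagonal of the Daleckii-Krein formula, so a single sum over eigenvalues
    remains. *)
Lemma divergence_trace (c : 'I_r -> R) :
  \sum_i \sum_j \tr (dK i j) * (X *m specmx V c) i j =
  - 2 * \sum_k d k k * c k * (s * l k).
Proof.
pose F k k' i j := - 2 * s * (d k k * c k') * ((XV i k * XV i k') * (V j k * V j k')).
transitivity (\sum_i \sum_j \sum_k \sum_k' F k k' i j).
  apply: eq_bigr => i _; apply: eq_bigr => j _.
  rewrite dKE mxtrace_mulC mulmxA VV mul1mx /mxtrace mulr_suml; apply: eq_bigr => k _.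
  rewrite /specmx !mulmxA -/XV mulmx_entry mulr_sumr; apply: eq_bigr => k' _.
  rewrite mul_mx_diag_entry [V^T _ _]mxE [X in X * _ = _]mxE /F; ring.
transitivity (\sum_k \sum_k' \sum_i \sum_j F k k' i j).
  rewrite (eq_bigr (fun i => \sum_k \sum_j \sum_k' F k k' i j)); last first.
    by move=> i _; rewrite exchange_big.
  rewrite exchange_big; apply: eq_bigr => k _.
  rewrite (eq_bigr (fun i => \sum_k' \sum_j F k k' i j)); last first.
    by move=> i _; rewrite exchange_big.
  by rewrite exchange_big.
rewrite mulr_sumr; apply: eq_bigr => k _.
rewrite (bigD1 k)//= [X in _ + X]big1 ?addr0.
  rewrite /F; under eq_bigr do rewrite -!mulr_sumr VVk eqxx mulr1.
  rewrite -mulr_sumr XVl eqxx mulr1n; ring.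
move=> k' /negbTE kk'.
rewrite /F; under eq_bigr do rewrite -!mulr_sumr VVk eq_sym kk' mulr0 mulr0.
by rewrite big1.
Qed.

End divergence_sums.

Section divergence_bound.
Context (R : realType).

(* A C^1 extension of 1 / t from [1, +oo[ to the whole line. *)
Definition recip1 (t : R) : R := if 1 <= t then t^-1 else 2 - t.

Definition drecip1 (t : R) : R := if 1 <= t then - t^-1 ^+ 2 else - 1.

(* For K = A^(- a) with trace at least 1 this is the function 2 Psi + Psi^2 of A. *)
Definition shrinkmx r (b : R) (K : 'M[R]_r) : 'M[R]_r :=
  (2 * b * recip1 (\tr K)) *: K + (b * recip1 (\tr K)) ^+ 2 *: (K *m K).

Definition dshrinkmx r (b : R) (K dK : 'M[R]_r) : 'M[R]_r :=
  (2 * b * (drecip1 (\tr K) * \tr dK)) *: K + (2 * b * recip1 (\tr K)) *: dK +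
  ((b ^+ 2 * (2 * recip1 (\tr K) * (drecip1 (\tr K) * \tr dK))) *: (K *m K) +
   (b * recip1 (\tr K)) ^+ 2 *: (dK *m K + K *m dK)).

(** The boundary term of the Abel summation relative to the trace of [binmx]. The sum of the y_i^N
    stands in for the largest of them, which keeps the expression symmetric in the eigenvalues. *)
Definition binerr r (a : R) N (y : 'I_r -> R) : R :=
  N.+1%:R * bincoef a N * (\sum_i y i ^+ N) / \sum_i binsum a N (y i).

Lemma binerr_ge0_le r a N (y : 'I_r -> R) : 1 <= a -> (0 < r)%N ->
  (forall i, 0 <= y i <= 1) -> 0 <= binerr a N y <= a.
Proof.
move=> a1 r0 yy; have a0 : 0 < a by exact: lt_le_trans a1.
have T0 : 0 < \sum_i binsum a N (y i).
  apply: (@lt_le_trans _ _ (\sum_(i < r) 1)); first by rewrite sumr_const card_ord ltr0n.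
  by apply: ler_sum => i _; apply: binsum_ge1 => //; case/andP: (yy i).
apply/andP; split.
  rewrite divr_ge0 ?(ltW T0)// !mulr_ge0 ?(ltW (bincoef_gt0 _ _))// sumr_ge0// => i _.
  by rewrite exprn_ge0//; case/andP: (yy i).
rewrite ler_pdivrMr// !mulr_sumr ler_sum// => i _.
exact: binerr_le.
Qed.

(* t stands for 1 / T; D, E are the diagonal and full double sums of the divergence. *)
Let bound_aux (b t T Q D1 D2 D3 E1 E2 E3 e v k : R) : 0 < b -> 0 < T -> t * T = 1 ->
  0 <= Q -> Q <= T ^+ 2 -> D2 <= D1 * T -> D3 <= D2 * T ->
  0 <= k -> k <= v ->
  D1 + (k - 1) * T - k ^+ 2 * e <= E1 ->
  D2 + (k - 1) * Q - k * e * T <= E2 -> D2 <= E3 ->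
  v * (2 * b * t * T + (b * t) ^+ 2 * Q) +
  ((2 * b) * (- t ^+ 2 * (- 2 * D2)) + (2 * b * t) * (- (D1 + E1)) +
   ((b ^+ 2 * (2 * t)) * (- t ^+ 2 * (- 2 * D3)) +
    (b * t) ^+ 2 * (- (D2 + E2) - (D2 + E3)))) <=
  (v - k + 1) * (2 * b + b ^+ 2) + (2 * b * k ^+ 2 + b ^+ 2 * k) * (e * t).
Proof.
move=> b0 T0 tT Q0 QT D21 D32 k0 kv hE1 hE2 hE3.
have t0 : 0 < t by rewrite -(pmulr_lgt0 _ T0) tT.
have b20 : 0 < b ^+ 2 by rewrite exprn_gt0.
have t20 : 0 < t ^+ 2 by rewrite exprn_gt0.
have q1 : t ^+ 2 * Q <= 1 by apply: le_trans (ler_wpM2l (ltW t20) QT) _; rewrite -exprMn tT expr1n.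
(* The derivative of 1 / T has the unfavourable sign, but D2 <= D1 T bounds it by exactly the
   diagonal terms that cancel it. In [h3] the inequality D3 <= D2 T does the same for the quadratic
   part. *)
have h1 : 2 * b * (t ^+ 2 * (2 * D2)) <= 2 * b * (t * (2 * D1)).
  rewrite ler_pM2l ?mulr_gt0// expr2 -mulrA ler_pM2l//.
  have := ler_wpM2l (ltW t0) D21; have -> : t * (D1 * T) = D1 * (t * T) by ring.
  by rewrite tT mulr1; lra.
have h2 : (2 * b * t) * (D1 + (D1 + (k - 1) * T - k ^+ 2 * e)) <= (2 * b * t) * (D1 + E1).
  by rewrite ler_pM2l ?mulr_gt0// lerD2l.
have h3 : b ^+ 2 * (2 * t) * (t ^+ 2 * (2 * D3)) <= b ^+ 2 * (t ^+ 2 * (4 * D2)).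
  have := ler_wpM2l (ltW t0) D32; have -> : t * (D2 * T) = D2 * (t * T) by ring.
  rewrite tT mulr1 => h.
  rewrite -mulrA ler_pM2l//.
  have := ler_wpM2l (ltW t20) h; lra.
have h4 : (b * t) ^+ 2 * (D2 + (D2 + (k - 1) * Q - k * e * T) + (D2 + D2)) <=
    (b * t) ^+ 2 * ((D2 + E2) + (D2 + E3)).
  by rewrite ler_pM2l ?exprn_gt0 ?mulr_gt0// lerD// lerD2l.
have h5 : b ^+ 2 * ((v - k + 1) * (t ^+ 2 * Q)) <= b ^+ 2 * (v - k + 1).
  by rewrite ler_pM2l// -[leRHS]mulr1 ler_wpM2l//; lra.
have E1t : (2 * b * t) * (D1 + (D1 + (k - 1) * T - k ^+ 2 * e)) =
    2 * b * (t * (2 * D1)) + 2 * b * (k - 1) * (t * T) - 2 * b * k ^+ 2 * (e * t) by ring.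
have E2t : (b * t) ^+ 2 * (D2 + (D2 + (k - 1) * Q - k * e * T) + (D2 + D2)) =
   b ^+ 2 * (t ^+ 2 * (4 * D2)) + b ^+ 2 * (k - 1) * (t ^+ 2 * Q) - b ^+ 2 * k * (e * t) * (t * T) by ring.
rewrite E1t tT in h2; rewrite E2t tT in h4.
have -> : 2 * b * t * T = 2 * b * (t * T) by ring.
rewrite tT exprMn; rewrite exprMn in h4.
lra.
Qed.

Let aux1 (D T e k : R) : D + (k - 1) * T - k ^+ 2 * e = D + (k * T - T - k * (k * e)).
Proof. ring. Qed.

Let aux2 (x e k : R) : (k - 1) * (x * (x - e)) = x ^+ 2 * (k - 1) - k * (e * x) + e * x.
Proof. ring. Qed.

Let aux3 (D Q T e k : R) : D + (k - 1) * Q - k * e * T = D + (Q * (k - 1) - k * (e * T)).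
Proof. ring. Qed.

(** With u_i = s l_i = 1 - y_i, the product of u_i and the divided difference at (i, j) is at least
    [binsum] at y_j, up to the boundary term. Summed over the r - 1 indices other than a given one,
    this lowers the factor v of the trace to v - r + 1. *)
Lemma divergence_le v r (X : 'M[R]_(v, r)) (V : 'M[R]_r) (l : 'I_r -> R)
    (a s b : R) N :
  V^T *m V = 1%:M -> X^T *m X = specmx V l -> 1 <= a -> 0 < b ->
  (0 < r)%N -> (r <= v)%N -> (forall i, 0 <= s * l i <= 1) ->
  \sum_i \sum_j (delta_mx i j *m shrinkmx b (binmx a N (1%:M - s *: (X^T *m X))) +
    X *m dshrinkmx b (binmx a N (1%:M - s *: (X^T *m X))) 
      (dbinmx a N (1%:M - s *: (X^T *m X)) (- s *: dgram X (delta_mx i j)))) i j <=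
  (v%:R - r%:R + 1) * (2 * b + b ^+ 2) +
  (2 * b * r%:R ^+ 2 + b ^+ 2 * r%:R) * binerr a N (fun i => 1 - s * l i).
Proof.
move=> VV XX a1 b0 r0 rv sl; pose y i := 1 - s * l i.
pose K := binmx a N (1%:M - s *: (X^T *m X)).
pose dK i j := dbinmx a N (1%:M - s *: (X^T *m X)) (- s *: dgram X (delta_mx i j)).
rewrite -/y -/K.
have a0 : 0 < a by exact: lt_le_trans a1.
have yy i : 0 <= y i <= 1 by have := sl i; rewrite /y; lra.
have y0 i : 0 <= y i by case/andP: (yy i).
have YE : 1%:M - s *: (X^T *m X) = specmx V y.
  by rewrite XX -(specmx1 VV) -scaleNr specmxZ specmxD; congr (specmx V _); apply/funext => i; rewrite /y mulNr.
pose kap i := binsum a N (y i).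
pose d i j := bindiv a N (y i) (y j).
pose u i := s * l i.
have KE : K = specmx V kap by rewrite /K YE binmx_spec.
pose T := \sum_i kap i.
have kap1 i : 1 <= kap i by exact: binsum_ge1.
have kap0 i : 0 <= kap i by exact: le_trans (kap1 i).
have r1 : 1 <= r%:R :> R by rewrite ler1n.
have T1 : 1 <= T.
  apply: (@le_trans _ _ (\sum_(i < r) 1)); first by rewrite sumr_const card_ord.
  exact: ler_sum.
have T0 : 0 < T by exact: lt_le_trans T1.
have trK : \tr K = T by rewrite KE specmx_trace.
have u0 i : 0 <= u i by case/andP: (sl i).
have d0 i j : 0 <= d i j by exact: bindiv_ge0.
(* A bound on the Abel boundary term for all pairs at once: [divpow N.+1] is at most N + 1 times the
   N-th power of the larger argument, hence at most N + 1 times the sum of all the y_i^N. *)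
pose e := N.+1%:R * bincoef a N * \sum_i y i ^+ N.
have e0 : 0 <= e.
  by rewrite !mulr_ge0 ?(ltW (bincoef_gt0 _ _))// sumr_ge0// => i _; rewrite exprn_ge0.
have hud i j : kap j - e <= u i * d i j.
  have := bindiv_ge N a1 (y0 i) (y0 j); rewrite {1}/y opprB addrCA subrr addr0; apply: le_trans.
  have -> : e = bincoef a N * (N.+1%:R * \sum_i y i ^+ N) by rewrite /e; ring.
  rewrite lerD2l lerN2 ler_wpM2l ?(ltW (bincoef_gt0 _ _))//.
  apply: (@le_trans _ _ (N.+1%:R * (Num.max (y i) (y j)) ^+ N)).
    by apply: divpow_le; rewrite y0 le_max lexx ?orbT.
  rewrite ler_wpM2l//; case: (leP (y i) (y j)) => _.
    by rewrite (bigD1 j)//= lerDl sumr_ge0// => k _; rewrite exprn_ge0.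
  by rewrite (bigD1 i)//= lerDl sumr_ge0// => k _; rewrite exprn_ge0.
have kapT i : kap i <= T.
  by rewrite /T (bigD1 i)//= lerDl sumr_ge0.
pose Q := \sum_i kap i ^+ 2.
pose D1 := \sum_k d k k * u k.
pose D2 := \sum_k kap k * d k k * u k.
pose D3 := \sum_k kap k ^+ 2 * d k k * u k.
pose E1 := \sum_k \sum_k' d k k' * u k.
pose E2 := \sum_k \sum_k' kap k' * d k k' * u k.
pose E3 := \sum_k \sum_k' kap k * d k k' * u k.
(* The product rule in spectral terms: the factor X yields the multiple of v; then come the
   derivatives of 1 / T and of K in the linear part, and likewise in the quadratic part. *)
have -> : \sum_i \sum_j (delta_mx i j *m shrinkmx b K + X *m dshrinkmx b K (dK i j)) i j =
  v%:R * (2 * b * T^-1 * T + (b * T^-1) ^+ 2 * Q) +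
  ((2 * b) * (- T^-1 ^+ 2 * (- 2 * D2)) + (2 * b * T^-1) * (- (D1 + E1)) +
   ((b ^+ 2 * (2 * T^-1)) * (- T^-1 ^+ 2 * (- 2 * D3)) +
    (b * T^-1) ^+ 2 * (- (D2 + E2) - (D2 + E3)))).
  have r1T : recip1 T = T^-1 by rewrite /recip1 T1.
  have d1T : drecip1 T = - T^-1 ^+ 2 by rewrite /drecip1 T1.
  rewrite [LHS](eq_bigr (fun i => \sum_j (delta_mx i j *m shrinkmx b K) i j +
      \sum_j (X *m dshrinkmx b K (dK i j)) i j)); last first.
    by move=> i _; rewrite -big_split/=; apply: eq_bigr => j _; rewrite mxE.
  rewrite big_split/=; congr (_ + _).
    rewrite (eq_bigr (fun _ => \tr (shrinkmx b K))); last first.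
      move=> i _; apply: eq_bigr => j _; rewrite mxE (bigD1 j)//= big1 ?addr0.
        by rewrite mxE !eqxx mul1r.
      by move=> k /negbTE kj; rewrite mxE kj andbF mul0r.
    rewrite sumr_const card_ord -[LHS]mulr_natl; congr (_ * _).
    rewrite /shrinkmx trK r1T mxtraceD !mxtraceZ trK KE specmxM// specmx_trace//.
  have S1 : \sum_i \sum_j \tr (dK i j) * (X *m K) i j = - 2 * D2.
    rewrite /dK YE KE (divergence_trace VV XX); congr (_ * _).
    apply: eq_bigr => k _; rewrite -[LHS]/(d k k * kap k * u k); ring.
  have S2 : \sum_i \sum_j (X *m dK i j) i j = - (D1 + E1).
    have := divergence_dbinmx VV XX a s N (fun=> 1) (fun=> 1).
    rewrite (specmx1 VV) mulmx1 => h; rewrite /dK YE.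
    transitivity (- (\sum_k 1 * 1 * d k k * u k + \sum_k \sum_k' 1 * 1 * d k k' * u k)).
      by rewrite -h; apply: eq_bigr => i _; apply: eq_bigr => j _; rewrite mulmx1.
    congr (- (_ + _)); first by apply: eq_bigr => k _; rewrite !mul1r.
    by apply: eq_bigr => k _; apply: eq_bigr => k' _; rewrite !mul1r.
  have S3 : \sum_i \sum_j \tr (dK i j) * (X *m (K *m K)) i j = - 2 * D3.
    rewrite /dK YE KE specmxM// (divergence_trace VV XX); congr (_ * _).
    apply: eq_bigr => k _; rewrite -[LHS]/(d k k * (kap k * kap k) * u k); ring.
  have S4 : \sum_i \sum_j (X *m (dK i j *m K)) i j = - (D2 + E2).
    have := divergence_dbinmx VV XX a s N (fun=> 1) kap.
    rewrite (specmx1 VV) mulmx1 => h; rewrite /dK YE KE.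
    transitivity (- (\sum_k 1 * kap k * d k k * u k + \sum_k \sum_k' 1 * kap k' * d k k' * u k)).
      by rewrite -h; apply: eq_bigr => i _; apply: eq_bigr => j _; rewrite mulmxA.
    congr (- (_ + _)); first by apply: eq_bigr => k _; rewrite !mul1r.
    by apply: eq_bigr => k _; apply: eq_bigr => k' _; rewrite !mul1r.
  have S5 : \sum_i \sum_j (X *m (K *m dK i j)) i j = - (D2 + E3).
    have := divergence_dbinmx VV XX a s N kap (fun=> 1).
    rewrite (specmx1 VV) => h; rewrite /dK YE KE.
    transitivity (- (\sum_k kap k * 1 * d k k * u k + \sum_k \sum_k' kap k * 1 * d k k' * u k)).
      by rewrite -h; apply: eq_bigr => i _; apply: eq_bigr => j _; rewrite mulmxA mulmx1.
    congr (- (_ + _)); first by apply: eq_bigr => k _; rewrite !mulr1.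
    by apply: eq_bigr => k _; apply: eq_bigr => k' _; rewrite !mulr1.
  rewrite -S1 -S2 -S3 -S4 -S5 !mulrDr !mulr_sumr -!big_split/=; apply: eq_bigr => i _.
  rewrite !mulr_sumr -!big_split/=; apply: eq_bigr => j _.
  rewrite /dshrinkmx trK r1T d1T !mulmxDr -!scalemxAr mulmxDr !mxE.
  ring.
have kE : e * T^-1 = binerr a N y by [].
rewrite -kE; apply: bound_aux => //.
- by rewrite mulVf// gt_eqF.
- by rewrite sumr_ge0// => i _; rewrite exprn_ge0.
- rewrite /Q expr2 {1}/T mulr_suml ler_sum// => i _; rewrite expr2.
  by rewrite ler_wpM2l.
- rewrite /D2 /D1 mulr_suml ler_sum// => i _.
  have -> : kap i * d i i * u i = d i i * u i * kap i by ring.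
  by rewrite ler_wpM2l// mulr_ge0.
- rewrite /D3 /D2 mulr_suml ler_sum// => i _.
  have -> : kap i ^+ 2 * d i i * u i = kap i * d i i * u i * kap i by ring.
  by apply: ler_wpM2l; [exact: mulr_ge0 (mulr_ge0 (kap0 i) (d0 i i)) (u0 i)|exact: kapT].
- by rewrite ler_nat.
- rewrite /E1 /D1.
  have hk k : d k k * u k + (T - kap k - r%:R * e) <= \sum_k' d k k' * u k.
    rewrite (bigD1 k)//= lerD2l.
    apply: (@le_trans _ _ (\sum_(j | j != k) (kap j - e))); last first.
      by apply: ler_sum => j _; rewrite mulrC.
    have hc : \sum_(j < r | j != k) e <= r%:R * e.
      rewrite sumr_const -[leLHS]mulr_natl ler_wpM2r// ler_nat -[leqRHS]card_ord.
      exact: max_card.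
    have -> : T = kap k + \sum_(j | j != k) kap j by rewrite /T (bigD1 k).
    by rewrite sumrB [kap k + _]addrC addrK lerD2l lerN2.
  apply: le_trans (ler_sum _ (fun k _ => hk k)).
  rewrite big_split/= !sumrB !sumr_const !card_ord -/T -/D1.
  by rewrite aux1 lerD2l -[T *+ r]mulr_natl -[(r%:R * e) *+ r]mulr_natl.
(* [hud] bounds a divided difference by the value at its second index, so the sums are exchanged to
   keep that index fixed. In E3 the weight sits on the first index and only the diagonal is kept. *)
- rewrite /E2 /D2 exchange_big/=.
  have hk k : kap k * d k k * u k + (kap k ^+ 2 * (r%:R - 1) - r%:R * (e * kap k)) <= \sum_k' kap k * d k' k * u k'.
    rewrite (bigD1 k)//= lerD2l.
    apply: (@le_trans _ _ (\sum_(j < r | j != k) (kap k * (kap k - e)))); last first.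
      by apply: ler_sum => j _; rewrite -mulrA [d _ _ * _]mulrC ler_wpM2l.
    rewrite sumr_const.
    have -> : #|(fun j : 'I_r => j != k)| = r.-1.
      by have := cardC1 k; rewrite card_ord => <-; apply: eq_card.
    rewrite -[leRHS]mulr_natl -subn1 natrB//.
    by rewrite aux2 lerDl mulr_ge0.
  apply: le_trans (ler_sum _ (fun k _ => hk k)).
  by rewrite big_split/= sumrB -mulr_suml -!mulr_sumr -/T -/Q -/D2 aux3.
- apply: ler_sum => k _; rewrite (bigD1 k)//= lerDl sumr_ge0// => j _.
  exact: mulr_ge0 (mulr_ge0 (kap0 _) (d0 _ _)) (u0 _).
Qed.

End divergence_bound.

(** * Integration by parts *)

Section directional_derivative.
Context (R : realType) (q m p : nat).

Local Notation V := ('M[R]_(q, p) * 'M[R]_(m, p))%type.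
Local Notation mu := (@lebesgue_zu R q m p).
Implicit Types (e x : V) (g h : V -> R).

(** Local boundedness with boxes in the role of compact sets. Boxes have finite measure, so a
    measurable function of this kind that vanishes outside one box is integrable. *)
Definition bounded_on_boxes g :=
  forall B, exists C, forall x, zu_box B x -> `|g x| <= C.

(** Differentiability along one direction, packed with the measurability and local boundedness that
    dominated convergence of the difference quotients requires. The package is stable under sums,
    products and composition with suitable functions of one variable. *)
Definition cdiff e g g' := [/\ measurable_fun [set: V] g, measurable_fun [set: V] g',
  forall x, is_derive (0 : R) (1 : R) (fun t : R => g (x + t *: e)) (g' x),
  bounded_on_boxes g & bounded_on_boxes g'].

Lemma bounded_on_boxes_cst c : bounded_on_boxes (fun=> c).
Proof. by move=> B; exists `|c|. Qed.

Lemma bounded_on_boxesD g h : bounded_on_boxes g -> bounded_on_boxes h ->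
  bounded_on_boxes (fun x => g x + h x).
Proof.
move=> bg bh B; have [C gC] := bg B; have [D hD] := bh B; exists (C + D) => x xB.
by rewrite (le_trans (ler_normD _ _))// lerD ?gC ?hD.
Qed.

Lemma bounded_on_boxesM g h : bounded_on_boxes g -> bounded_on_boxes h ->
  bounded_on_boxes (fun x => g x * h x).
Proof.
move=> bg bh B; have [C gC] := bg B; have [D hD] := bh B; exists (C * D) => x xB.
by rewrite normrM ler_pM ?gC ?hD.
Qed.

Lemma cdiff_cst e c : cdiff e (fun=> c) (fun=> 0).
Proof.
split; [exact: measurable_cst|exact: measurable_cst| |exact: bounded_on_boxes_cst|exact: bounded_on_boxes_cst].
by move=> x; exact: is_derive_cst.
Qed.

Lemma cdiffD e g g' h h' : cdiff e g g' -> cdiff e h h' ->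
  cdiff e (fun x => g x + h x) (fun x => g' x + h' x).
Proof.
move=> [mg mg' dg bg bg'] [mh mh' dh bh bh']; split; try exact: bounded_on_boxesD.
- exact: measurable_funD.
- exact: measurable_funD.
- by move=> x; exact: is_deriveD.
Qed.

Lemma cdiffM e g g' h h' : cdiff e g g' -> cdiff e h h' ->
  cdiff e (fun x => g x * h x) (fun x => g' x * h x + g x * h' x).
Proof.
move=> [mg mg' dg bg bg'] [mh mh' dh bh bh']; split.
- exact: measurable_funM.
- by apply: measurable_funD; exact: measurable_funM.
- move=> x; apply: (is_derive_eq (is_deriveM (dg x) (dh x))).
  by rewrite !scale0r !addr0 addrC /GRing.scale/= mulrC.
- exact: bounded_on_boxesM.
- by apply: bounded_on_boxesD; exact: bounded_on_boxesM.
Qed.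

Lemma cdiff_sum e (I : Type) (s : seq I) (g g' : I -> V -> R) :
  (forall i, cdiff e (g i) (g' i)) ->
  cdiff e (fun x => \sum_(i <- s) g i x) (fun x => \sum_(i <- s) g' i x).
Proof.
move=> gg'; elim: s => [|i s IH].
  rewrite (_ : (fun x => _) = fun=> 0); last by apply/funext => x; rewrite big_nil.
  rewrite (_ : (fun x => \sum_(i <- [::]) g' i x) = fun=> 0); first exact: cdiff_cst.
  by apply/funext => x; rewrite big_nil.
rewrite (_ : (fun x => _) = fun x => g i x + \sum_(j <- s) g j x); last first.
  by apply/funext => x; rewrite big_cons.
rewrite (_ : (fun x => \sum_(j <- i :: s) g' j x) = fun x => g' i x + \sum_(j <- s) g' j x).
  exact: cdiffD.
by apply/funext => x; rewrite big_cons.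
Qed.

Lemma cdiff_comp e (phi dphi : R -> R) g g' :
  measurable_fun [set: R] phi -> measurable_fun [set: R] dphi ->
  (forall t, is_derive t (1 : R) phi (dphi t)) ->
  (forall B, exists C, forall t, `|t| <= B -> `|phi t| <= C /\ `|dphi t| <= C) ->
  cdiff e g g' -> cdiff e (fun x => phi (g x)) (fun x => dphi (g x) * g' x).
Proof.
move=> mphi mdphi dphiP bphi [mg mg' dg bg bg'].
have bphi1 : bounded_on_boxes (fun x => phi (g x)).
  move=> B; have [C gC] := bg B; have [D phiD] := bphi C.
  by exists D => x xB; case: (phiD _ (gC x xB)).
have bphi2 : bounded_on_boxes (fun x => dphi (g x)).
  move=> B; have [C gC] := bg B; have [D phiD] := bphi C.
  by exists D => x xB; case: (phiD _ (gC x xB)).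
split => //.
- exact: measurableT_comp mphi mg.
- by apply: measurable_funM => //; exact: measurableT_comp mdphi mg.
- move=> x; have H : is_derive (g (x + (0 : R) *: e)) (1 : R) phi (dphi (g x)).
    by rewrite scale0r addr0.
  exact: (@is_derive1_comp R phi (fun t : R => g (x + t *: e)) 0 _ _ H (dg x)).
- exact: bounded_on_boxesM.
Qed.

Lemma cdiff_entry2 e i j : cdiff e (fun x => x.2 i j) (fun=> e.2 i j).
Proof.
split.
- exact: measurable_zu2.
- exact: measurable_cst.
- move=> x; rewrite (_ : (fun t => _) = cst (x.2 i j) + (e.2 i j) \*: (id : R -> R)).
    by apply: is_derive_eq; rewrite add0r /GRing.scale/= mulr1.
  by apply/funext => t /=; rewrite !mxE mulrC.
- by move=> B; exists B => x [_ xB]; exact: xB.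
- exact: bounded_on_boxes_cst.
Qed.

Lemma cdiff_entry1 e i j : cdiff e (fun x => x.1 i j) (fun=> e.1 i j).
Proof.
split.
- exact: measurable_zu1.
- exact: measurable_cst.
- move=> x; rewrite (_ : (fun t => _) = cst (x.1 i j) + (e.1 i j) \*: (id : R -> R)).
    by apply: is_derive_eq; rewrite add0r /GRing.scale/= mulr1.
  by apply/funext => t /=; rewrite !mxE mulrC.
- by move=> B; exists B => x [xB _]; exact: xB.
- exact: bounded_on_boxes_cst.
Qed.

Definition mcdiff k n e (F F' : V -> 'M[R]_(k, n)) :=
  forall i j, cdiff e (fun x => F x i j) (fun x => F' x i j).

Lemma eq_cdiff e g g' h h' : (forall x, g x = h x) -> (forall x, g' x = h' x) ->
  cdiff e g g' -> cdiff e h h'.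
Proof. by move=> /funext -> /funext ->. Qed.

Lemma mcdiff_cst k n e (A : 'M[R]_(k, n)) : mcdiff e (fun=> A) (fun=> 0).
Proof. by move=> i j; apply: eq_cdiff (cdiff_cst e (A i j)) => // x; rewrite mxE. Qed.

Lemma mcdiffD k n e (F F' G G' : V -> 'M[R]_(k, n)) : mcdiff e F F' -> mcdiff e G G' ->
  mcdiff e (fun x => F x + G x) (fun x => F' x + G' x).
Proof.
by move=> dF dG i j; apply: eq_cdiff (cdiffD (dF i j) (dG i j)) => x; rewrite mxE.
Qed.

Lemma mcdiffM k n l e (F F' : V -> 'M[R]_(k, n)) (G G' : V -> 'M[R]_(n, l)) :
  mcdiff e F F' -> mcdiff e G G' ->
  mcdiff e (fun x => F x *m G x) (fun x => F' x *m G x + F x *m G' x).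
Proof.
move=> dF dG i j.
apply: eq_cdiff (cdiff_sum (index_enum 'I_n) (fun o => cdiffM (dF i o) (dG o j))) => x.
  by rewrite mxE.
by rewrite 3!mxE big_split.
Qed.

Lemma mcdiffZ k n e g g' (F F' : V -> 'M[R]_(k, n)) : cdiff e g g' -> mcdiff e F F' ->
  mcdiff e (fun x => g x *: F x) (fun x => g' x *: F x + g x *: F' x).
Proof.
by move=> dg dF i j; apply: eq_cdiff (cdiffM dg (dF i j)) => x; rewrite !mxE.
Qed.

Lemma mcdiff_tr k n e (F F' : V -> 'M[R]_(k, n)) : mcdiff e F F' ->
  mcdiff e (fun x => (F x)^T) (fun x => (F' x)^T).
Proof. by move=> dF i j; apply: eq_cdiff (dF j i) => x; rewrite mxE. Qed.

Lemma cdiff_trace k e (F F' : V -> 'M[R]_k) : mcdiff e F F' ->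
  cdiff e (fun x => \tr (F x)) (fun x => \tr (F' x)).
Proof. by move=> dF; exact: (cdiff_sum (index_enum 'I_k) (fun i => dF i i)). Qed.

Lemma eq_mcdiff k n e (F F' G G' : V -> 'M[R]_(k, n)) : (forall x, F x = G x) ->
  (forall x, F' x = G' x) -> mcdiff e F F' -> mcdiff e G G'.
Proof. by move=> /funext -> /funext ->. Qed.

Lemma mcdiff_sum k n e (I : Type) (s : seq I) (F F' : I -> V -> 'M[R]_(k, n)) :
  (forall i, mcdiff e (F i) (F' i)) ->
  mcdiff e (fun x => \sum_(i <- s) F i x) (fun x => \sum_(i <- s) F' i x).
Proof.
move=> dF i j; apply: eq_cdiff (cdiff_sum s (fun o => dF o i j)) => x; by rewrite summxE.
Qed.

(** Moving the base point to x + t e turns derivatives at 0 into derivatives at t, as the mean value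
    theorem needs. *)
Lemma cdiff_shift e g g' x t : cdiff e g g' ->
  is_derive t (1 : R) (fun t : R => g (x + t *: e)) (g' (x + t *: e)).
Proof.
case=> _ _ dg _ _.
rewrite (_ : (fun s => _) = (fun s : R => g ((x + t *: e) + s *: e)) \o (fun s => s - t)); last first.
  by apply/funext => s /=; rewrite -addrA -scalerDl [t + _]addrC subrK.
have d1 : is_derive t (1 : R) (fun s => s - t) 1.
  rewrite (_ : (fun s => _) = id - cst t)//; apply: is_derive_eq; by rewrite subr0.
have d2 : is_derive (t - t) (1 : R) (fun s : R => g ((x + t *: e) + s *: e)) (g' (x + t *: e)).
  by rewrite subrr.
have := @is_derive1_comp R _ (fun s => s - t) t _ _ d2 d1.
by rewrite mulr1.
Qed.

Lemma integral_translation (g : V -> \bar R) (d : V) : measurable_fun [set: V] g ->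
  (\int[mu]_x g (x + d)%R = \int[mu]_x g x)%E.
Proof.
move=> mg; rewrite integralE [in RHS]integralE.
have E x : x + d = affine_zu 1 d x by rewrite /affine_zu !scale1r.
have H (h : V -> \bar R) : measurable_fun [set: V] h -> (forall x, 0 <= h x)%E ->
    (\int[mu]_x h (x + d)%R = \int[mu]_x h x)%E.
  move=> mh h0; rewrite -(ge0_integral_affine_zu (@ltr01 R) d mh h0) expr1n mul1e.
  by apply: eq_integral => x _; rewrite E.
have P := H _ (measurable_funepos mg) (funepos_ge0 g).
have N := H _ (measurable_funeneg mg) (funeneg_ge0 g).
rewrite -P -N.
by congr (_ - _)%E; apply: eq_integral => x _; rewrite ?funeposE ?funenegE.
Qed.

Lemma integrable_box g B C : measurable_fun [set: V] g ->
  (forall x, `|g x| <= C) -> (forall x, ~ zu_box B x -> g x = 0) ->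
  mu.-integrable [set: V] (EFin \o g).
Proof.
move=> mg gC g0.
apply/integrableP; split; first exact/measurable_EFinP.
apply: (@le_lt_trans _ _ (\int[mu]_x (C * \1_(zu_box B) x)%:E)%E).
  apply: ge0_le_integral => //.
  - by apply/measurable_EFinP; exact: measurableT_comp.
  - by apply/measurable_EFinP; apply: measurable_funM => //; apply: measurable_indic; exact: measurable_zu_box.
  move=> x _; rewrite lee_fin indicE.
  case: (boolP (x \in zu_box B)) => xB; first by rewrite mulr1.
  by rewrite g0 ?normr0 ?mulr0// => /mem_set; exact/negP.
have mB := @measurable_zu_box R q m p B.
have C0 : 0 <= C by apply: le_trans (gC 0).
under eq_integral do rewrite EFinM.
rewrite ge0_integralZl//.
  by rewrite integral_indic// setIT lte_mul_pinfty// ?ge0_fin_numE//; exact: lebesgue_zu_box_lty.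
by apply/measurable_EFinP/measurable_indic.
Qed.

Lemma zu_box_add B C x y : zu_box B x -> zu_box C y -> zu_box (B + C) (x + y).
Proof.
move=> [xB1 xB2] [yC1 yC2]; split => i j; rewrite mxE (le_trans (ler_normD _ _))// lerD//.
Qed.

Lemma zu_box_le B C x : B <= C -> zu_box B x -> zu_box C x.
Proof. by move=> BC [x1 x2]; split => i j; rewrite (le_trans _ BC). Qed.

Lemma zu_box_exists x : exists2 B, 0 <= B & zu_box B x.
Proof.
exists (\sum_i \sum_j `|x.1 i j| + \sum_i \sum_j `|x.2 i j|).
  by rewrite addr_ge0// sumr_ge0// => *; rewrite sumr_ge0.
split => i j /=.
  apply: ler_wpDr; first by rewrite sumr_ge0// => *; rewrite sumr_ge0.
  rewrite (bigD1 i)//= (bigD1 j)//= -addrA lerDl addr_ge0 ?sumr_ge0// => *.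
  by rewrite sumr_ge0.
apply: ler_wpDl; first by rewrite sumr_ge0// => *; rewrite sumr_ge0.
rewrite (bigD1 i)//= (bigD1 j)//= -addrA lerDl addr_ge0 ?sumr_ge0// => *.
by rewrite sumr_ge0.
Qed.

Lemma zu_boxZ B t x : `|t| <= 1 -> zu_box B x -> zu_box B (t *: x).
Proof.
move=> t1 [x1 x2]; split => i j; rewrite mxE normrM -[leRHS]mul1r ler_pM//.
Qed.

(** Every difference quotient of g along e has integral 0 by translation invariance. The mean value
    theorem bounds the quotients by the derivative on a box, so dominated convergence carries the
    value 0 over to g'. *)
Lemma cdiff_integral0 e g g' B : cdiff e g g' -> (forall x, ~ zu_box B x -> g x = 0) ->
  mu.-integrable [set: V] (EFin \o g') /\ (\int[mu]_x (g' x)%:E = 0)%E.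
Proof.
move=> dg g0; have [mg mg' dg0 bg bg'] := dg.
(* Enlarging the box by the size of e makes all translates g (x + t e) with |t| <= 1 vanish outside
   one common box. *)
have [E E0 eE] := zu_box_exists e.
have g0' t x : `|t| <= 1 -> ~ zu_box (B + E) x -> g (x + t *: e) = 0.
  move=> t1 xBE; apply: g0 => xB; apply: xBE.
  have -> : x = (x + t *: e) + (- t) *: e by rewrite -addrA -scalerDl subrr scale0r addr0.
  by apply: zu_box_add => //; apply: zu_boxZ => //; rewrite normrN.
have gz x : ~ zu_box (B + E) x -> g x = 0.
  by move=> h; rewrite -[x]addr0 -(scale0r e) g0'// normr0.
have g'z x : ~ zu_box (B + E) x -> g' x = 0.
  move=> xBE; have D0 : is_derive (0 : R) (1 : R) (fun t : R => g (x + t *: e)) 0.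
    apply: (@near_eq_is_derive R R^o R^o (cst 0) _ _ _ _ _ (is_derive_cst _ _ _)).
    exists 1 => //= t /=; rewrite sub0r normrN => t1; rewrite g0'//; exact: ltW.
  by case: (dg0 x) => _ <-; case: D0 => _ ->.
(* The derivative is bounded on a box larger by E, because the intermediate point x + s e of the
   mean value theorem may leave the box of x. *)
have [C gC] := bg (B + E); have [C' g'C] := bg' (B + E + E).
have gbd x : `|g x| <= `|C|.
  have [xB|/gz ->] := pselect (zu_box (B + E) x); last by rewrite normr0.
  exact: le_trans (gC _ xB) (ler_norm _).
have g'bd x : zu_box (B + E + E) x -> `|g' x| <= `|C'|.
  by move=> xB; exact: le_trans (g'C _ xB) (ler_norm _).
have ig := integrable_box mg gbd gz.
have g'bdT x : `|g' x| <= `|C'|.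
  have [xB|/g'z ->] := pselect (zu_box (B + E) x); last by rewrite normr0.
  by apply: g'bd; apply: zu_box_le xB; rewrite lerDl.
have ig' := integrable_box mg' g'bdT g'z.
split => //.
pose t k : R := harmonic k.
have t0 k : 0 < t k by exact: harmonic_gt0.
have t1 k : `|t k| <= 1.
  by rewrite ger0_norm ?(ltW (t0 _))// invf_le1// ler1n.
pose D k x := (t k)^-1 * (g (x + t k *: e) - g x).
have mgt k : measurable_fun [set: V] (fun x => g (x + t k *: e)).
  rewrite (_ : (fun x => _) = g \o affine_zu 1 (t k *: e)).
    exact: measurableT_comp mg (measurable_affine_zu _ _).
  by apply/funext => x /=; rewrite /affine_zu !scale1r.
have mD k : measurable_fun [set: V] (D k).
  by apply: measurable_funM => //; apply: measurable_funB.
have Dz k x : ~ zu_box (B + E) x -> D k x = 0.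
  by move=> xBE; rewrite /D g0'// gz// subrr mulr0.
have Dbd k x : `|D k x| <= `|C'| * \1_(zu_box (B + E)) x.
  have [xB|/[dup] xB /Dz ->] := pselect (zu_box (B + E) x); last first.
    by rewrite normr0 mulr_ge0.
  rewrite indicE mem_set// mulr1.
  have [s] : exists2 s, s \in `]0, t k[ & g (x + t k *: e) - g (x + (0 : R) *: e) =
      g' (x + s *: e) * (t k - 0).
    apply: (@MVT R (fun s => g (x + s *: e)) (fun s => g' (x + s *: e))) => //.
      by move=> s _; exact: cdiff_shift dg.
    apply: derivable_within_continuous => s _.
    by have [] := @cdiff_shift e g g' x s dg.
  rewrite in_itv/= => /andP[s0 st]; rewrite scale0r addr0 subr0 /D => ->.
  rewrite mulrC (mulfK (lt0r_neq0 (t0 k))); apply: g'bd; apply: zu_box_add xB (zu_boxZ _ eE).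
  by rewrite ger0_norm ?(ltW s0)// (le_trans (ltW st))// (le_trans (ler_norm _)).
have intD k : (\int[mu]_x (D k x)%:E = 0)%E.
  have igt : mu.-integrable [set: V] (EFin \o (fun x => g (x + t k *: e))).
    apply: (@integrable_box _ (B + E) `|C|) => // x; exact: g0'.
  transitivity ((t k)^-1%:E * (\int[mu]_x (g (x + t k *: e))%:E - \int[mu]_x (g x)%:E))%E.
    transitivity (\int[mu]_x ((t k)^-1%:E *
        ((EFin \o (fun x => g (x + t k *: e)%R)) \- (EFin \o g)) x))%E.
      by apply: eq_integral => x _; rewrite /D EFinM EFinB.
    by rewrite integralZl ?integralB//; exact: integrableB.
  rewrite (integral_translation (g := EFin \o g)); last exact/measurable_EFinP.
  by rewrite subee ?mule0//; exact: integrable_fin_num.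
have iC : mu.-integrable [set: V] (EFin \o (fun x => `|C'| * \1_(zu_box (B + E)) x)).
  apply: (@integrable_box _ (B + E) `|C'|).
  - by apply: measurable_funM => //; apply: measurable_indic; exact: measurable_zu_box.
  - move=> x; rewrite normrM normr_id indicE; case: (_ \in _) => /=; first by rewrite normr1 mulr1.
    by rewrite normr0 mulr0.
  - by move=> x xB; rewrite indicE memNset// mulr0.
have DC x : (D k x)%:E @[k --> \oo] --> (g' x)%:E.
  apply/fine_cvgP; split; first exact: nearW.
  have [der val] := dg0 x; move: der; rewrite /derivable => /cvg_ex[l dl].
  have E' : l = g' x by rewrite -val; apply/esym/cvg_lim.
  have H := proj1 (@cvgr_dnbhsP R _ 0 l) dl.
  have := H t (conj (fun n => lt0r_neq0 (t0 n)) (@cvg_harmonic R)); rewrite E'.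
  rewrite (_ : (fun n => _) = D ^~ x)//; apply/funext => k /=.
  by rewrite /D addr0 scale0r addr0 /GRing.scale/= mulr1.
have := @dominated_convergence _ _ _ mu setT measurableT
  (fun k x => (D k x)%:E) (EFin \o g') (EFin \o (fun x => `|C'| * \1_(zu_box (B + E)) x))
  (fun k => proj2 (measurable_EFinP _ _) (mD k)) (proj2 (measurable_EFinP _ _) mg')
  (aeW _ (fun x _ => DC x)) iC (aeW _ (fun x k _ => Dbd k x)).
case=> _ _; rewrite (_ : [sequence _]_k = cst 0%E); last first.
  by apply/funext => k; exact: intD.
move/cvg_lim => <- //; exact: lim_cst.
Unshelve. all: by end_near.
Qed.

End directional_derivative.

(** * Piecewise functions: the extended reciprocal and the test profile *)

Section glued_functions.
Context (R : realType).

Lemma is_derive_glue (c : R) (g h dg dh : R -> R) :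
  (forall t, c <= t -> is_derive t (1 : R) g (dg t)) ->
  (forall t, t <= c -> is_derive t (1 : R) h (dh t)) ->
  g c = h c -> dg c = dh c ->
  forall t, is_derive t (1 : R) (fun t => if c <= t then g t else h t)
    (if c <= t then dg t else dh t).
Proof.
move=> dg_g dh_h gh dgh t; case: (ltgtP c t) => [ct|tc|<-].
- apply: (@near_eq_is_derive R R^o R^o g _ _ _ _ _ (dg_g t (ltW ct))).
  by near=> s; rewrite ifT//; apply: ltW; near: s; exact: lt_nbhsr.
- apply: (@near_eq_is_derive R R^o R^o h _ _ _ _ _ (dh_h t (ltW tc))).
  by near=> s; rewrite leNgt ifF//; apply/negbTE; rewrite negbK; near: s; exact: lt_nbhsl.
have quot (f : R -> R) d : is_derive c (1 : R) f d ->
    (u^-1 *: ((f \o shift c) (u *: (1 : R)) - f c)) @[u --> 0^'] --> d.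
  by case=> der <-; exact: der.
have Q : (u^-1 *: (((fun t => if c <= t then g t else h t) \o shift c) (u *: (1 : R)) -
    (if c <= c then g c else h c))) @[u --> 0^'] --> dg c.
  have Qg := quot _ _ (dg_g c (lexx c)); have Qh := quot _ _ (dh_h c (lexx c)).
  rewrite -dgh in Qh; apply/cvgrPdist_lt => e e0.
  move/cvgrPdist_lt : Qg => /(_ _ e0) Qg; move/cvgrPdist_lt : Qh => /(_ _ e0) Qh.
  near=> u; rewrite lexx /=; case: ifPn => _; first by near: u.
  by rewrite gh; near: u.
by apply: DeriveDef; [apply/cvg_ex; exists (dg c)|apply/cvg_lim].
Unshelve. all: by end_near. Qed.

Lemma is_derive_measurable (g dg : R -> R) :
  (forall t, is_derive t (1 : R) g (dg t)) -> measurable_fun [set: R] g.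
Proof.
move=> dg_g; apply: continuous_measurable_fun => t.
by apply/differentiable_continuous/derivable1_diffP; case: (dg_g t).
Qed.

Lemma is_derive_recip1 (t : R) : is_derive t (1 : R) (@recip1 R) (drecip1 t).
Proof.
apply: (@is_derive_glue 1 (fun t => t^-1) (fun t => 2 - t) (fun t => - t^-1 ^+ 2) (fun=> -1)).
- move=> s s1; have s0 : s != 0 by rewrite gt_eqF// (lt_le_trans _ s1).
  apply: (is_derive_eq (@is_deriveV R id s 1 1 s0 (is_derive_id _ _))).
  by rewrite /GRing.scale/= mulr1 exprVn.
- move=> s _; rewrite (_ : (fun _ => _) = cst 2 - id)//.
  by apply: is_derive_eq; rewrite sub0r.
- by rewrite invr1; lra.
- by rewrite invr1 expr1n.
Qed.

Lemma recip1_bounded (B : R) : exists C, forall t : R, `|t| <= B ->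
  `|recip1 t| <= C /\ `|drecip1 t| <= C.
Proof.
exists (3 + B) => t; rewrite /recip1 /drecip1; have [t1|t1] := leP 1 t => tB.
  have t0 : 0 < t by exact: lt_le_trans t1.
  have ti : 0 <= t^-1 <= 1 by rewrite invr_ge0 (ltW t0) invf_le1.
  have ti2 : t^-1 ^+ 2 <= 1 by rewrite exprn_ile1//; case/andP: ti.
  have B0 : 0 <= B by apply: le_trans tB.
  rewrite normrN normrX (ger0_norm (_ : 0 <= t^-1)); last by case/andP: ti.
  by case/andP: ti => *; split; lra.
move: tB; rewrite !ler_norml => /andP[? ?]; split; lra.
Qed.

Lemma measurable_recip1 : measurable_fun [set: R] (@recip1 R).
Proof. exact: is_derive_measurable is_derive_recip1. Qed.

Lemma measurable_drecip1 : measurable_fun [set: R] (@drecip1 R).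
Proof.
rewrite (_ : @drecip1 R = fun t => - (recip1 (Num.max t 1)) ^+ 2).
  apply: measurableT_comp => //; apply: measurable_funX.
  by apply: measurableT_comp measurable_recip1 _; exact: measurable_maxr.
apply/funext => t; rewrite /drecip1 /recip1; case: leP => t1.
  by rewrite t1.
by rewrite lexx invr1 expr1n.
Qed.

(* The radial test profile: profile = 1/2 \int_t^oo profile_density. *)
Definition profile (t : R) : R := if 1 <= t then 0 else 2^-1 * (1 - t) ^+ 2.

Definition profile_density (t : R) : R := 2 * Num.max (1 - t) 0.

Lemma profile_densityE t : profile_density t = if 1 <= t then 0 else 2 * (1 - t).
Proof.
rewrite /profile_density; have [t1|t1] := leP 1 t.
  by rewrite max_r ?mulr0// subr_le0.
by rewrite max_l// subr_ge0 ltW.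
Qed.

Lemma is_derive_profile (t : R) :
  is_derive t (1 : R) profile (- 2^-1 * profile_density t).
Proof.
rewrite profile_densityE (fun_if (fun z => - 2^-1 * z)).
apply: (@is_derive_glue 1 (fun=> 0) (fun t => 2^-1 * (1 - t) ^+ 2)
  (fun=> - 2^-1 * 0) (fun t => - 2^-1 * (2 * (1 - t)))).
- by move=> s _; rewrite mulr0; exact: is_derive_cst.
- move=> s _.
  rewrite (_ : (fun _ => _) = 2^-1 \*: ((cst 1 - id) ^+ 2)); last first.
    by apply/funext => u; rewrite /= !fctE.
  apply: is_derive_eq; rewrite !fctE /GRing.scale/= expr1; ring.
- by rewrite subrr expr0n mulr0.
- by rewrite subrr !mulr0.
Qed.

Lemma profile_bounded (B : R) : exists C, forall t : R, `|t| <= B ->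
  `|profile t| <= C /\ `|- 2^-1 * profile_density t| <= C.
Proof.
exists ((1 + B) ^+ 2 + (1 + B)) => t tB; have B0 : 0 <= B by apply: le_trans tB.
rewrite profile_densityE /profile; have [t1|t1] := leP 1 t.
  by rewrite mulr0 normr0; split; rewrite addr_ge0 ?sqr_ge0 ?addr_ge0.
have d0 : 0 <= 1 - t by rewrite subr_ge0 ltW.
have dB : 1 - t <= 1 + B by move: tB; rewrite ler_norml => /andP[? ?]; lra.
have d2 : (1 - t) ^+ 2 <= (1 + B) ^+ 2 by rewrite lerXn2r ?nnegrE// addr_ge0.
have d20 := sqr_ge0 (1 - t).
split; first by rewrite ger0_norm; lra.
rewrite mulNr normrN ger0_norm; lra.
Qed.

Lemma measurable_profile : measurable_fun [set: R] profile.
Proof. exact: is_derive_measurable is_derive_profile. Qed.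

Lemma measurable_profile_density : measurable_fun [set: R] profile_density.
Proof.
apply: measurable_funM => //; apply: measurable_maxr => //.
exact: measurable_funB.
Qed.

Lemma profile_density_ge0 t : 0 <= profile_density t.
Proof. by rewrite /profile_density mulr_ge0// le_max lexx orbT. Qed.

Lemma profile_ge0 t : 0 <= profile t.
Proof. by rewrite /profile; case: ifP => // _; rewrite mulr_ge0 ?sqr_ge0. Qed.

End glued_functions.

Section shrinkage_derivative.
Context (R : realType) (q m p : nat).
Local Notation V := ('M[R]_(q, p) * 'M[R]_(m, p))%type.

Lemma mcdiffZc k n (e : V) c (F F' : V -> 'M[R]_(k, n)) : mcdiff e F F' ->
  mcdiff e (fun x => c *: F x) (fun x => c *: F' x).
Proof.
move=> dF; apply: eq_mcdiff (mcdiffZ (cdiff_cst e c) dF) => x //.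
by rewrite scale0r add0r.
Qed.

Lemma cdiffMc (e : V) c g g' : cdiff e g g' ->
  cdiff e (fun x => c * g x) (fun x => c * g' x).
Proof.
move=> dg; apply: eq_cdiff (cdiffM (cdiff_cst e c) dg) => x //.
by rewrite mul0r add0r.
Qed.

Lemma mcdiff_pow r (e : V) (Y Y' : V -> 'M[R]_r) n : mcdiff e Y Y' ->
  mcdiff e (fun x => Y x ^+ n) (fun x => dpowmx (Y x) (Y' x) n).
Proof.
move=> dY; elim: n => [|n IH].
  by apply: eq_mcdiff (mcdiff_cst e 1%:M) => x.
apply: eq_mcdiff (mcdiffM dY IH) => x; first exact: esym (exprS _ _).
by rewrite [RHS]/= addrC.
Qed.

Lemma mcdiff_binmx r (e : V) (Y Y' : V -> 'M[R]_r) a N : mcdiff e Y Y' ->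
  mcdiff e (fun x => binmx a N (Y x)) (fun x => dbinmx a N (Y x) (Y' x)).
Proof.
move=> dY.
exact: (mcdiff_sum (index_enum 'I_N.+1) (fun n => mcdiffZc (bincoef a n) (mcdiff_pow n dY))).
Qed.

Lemma mcdiff_shrinkmx r (e : V) (K K' : V -> 'M[R]_r) b : mcdiff e K K' ->
  mcdiff e (fun x => shrinkmx b (K x)) (fun x => dshrinkmx b (K x) (K' x)).
Proof.
move=> dK.
have dT := cdiff_comp (@measurable_recip1 R) (@measurable_drecip1 R) (@is_derive_recip1 R)
  (@recip1_bounded R) (cdiff_trace dK).
have d1 := mcdiffZ (cdiffMc (2 * b) dT) dK.
have d2 := cdiffMc b dT.
have d3 := mcdiffZ (cdiffM d2 d2) (mcdiffM dK dK).
apply: eq_mcdiff (mcdiffD d1 d3) => x; rewrite /shrinkmx /dshrinkmx.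
  by rewrite expr2.
congr (_ + (_ *: _ + _ *: _)); ring.
Qed.

Lemma mcdiff_gram v r (e : V) (X : V -> 'M[R]_(v, r)) (D : 'M[R]_(v, r)) s :
  mcdiff e X (fun=> D) ->
  mcdiff e (fun x => 1%:M - s *: ((X x)^T *m X x)) (fun x => - s *: dgram (X x) D).
Proof.
move=> dX; apply: eq_mcdiff (mcdiffD (mcdiff_cst e 1%:M)
  (mcdiffZc (- s) (mcdiffM (mcdiff_tr dX) dX))) => x; last by rewrite add0r.
by rewrite scaleNr.
Qed.

End shrinkage_derivative.

Section matrix_measurability.
Context (R : realType) d (T : measurableType d).

Definition mmeas k n (F : T -> 'M[R]_(k, n)) :=
  forall i j, measurable_fun [set: T] (fun x => F x i j).

Lemma mmeas_cst k n (A : 'M[R]_(k, n)) : mmeas (fun=> A).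
Proof. by move=> i j; exact: measurable_cst. Qed.

Lemma mmeasD k n (F G : T -> 'M[R]_(k, n)) : mmeas F -> mmeas G ->
  mmeas (fun x => F x + G x).
Proof.
move=> mF mG i j; under [X in measurable_fun _ X]eq_fun do rewrite mxE.
exact: measurable_funD.
Qed.

Lemma mmeasZ k n (c : T -> R) (F : T -> 'M[R]_(k, n)) : measurable_fun [set: T] c ->
  mmeas F -> mmeas (fun x => c x *: F x).
Proof.
move=> mc mF i j; under [X in measurable_fun _ X]eq_fun do rewrite mxE.
exact: measurable_funM.
Qed.

Lemma mmeasM k n l (F : T -> 'M[R]_(k, n)) (G : T -> 'M[R]_(n, l)) : mmeas F -> mmeas G ->
  mmeas (fun x => F x *m G x).
Proof.
move=> mF mG i j; under [X in measurable_fun _ X]eq_fun do rewrite mxE.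
by apply: measurable_sum => o; exact: measurable_funM.
Qed.

Lemma mmeas_tr k n (F : T -> 'M[R]_(k, n)) : mmeas F -> mmeas (fun x => (F x)^T).
Proof.
move=> mF i j; under [X in measurable_fun _ X]eq_fun do rewrite mxE.
exact: mF.
Qed.

Lemma mmeas_trace k (F : T -> 'M[R]_k) : mmeas F -> measurable_fun [set: T] (fun x => \tr (F x)).
Proof. by move=> mF; rewrite /mxtrace; apply: measurable_sum => i; exact: mF. Qed.

Lemma mmeas_pow k (F : T -> 'M[R]_k) n : mmeas F -> mmeas (fun x => F x ^+ n).
Proof.
move=> mF; elim: n => [|n IH]; first exact: (mmeas_cst (1%:M)).
rewrite (_ : (fun x => _) = fun x => F x *m F x ^+ n); first exact: mmeasM.
by apply/funext => x; exact: exprS.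
Qed.

Lemma mmeas_sum k n (I : Type) (s : seq I) (F : I -> T -> 'M[R]_(k, n)) :
  (forall i, mmeas (F i)) -> mmeas (fun x => \sum_(i <- s) F i x).
Proof.
move=> mF i j; under [X in measurable_fun _ X]eq_fun do rewrite summxE.
by apply: measurable_sum => o; exact: mF.
Qed.

Lemma mmeas_binmx k (F : T -> 'M[R]_k) a N : mmeas F -> mmeas (fun x => binmx a N (F x)).
Proof.
by move=> mF; apply: mmeas_sum => n; apply: mmeasZ => //; exact: mmeas_pow.
Qed.

Lemma mmeas_shrinkmx k (F : T -> 'M[R]_k) b : mmeas F -> mmeas (fun x => shrinkmx b (F x)).
Proof.
move=> mF; have mr : measurable_fun [set: T] (fun x => recip1 (\tr (F x))).
  exact: measurableT_comp (@measurable_recip1 R) (mmeas_trace mF).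
apply: mmeasD; apply: mmeasZ => //; last exact: mmeasM.
  exact: measurable_funM.
by apply: measurable_funX; exact: measurable_funM.
Qed.

Lemma measurable_det k (F : T -> 'M[R]_k) : mmeas F -> measurable_fun [set: T] (fun x => \det (F x)).
Proof.
move=> mF; rewrite /determinant; apply: measurable_sum => s; apply: measurable_funM => //.
by apply: measurable_prod => i _; exact: mF.
Qed.

End matrix_measurability.

Section shrinkage_weights.
Context (R : realType) (r : nat) (a b : R).
Hypotheses (a1 : 1 <= a) (b0 : 0 < b) (r0 : (0 < r)%N).
Implicit Types (l y : 'I_r -> R).

Let a0 : 0 < a. Proof. exact: lt_le_trans a1. Qed.

Definition psi l (i : 'I_r) : R := b / (\sum_k l k `^ (- a)) * l i `^ (- a).

(** Approximates [psi l] when y = 1 - s l; the scale s cancels between numerator and trace in the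
    limit. *)
Definition psiN N y (i : 'I_r) : R := b * binsum a N (y i) / \sum_k binsum a N (y k).

(** This is (1 + t)^2 - 1: the eigenvalue of 2 Psi + Psi^2 where Psi has the eigenvalue t. *)
Definition weight (t : R) : R := 2 * t + t ^+ 2.

Lemma binsum_total_ge1 N y : (forall i, 0 <= y i) -> 1 <= \sum_k binsum a N (y k).
Proof.
move=> y0; apply: (@le_trans _ _ (\sum_(i < r) 1)); first by rewrite sumr_const card_ord ler1n.
by apply: ler_sum => i _; exact: binsum_ge1.
Qed.

Lemma psiN_bounds N y i : (forall i, 0 <= y i) -> 0 <= psiN N y i <= b.
Proof.
move=> y0; have T1 := binsum_total_ge1 N y0; have T0 : 0 < \sum_k binsum a N (y k) by exact: lt_le_trans T1.
have k0 j : 0 <= binsum a N (y j) by apply: le_trans (binsum_ge1 N a0 (y0 j)).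
rewrite /psiN divr_ge0 ?mulr_ge0 ?(ltW b0) ?(ltW T0)//= ler_pdivrMr// ler_wpM2l ?(ltW b0)//.
by rewrite (bigD1 i)//= lerDl sumr_ge0.
Qed.

Lemma weight_ge0 t : 0 <= t -> 0 <= weight t.
Proof. by move=> t0; rewrite addr_ge0 ?mulr_ge0 ?exprn_ge0. Qed.

Lemma weight_le t u : 0 <= t <= u -> weight t <= weight u.
Proof.
move=> /andP[t0 tu]; rewrite lerD ?ler_wpM2l// lerXn2r ?nnegrE//.
exact: le_trans tu.
Qed.

(** The series converges to (s l_i)^(-a), and the common factor s^(-a) divides out. *)
Lemma cvg_psiN l (s : R) i : 0 < s -> (forall i, 0 < l i) -> (forall i, s * l i <= 1) ->
  psiN N (fun i => 1 - s * l i) i @[N --> \oo] --> psi l i.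
Proof.
move=> s0 l0 sl; have p0 : 0 < s `^ (- a) by rewrite powR_gt0.
have cvgk k : binsum a N (1 - s * l k) @[N --> \oo] --> s `^ (- a) * l k `^ (- a).
  rewrite -powRM ?(ltW s0) ?(ltW (l0 k))//.
  have -> : (s * l k) `^ (- a) = (1 - (1 - s * l k)) `^ (- a) by rewrite opprB addrC subrK.
  apply: cvg_binsum => //; have := mulr_gt0 s0 (l0 k); have := sl k; lra.
have cvgT : \sum_k binsum a N (1 - s * l k) @[N --> \oo] --> \sum_k s `^ (- a) * l k `^ (- a).
  by apply: cvg_big => //; exact: add_continuous.
have T0 : 0 < \sum_k s `^ (- a) * l k `^ (- a).
  rewrite (bigD1 i)//= ltr_wpDr ?mulr_gt0 ?powR_gt0// sumr_ge0// => k _.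
  by rewrite mulr_ge0 ?powR_ge0.
have -> : psi l i = b * (s `^ (- a) * l i `^ (- a)) * (\sum_k s `^ (- a) * l k `^ (- a))^-1.
  rewrite -mulr_sumr invfM /psi.
  have : s `^ (- a) != 0 by rewrite gt_eqF.
  have : \sum_k l k `^ (- a) != 0.
    by apply: contraTneq T0 => E; rewrite -mulr_sumr E mulr0 ltxx.
  move: (s `^ (- a)) (\sum_k _) => u w w0 u0; field.
  by rewrite u0 w0.
apply: cvgM; last by apply: cvgV => //; rewrite gt_eqF.
by apply: cvgM => //; exact: cvg_cst.
Qed.

Lemma cvg_weight_psiN l (s : R) i : 0 < s -> (forall i, 0 < l i) -> (forall i, s * l i <= 1) ->
  weight (psiN N (fun i => 1 - s * l i) i) @[N --> \oo] --> weight (psi l i).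
Proof.
move=> s0 l0 sl; have H := @cvg_psiN l s i s0 l0 sl.
apply: cvgD; first by apply: cvgM => //; exact: cvg_cst.
by rewrite expr2; under eq_fun do rewrite expr2; exact: cvgM.
Qed.

Lemma cvg_binerr_total y : (forall i, 0 <= y i < 1) -> binerr a N y @[N --> \oo] --> 0.
Proof.
move=> yy; have y0 i : 0 <= y i by case/andP: (yy i).
apply: (@squeeze_cvgr _ _ _ _ (fun=> 0) (fun N => \sum_i (a + N%:R) * bincoef a N * y i ^+ N)).
- apply: nearW => N; have T1 := binsum_total_ge1 N y0.
  have T0 : 0 < \sum_k binsum a N (y k) by exact: lt_le_trans T1.
  have yN i : 0 <= y i ^+ N by rewrite exprn_ge0.
  have c0 := ltW (bincoef_gt0 N a0).
  rewrite /binerr divr_ge0 ?(ltW T0) ?mulr_ge0 ?sumr_ge0//=.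
  rewrite ler_pdivrMr// mulr_sumr -[leLHS]mulr1.
  apply: ler_pM => //; first by rewrite sumr_ge0// => i _; rewrite !mulr_ge0.
  apply: ler_sum => i _; rewrite ler_wpM2r// ler_wpM2r//.
  by rewrite -natr1 addrC lerD2r.
- exact: cvg_cst.
- rewrite [X in _ --> X](_ : 0 = \sum_(i < r) (0 : R)); last by rewrite big1.
  apply: cvg_big; first exact: add_continuous.
  by move=> i _; exact: cvg_binerr.
Qed.

Lemma shrinkmx_spec (V : 'M[R]_r) N y : V^T *m V = 1%:M -> (forall i, 0 <= y i) ->
  shrinkmx b (binmx a N (specmx V y)) = specmx V (fun i => weight (psiN N y i)).
Proof.
move=> VV y0; rewrite /shrinkmx binmx_spec// specmx_trace// /recip1 binsum_total_ge1//.
rewrite specmxM// !specmxZ specmxD; congr (specmx V _); apply/funext => i.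
rewrite /weight /psiN; ring.
Qed.

Lemma gram_affine_spec v (X : 'M[R]_(v, r)) (V : 'M[R]_r) l (s : R) : V^T *m V = 1%:M ->
  X^T *m X = specmx V l -> 1%:M - s *: (X^T *m X) = specmx V (fun i => 1 - s * l i).
Proof.
move=> VV ->; rewrite -(specmx1 VV) -scaleNr specmxZ specmxD; congr (specmx V _).
by apply/funext => i; rewrite mulNr.
Qed.

Lemma trace_mul_specmx (A V : 'M[R]_r) (f : 'I_r -> R) :
  \tr (A *m specmx V f) = \sum_i f i * (V^T *m A *m V) i i.
Proof.
rewrite /specmx mulmxA mxtrace_mulC !mulmxA /mxtrace; apply: eq_bigr => i _.
by rewrite mul_mx_diag_entry mulrC.
Qed.

End shrinkage_weights.

Lemma trace_trmx_mul (R : comPzRingType) k n (A B : 'M[R]_(k, n)) :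
  \tr (A^T *m B) = \sum_i \sum_j A i j * B i j.
Proof.
rewrite /mxtrace exchange_big/=; apply: eq_bigr => j _; rewrite mxE.
by apply: eq_bigr => i _; rewrite mxE.
Qed.

(** * Stein's identity and the bound for the test profile *)

Section profile_inequality.
Context (R : realType) (q m p v r : nat).

Local Notation V := ('M[R]_(q, p) * 'M[R]_(m, p))%type.
Local Notation mu := (@lebesgue_zu R q m p).

Variables (X W : V -> 'M[R]_(v, r)) (Q : V -> R) (e : 'I_v -> 'I_r -> V).
Variables (a b M B : R) (D : set V) (h : V -> R).
Hypotheses (a1 : 1 <= a) (b0 : 0 < b) (M0 : 0 < M) (r0 : (0 < r)%N) (rv : (r <= v)%N).
Hypothesis dX : forall i j, mcdiff (e i j) X (fun=> delta_mx i j).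
Hypothesis dQ : forall i j, cdiff (e i j) Q (fun x => 2 * W x i j).
Hypothesis QB : forall x, Q x < 1 -> zu_box B x.
Hypothesis QM : forall x, Q x < 1 -> \tr ((X x)^T *m X x) <= M.
Hypotheses (mD : measurable D) (D0 : mu (~` D) = 0%E).

Definition gram_spec (x : V) (U : 'M[R]_r) (l : 'I_r -> R) :=
  [/\ U^T *m U = 1%:M, (X x)^T *m X x = specmx U l & forall i, 0 < l i].

Let w x (U : 'M[R]_r) i := (U^T *m ((W x)^T *m X x) *m U) i i.

Hypothesis specD : forall x, D x -> exists U l, gram_spec x U l.
Hypothesis w0 : forall x U l i, gram_spec x U l -> 0 <= w x U i.
Hypothesis hE : forall x U l, D x -> gram_spec x U l ->
  h x = \sum_i weight (psi a b l i) * w x U i.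

Let a0 : 0 < a. Proof. exact: lt_le_trans a1. Qed.

Let shrinkN N s x := shrinkmx b (binmx a N (1%:M - s *: ((X x)^T *m X x))).

(** The polynomial substitute for h. It involves no eigenvectors, hence is measurable everywhere; at
    a point with a spectral decomposition and with s l <= 1 it is the sum that defines h with [psiN]
    in place of [psi]. *)
Let hN N s x := \tr ((W x)^T *m X x *m shrinkN N s x).

Let trace_gram x U l : gram_spec x U l -> \tr ((X x)^T *m X x) = \sum_i l i.
Proof. by case=> UU -> _; rewrite specmx_trace. Qed.

Let l_le_trace x U l i : gram_spec x U l -> l i <= \tr ((X x)^T *m X x).
Proof.
move=> g; rewrite (trace_gram g) (bigD1 i)//= lerDl sumr_ge0// => k _.
by case: g => _ _ l0; exact: ltW.
Qed.

Let hN_spec N s x U l : gram_spec x U l -> (forall i, s * l i <= 1) ->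
  hN N s x = \sum_i weight (psiN a b N (fun i => 1 - s * l i) i) * w x U i.
Proof.
move=> [UU XX l0] sl; rewrite /hN /shrinkN (gram_affine_spec s UU XX) shrinkmx_spec//.
  by rewrite trace_mul_specmx.
by move=> i; rewrite subr_ge0.
Qed.

Let cvg_hN s x U l : D x -> gram_spec x U l -> 0 < s -> (forall i, s * l i <= 1) ->
  hN N s x @[N --> \oo] --> h x.
Proof.
move=> Dx g s0 sl; rewrite (hE Dx g); have [UU XX l0] := g.
under eq_fun do rewrite (hN_spec _ g sl).
apply: cvg_big; first exact: add_continuous.
by move=> i _; apply: cvgM; [exact: cvg_weight_psiN|exact: cvg_cst].
Qed.

Let mmeasX : mmeas X.
Proof. by move=> i j; case: (dX i j i j). Qed.

Let mmeasW : mmeas W.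
Proof.
move=> i j; have [_ mW _ _ _] := dQ i j.
rewrite (_ : (fun x => _) = fun x => 2^-1 * (2 * W x i j)).
  exact: measurable_funM.
by apply/funext => x; rewrite mulrA mulVf ?mul1r.
Qed.

Let boundedW i j : bounded_on_boxes (fun x => W x i j).
Proof.
have [_ _ _ _ bW] := dQ i j.
rewrite (_ : (fun x => _) = fun x => 2^-1 * (2 * W x i j)).
  by apply: bounded_on_boxesM => //; exact: bounded_on_boxes_cst.
by apply/funext => x; rewrite mulrA mulVf ?mul1r.
Qed.

Let measurableQ : measurable_fun [set: V] Q.
Proof. by case: (dQ (Ordinal (leq_trans r0 rv)) (Ordinal r0)). Qed.

(** The eigenvectors behind h are not known to depend measurably on x, so h is obtained on D as a
    pointwise limit of the functions [hN]. *)
Lemma measurable_weighted : measurable_fun D h.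
Proof.
have mA : mmeas (fun x => (X x)^T *m X x) by apply: mmeasM => //; exact: mmeas_tr.
(* The trace dominates every eigenvalue, so this scale, which depends on the point, satisfies s l <=
   1 on all of D. *)
pose s x := (\tr ((X x)^T *m X x)) `^ (- 1).
have ms : measurable_fun [set: V] s.
  exact: measurableT_comp (measurable_powR (- 1)) (mmeas_trace mA).
apply: (@measurable_fun_cvg _ _ _ D (fun N x => hN N (s x) x)).
  move=> N; apply: measurable_funTS.
  apply: mmeas_trace; apply: mmeasM; first by apply: mmeasM => //; exact: mmeas_tr.
  apply: mmeas_shrinkmx; apply: mmeas_binmx; apply: mmeasD; first exact: mmeas_cst.
  rewrite (_ : (fun x => _) = fun x => (- s x) *: ((X x)^T *m X x)).
    by apply: mmeasZ => //; exact: measurableT_comp.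
  by apply/funext => x; rewrite scaleNr.
move=> x Dx; have [U [l g]] := specD Dx; have [_ _ l0] := g.
have T0 : 0 < \tr ((X x)^T *m X x).
  by apply: lt_le_trans (l_le_trace (Ordinal r0) g).
have sE : s x = (\tr ((X x)^T *m X x))^-1 by rewrite /s powR_inv1// ltW.
apply: (cvg_hN Dx g); rewrite sE ?invr_gt0// => i.
by rewrite mulrC ler_pdivrMr// mul1r; exact: l_le_trace g.
Qed.

(** Where Q < 1 a constant scale is enough, and unlike the reciprocal of the trace it adds nothing
    to the derivatives. *)
Let s := M^-1.

Let s0 : 0 < s. Proof. by rewrite invr_gt0. Qed.

Let sl_le1 x U l i : gram_spec x U l -> Q x < 1 -> s * l i <= 1.
Proof.
move=> g Q1; rewrite mulrC ler_pdivrMr// mul1r.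
exact: le_trans (l_le_trace i g) (QM Q1).
Qed.

Let profile_out x : ~ zu_box B x -> profile (Q x) = 0 /\ profile_density (Q x) = 0.
Proof.
move=> xB; have Q1 : 1 <= Q x by rewrite leNgt; apply/negP => /QB.
by rewrite profile_densityE /profile Q1.
Qed.

Let integrable_compact (g : V -> R) : measurable_fun [set: V] g -> bounded_on_boxes g ->
  (forall x, ~ zu_box B x -> g x = 0) -> mu.-integrable [set: V] (EFin \o g).
Proof.
move=> mg bg g0; have [C gC] := bg B; apply: (integrable_box (C := `|C|) mg _ g0) => x.
have [xB|/g0 ->] := pselect (zu_box B x); last by rewrite normr0.
exact: le_trans (gC _ xB) (ler_norm _).
Qed.

Let dprofile i j : cdiff (e i j) (fun x => profile (Q x))
  (fun x => - 2^-1 * profile_density (Q x) * (2 * W x i j)).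
Proof.
apply: (@cdiff_comp _ _ _ _ (e i j) (@profile R) (fun t => - 2^-1 * profile_density t)
  Q (fun x => 2 * W x i j)) => //.
- exact: measurable_profile.
- by apply: measurable_funM => //; exact: measurable_profile_density.
- exact: is_derive_profile.
- exact: profile_bounded.
Qed.

Let i0 : 'I_v := Ordinal (leq_trans r0 rv).
Let j0 : 'I_r := Ordinal r0.

Let bounded_profile : bounded_on_boxes (fun x => profile (Q x)).
Proof. by case: (dprofile i0 j0). Qed.

Let bounded_density : bounded_on_boxes (fun x => profile_density (Q x)).
Proof.
have [_ _ _ bQ _] := dQ i0 j0 => B'; have [C QC] := bQ B'.
have [C' pC] := profile_bounded C; exists (2 * C') => x xB.
have [_] := pC _ (QC _ xB); rewrite mulNr normrN normrM ger0_norm; lra.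
Qed.

Let mprofile : measurable_fun [set: V] (fun x => profile (Q x)).
Proof. exact: measurableT_comp (@measurable_profile R) measurableQ. Qed.

Let mdensity : measurable_fun [set: V] (fun x => profile_density (Q x)).
Proof. exact: measurableT_comp (@measurable_profile_density R) measurableQ. Qed.

Let K N x := binmx a N (1%:M - s *: ((X x)^T *m X x)).

Let dK N i j x := dbinmx a N (1%:M - s *: ((X x)^T *m X x)) (- s *: dgram (X x) (delta_mx i j)).

Let dshrink N i j : mcdiff (e i j) (fun x => X x *m shrinkN N s x)
  (fun x => delta_mx i j *m shrinkN N s x + X x *m dshrinkmx b (K N x) (dK N i j x)).
Proof.
apply: mcdiffM; first exact: dX.
by apply: mcdiff_shrinkmx; apply: mcdiff_binmx; apply: mcdiff_gram; exact: dX.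
Qed.

Let dvg N x := \sum_i \sum_j
  (delta_mx i j *m shrinkN N s x + X x *m dshrinkmx b (K N x) (dK N i j x)) i j.

Let bounded_sum (I : Type) (t : seq I) (g : I -> V -> R) :
  (forall i, bounded_on_boxes (g i)) -> bounded_on_boxes (fun x => \sum_(i <- t) g i x).
Proof.
move=> bg; elim: t => [|i t IH].
  rewrite (_ : (fun x => _) = fun=> 0); first exact: bounded_on_boxes_cst.
  by apply/funext => x; rewrite big_nil.
rewrite (_ : (fun x => _) = fun x => g i x + \sum_(j <- t) g j x).
  exact: bounded_on_boxesD.
by apply/funext => x; rewrite big_cons.
Qed.

Let hNE N x : hN N s x = \sum_i \sum_j W x i j * (X x *m shrinkN N s x) i j.
Proof. by rewrite /hN -mulmxA trace_trmx_mul. Qed.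

Let mhN N : measurable_fun [set: V] (hN N s).
Proof.
rewrite (_ : hN N s = fun x => \sum_i \sum_j W x i j * (X x *m shrinkN N s x) i j).
  apply: measurable_sum => i; apply: measurable_sum => j; apply: measurable_funM.
    exact: mmeasW.
  by case: (dshrink N i j i j).
by apply/funext => x; exact: hNE.
Qed.

Let bhN N : bounded_on_boxes (hN N s).
Proof.
rewrite (_ : hN N s = fun x => \sum_i \sum_j W x i j * (X x *m shrinkN N s x) i j).
  apply: bounded_sum => i; apply: bounded_sum => j; apply: bounded_on_boxesM => //.
  by case: (dshrink N i j i j).
by apply/funext => x; exact: hNE.
Qed.

Let mdvg N : measurable_fun [set: V] (dvg N).
Proof.
apply: measurable_sum => i; apply: measurable_sum => j.
by case: (dshrink N i j i j).
Qed.

Let bdvg N : bounded_on_boxes (dvg N).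
Proof.
apply: bounded_sum => i; apply: bounded_sum => j.
by case: (dshrink N i j i j).
Qed.

Let integrable_density_hN N :
  mu.-integrable [set: V] (EFin \o (fun x => profile_density (Q x) * hN N s x)).
Proof.
apply: integrable_compact; [exact: measurable_funM|exact: bounded_on_boxesM|].
by move=> x /profile_out[_ ->]; rewrite mul0r.
Qed.

Let integrable_profile_dvg N :
  mu.-integrable [set: V] (EFin \o (fun x => profile (Q x) * dvg N x)).
Proof.
apply: integrable_compact; [exact: measurable_funM|exact: bounded_on_boxesM|].
by move=> x /profile_out[-> _]; rewrite mul0r.
Qed.

(** The difference of the integrands is the divergence of [profile (Q x)] times the field X
    [shrinkN]. This field vanishes outside a box, so each partial derivative integrates to 0. *)
Let stein_identity N :
  (\int[mu]_x (profile_density (Q x) * hN N s x)%:E =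
   \int[mu]_x (profile (Q x) * dvg N x)%:E)%E.
Proof.
(* The factor - 1/2 in the derivative of [profile] meets the factor 2 in the gradient 2 W of Q. *)
pose G i j x := - 2^-1 * profile_density (Q x) * (2 * W x i j) * (X x *m shrinkN N s x) i j +
  profile (Q x) * (delta_mx i j *m shrinkN N s x + X x *m dshrinkmx b (K N x) (dK N i j x)) i j.
have IG i j : mu.-integrable [set: V] (EFin \o G i j) /\ (\int[mu]_x (G i j x)%:E = 0)%E.
  apply: (cdiff_integral0 (B := B) (cdiffM (dprofile i j) (dshrink N i j i j))).
  by move=> x /profile_out[-> _]; rewrite mul0r.
have SG x : profile (Q x) * dvg N x - profile_density (Q x) * hN N s x = \sum_i \sum_j G i j x.
  rewrite hNE /dvg !mulr_sumr -sumrB; apply: eq_bigr => i _.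
  rewrite !mulr_sumr -sumrB; apply: eq_bigr => j _; rewrite /G; by field.
have I0 : (\int[mu]_x (\sum_i \sum_j G i j x)%:E = 0)%E.
  under eq_integral do rewrite -sumEFin.
  rewrite integral_sum//; last first.
    move=> k; apply: eq_integrable (integrable_sum _ _ (fun j _ => (IG k j).1)) => // x _.
    by rewrite /= -sumEFin.
  rewrite big1// => i _; under eq_integral do rewrite -sumEFin.
  rewrite integral_sum//; last by move=> j; exact: (IG i j).1.
  by rewrite big1// => j _; exact: (IG i j).2.
move: I0; under eq_integral do rewrite -SG EFinB.
rewrite integralB//; [|exact: integrable_profile_dvg|exact: integrable_density_hN].
move/eqP; rewrite sube_eq//.
  by rewrite add0e => /eqP ->.
- by apply: integrable_fin_num => //; exact: integrable_profile_dvg.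
Qed.

Let C : R := (v%:R - r%:R + 1) * (2 * b + b ^+ 2).
Let c : R := 2 * b * r%:R ^+ 2 + b ^+ 2 * r%:R.

(** The error [binerr] written through traces and [recip1], so that it is defined without a spectral
    decomposition and its measurability is immediate. *)
Let errN N x := N.+1%:R * bincoef a N * \tr ((1%:M - s *: ((X x)^T *m X x)) ^+ N) *
  recip1 (\tr (K N x)).

(** Serves to extract measurability and local boundedness, which [cdiff] carries along; the
    direction and the derivative themselves are immaterial. *)
Let derrN N : exists g', cdiff (e i0 j0) (errN N) g'.
Proof.
have dY := mcdiff_gram s (dX i0 j0).
have dT := cdiff_comp (@measurable_recip1 R) (@measurable_drecip1 R) (@is_derive_recip1 R)
  (@recip1_bounded R) (cdiff_trace (mcdiff_binmx a N dY)).
by eexists; exact: cdiffM (cdiffMc (N.+1%:R * bincoef a N) (cdiff_trace (mcdiff_pow N dY))) dT.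
Qed.

Let y_bounds x U l : gram_spec x U l -> Q x < 1 -> forall i, 0 <= 1 - s * l i < 1.
Proof.
move=> g Q1 i; rewrite subr_ge0 (sl_le1 _ g Q1)/= gtrDl oppr_lt0 mulr_gt0//.
by case: g.
Qed.

Let errN_spec N x U l : gram_spec x U l -> Q x < 1 ->
  errN N x = binerr a N (fun i => 1 - s * l i).
Proof.
move=> g Q1; have [UU XX l0] := g; have y01 := y_bounds g Q1.
have y0 i : 0 <= 1 - s * l i by case/andP: (y01 i).
rewrite /errN /K (gram_affine_spec s UU XX) specmxX// binmx_spec// !specmx_trace//.
by rewrite /recip1 (binsum_total_ge1 a1 r0).
Qed.

Let dvg_le N x : D x -> profile (Q x) * dvg N x <= profile (Q x) * (C + c * errN N x).
Proof.
move=> Dx; have [Q1|Q1] := ltP (Q x) 1; last by rewrite /profile Q1 !mul0r.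
have [U [l g]] := specD Dx; have [UU XX l0] := g.
rewrite ler_wpM2l ?profile_ge0// (errN_spec N g Q1).
apply: (@divergence_le R v r (X x) U l a s b N) => // i.
by rewrite mulr_ge0 ?(ltW s0) ?(ltW (l0 i))//= (sl_le1 _ g Q1).
Qed.

Let integrable_profile_err N :
  mu.-integrable [set: V] (EFin \o (fun x => profile (Q x) * errN N x)).
Proof.
have [g' [me _ _ be _]] := derrN N.
apply: integrable_compact; [exact: measurable_funM|exact: bounded_on_boxesM|].
by move=> x /profile_out[-> _]; rewrite mul0r.
Qed.

Let integrable_profile : mu.-integrable [set: V] (EFin \o (fun x => profile (Q x))).
Proof. by apply: integrable_compact => // x /profile_out[]. Qed.

(** Dominated by a [profile (Q x)], thanks to the uniform bound [binerr] <= a. Pointwise convergence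
    holds because the positivity of the eigenvalues puts every y_i strictly below 1. *)
Let cvg_err : (\int[mu]_(x in D) (profile (Q x) * errN N x)%:E @[N --> \oo] --> 0)%E.
Proof.
have mpe N : measurable_fun D (fun x => (profile (Q x) * errN N x)%:E).
  apply/measurable_EFinP/measurable_funTS; have [g' [me _ _ _ _]] := derrN N.
  exact: measurable_funM.
have ig : mu.-integrable D (fun x => (a * profile (Q x))%:E).
  apply: (@integrableS _ _ _ _ setT) => //.
  by apply: eq_integrable (integrableZl measurableT a integrable_profile) => // x _; rewrite /= EFinM.
have pt x : D x -> (profile (Q x) * errN N x)%:E @[N --> \oo] --> 0%E.
  move=> Dx; apply/fine_cvgP; split; first exact: nearW.
  have [Q1|Q1] := ltP (Q x) 1; last first.
    rewrite (_ : (fun N => _) = cst 0); first exact: cvg_cst.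
    by apply/funext => N /=; rewrite /profile Q1 mul0r.
  have [U [l g]] := specD Dx.
  suff : (fun N => profile (Q x) * errN N x) @ \oo --> (0 : R) by [].
  rewrite (_ : (fun N => _) = fun N => profile (Q x) * binerr a N (fun i => 1 - s * l i)).
    rewrite -[X in _ --> X](mulr0 (profile (Q x))); apply: cvgM; first exact: cvg_cst.
    by apply: cvg_binerr_total => //; exact: y_bounds g Q1.
  by apply/funext => N /=; rewrite (errN_spec N g Q1).
have bd N x : D x -> (`|(profile (Q x) * errN N x)%:E| <= (a * profile (Q x))%:E)%E.
  move=> Dx; rewrite lee_fin normrM ger0_norm ?profile_ge0// mulrC.
  have [Q1|Q1] := ltP (Q x) 1; last by rewrite /profile Q1 !mulr0.
  have [U [l g]] := specD Dx; rewrite (errN_spec N g Q1).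
  rewrite ler_wpM2r ?profile_ge0//.
  have /andP[? ?] : 0 <= binerr a N (fun i => 1 - s * l i) <= a.
    by apply: binerr_ge0_le => // i; case/andP: (y_bounds g Q1 i) => -> /ltW.
  by rewrite ger0_norm.
have [_ _] := dominated_convergence mD mpe (measurable_cst _)
  (aeW _ pt) ig (aeW _ (fun x N => bd N x)).
by rewrite integral0.
Qed.

(** The dominating function comes from [psiN] <= b: the spectral weights [w] are nonnegative and sum
    to tr (W^T X), which is bounded on boxes. *)
Let cvg_density_h : (\int[mu]_(x in D) (profile_density (Q x) * hN N s x)%:E @[N --> \oo] -->
  \int[mu]_(x in D) (profile_density (Q x) * h x)%:E)%E.
Proof.
pose g x := profile_density (Q x) * (weight b * \tr ((W x)^T *m X x)).
have mg : measurable_fun [set: V] g.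
  apply: measurable_funM => //; apply: measurable_funM => //.
  by apply: mmeas_trace; apply: mmeasM => //; exact: mmeas_tr.
have ig : mu.-integrable [set: V] (EFin \o g).
  apply: integrable_compact => //; last by move=> x /profile_out[_ E]; rewrite /g E mul0r.
  apply: bounded_on_boxesM => //; apply: bounded_on_boxesM; first exact: bounded_on_boxes_cst.
  rewrite (_ : (fun x => _) = fun x => \sum_i \sum_j W x i j * X x i j); last first.
    by apply/funext => x; rewrite trace_trmx_mul.
  apply: bounded_sum => i; apply: bounded_sum => j; apply: bounded_on_boxesM => //.
  by case: (dX i j i j).
have mp N : measurable_fun D (fun x => (profile_density (Q x) * hN N s x)%:E).
  by apply/measurable_EFinP/measurable_funTS; exact: measurable_funM.
have mh : measurable_fun D (fun x => (profile_density (Q x) * h x)%:E).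
  by apply/measurable_EFinP; apply: measurable_funM measurable_weighted; exact: measurable_funTS.
have pt x : D x -> (profile_density (Q x) * hN N s x)%:E @[N --> \oo] -->
    (profile_density (Q x) * h x)%:E.
  move=> Dx; apply/fine_cvgP; split; first exact: nearW.
  suff : (fun N => profile_density (Q x) * hN N s x) @ \oo --> profile_density (Q x) * h x by [].
  have [Q1|Q1] := ltP (Q x) 1; last first.
    by rewrite profile_densityE Q1 mul0r; under eq_fun do rewrite mul0r; exact: cvg_cst.
  have [U [l gs]] := specD Dx.
  apply: cvgM; first exact: cvg_cst.
  by apply: (cvg_hN Dx gs s0) => i; exact: sl_le1 gs Q1.
have bd N x : D x -> (`|(profile_density (Q x) * hN N s x)%:E| <= (g x)%:E)%E.
  move=> Dx; rewrite lee_fin normrM ger0_norm ?profile_density_ge0//.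
  have [Q1|Q1] := ltP (Q x) 1; last by rewrite /g profile_densityE Q1 !mul0r.
  have [U [l gs]] := specD Dx; have y01 := y_bounds gs Q1.
  have y0 i : 0 <= 1 - s * l i by case/andP: (y01 i).
  rewrite ler_wpM2l ?profile_density_ge0// (hN_spec N gs); last by move=> i; exact: sl_le1 gs Q1.
  have [UU _ _] := gs.
  have -> : \tr ((W x)^T *m X x) = \sum_i w x U i.
    have UUt : U *m U^T = 1%:M by exact: mulmx1C.
    by rewrite -[X in \tr X]mulmx1 -UUt mulmxA mxtrace_mulC mulmxA.
  rewrite ger0_norm; last first.
    rewrite sumr_ge0// => i _; rewrite mulr_ge0 ?(w0 _ gs)// weight_ge0//.
    have /andP[] // : 0 <= psiN a b N (fun i => 1 - s * l i) i <= b by exact: psiN_bounds.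
  rewrite mulr_sumr ler_sum// => i _; rewrite ler_wpM2r ?(w0 _ gs)//.
  by apply: weight_le => //; exact: psiN_bounds.
by have [] := dominated_convergence mD mp mh (aeW _ pt)
  (integrableS measurableT mD (@subsetT _ _) ig) (aeW _ (fun x N => bd N x)).
Qed.

Lemma profile_inequality :
  (\int[mu]_(x in D) (profile_density (Q x) * h x)%:E <=
   ((v%:R - r%:R + 1) * (2 * b + b ^+ 2))%:E * \int[mu]_x (profile (Q x))%:E)%E.
Proof.
have toD (g : V -> R) : mu.-integrable [set: V] (EFin \o g) ->
    (\int[mu]_x (g x)%:E = \int[mu]_(x in D) (g x)%:E)%E.
  move=> ig; rewrite (negligible_integral (measurableC mD) measurableT ig D0).
  by rewrite setTD setCK.
have iD (g : V -> R) : mu.-integrable [set: V] (EFin \o g) -> mu.-integrable D (EFin \o g).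
  by move=> ig; exact: integrableS ig.
have iCp : mu.-integrable [set: V] (EFin \o (fun x => C * profile (Q x))).
  by apply: eq_integrable (integrableZl measurableT C integrable_profile) => // x _; rewrite /= EFinM.
have icp N : mu.-integrable [set: V] (EFin \o (fun x => c * (profile (Q x) * errN N x))).
  by apply: eq_integrable (integrableZl measurableT c (integrable_profile_err N)) => // x _; rewrite /= EFinM.
have bN N : (\int[mu]_(x in D) (profile_density (Q x) * hN N s x)%:E <=
    C%:E * \int[mu]_x (profile (Q x))%:E +
    c%:E * \int[mu]_(x in D) (profile (Q x) * errN N x)%:E)%E.
  rewrite -(toD _ (integrable_density_hN N)) stein_identity (toD _ (integrable_profile_dvg N)).
  have -> : (C%:E * \int[mu]_x (profile (Q x))%:E = \int[mu]_(x in D) (C * profile (Q x))%:E)%E.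
    rewrite (toD _ integrable_profile) -(integralZl mD (iD _ integrable_profile) C).
    by apply: eq_integral => x _; rewrite EFinM.
  have -> : (c%:E * \int[mu]_(x in D) (profile (Q x) * errN N x)%:E =
      \int[mu]_(x in D) (c * (profile (Q x) * errN N x))%:E)%E.
    rewrite -(integralZl mD (iD _ (integrable_profile_err N)) c).
    by apply: eq_integral => x _; rewrite EFinM.
  rewrite -(integralD mD (iD _ iCp) (iD _ (icp N))).
  apply: le_integral => //; first exact: iD (integrable_profile_dvg N).
    exact: integrableD (iD _ iCp) (iD _ (icp N)).
  move=> x /set_mem Dx; rewrite -EFinD lee_fin (le_trans (dvg_le N Dx))//.
  by rewrite mulrDr mulrC lerD2l mulrCA.
have cR : (C%:E * \int[mu]_x (profile (Q x))%:E +
    c%:E * \int[mu]_(x in D) (profile (Q x) * errN N x)%:E @[N --> \oo] -->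
    C%:E * \int[mu]_x (profile (Q x))%:E)%E.
  rewrite -[X in _ --> X]adde0; apply: cvgeD; first exact: fin_num_adde_defl.
    exact: cvg_cst.
  by rewrite -[X in _ --> X](mule0 c%:E); apply: cvgeZl => //; exact: cvg_err.
exact: (lee_cvg_to cvg_density_h cR (nearW _ bN)).
Qed.

End profile_inequality.

(** * Degenerate Gram matrices *)

Section discriminant.

Definition hankelmx (R : comNzRingType) r (A : 'M[R]_r) : 'M[R]_r :=
  \matrix_(i, j) \tr (A ^+ (i + j)).

(* Nonzero exactly when A is invertible with pairwise distinct eigenvalues:
   the Hankel matrix of the power sums is the Gram matrix of a Vandermonde matrix. *)
Definition gendisc (R : comNzRingType) r (A : 'M[R]_r) : R :=
  \det A * \det (hankelmx A).

Lemma map_mxX (R S : comNzRingType) (f : {rmorphism R -> S}) r (A : 'M[R]_r) k :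
  map_mx f (A ^+ k) = (map_mx f A) ^+ k.
Proof.
elim: k => [|k IH]; first by rewrite !expr0 -[LHS]/(map_mx f 1%:M) map_mx1.
by rewrite !exprS [LHS]map_mxM IH.
Qed.

Lemma hankelmx_map (R S : comNzRingType) (f : {rmorphism R -> S}) r (A : 'M[R]_r) :
  hankelmx (map_mx f A) = map_mx f (hankelmx A).
Proof. by apply/matrixP => i j; rewrite !mxE -map_mxX trace_map_mx. Qed.

Lemma gendisc_map (R S : comNzRingType) (f : {rmorphism R -> S}) r (A : 'M[R]_r) :
  gendisc (map_mx f A) = f (gendisc A).
Proof. by rewrite /gendisc hankelmx_map !det_map_mx rmorphM. Qed.

Lemma exprmx_similar (F : fieldType) r (P : 'M[F]_r) (d : 'rV[F]_r) k :
  P \in unitmx -> (invmx P *m diag_mx d *m P) ^+ k =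
  invmx P *m diag_mx (\row_i d 0 i ^+ k) *m P.
Proof.
move=> uP; elim: k => [|k IH].
  rewrite expr0 (_ : diag_mx _ = 1%:M) ?mulmx1 ?mulVmx//.
  by rewrite -diag_const_mx; congr diag_mx; apply/rowP => i; rewrite !mxE expr0.
rewrite exprS IH -[LHS]/(_ *m _) !mulmxA mulmxK// -[_ *m diag_mx _ *m diag_mx _]mulmxA mulmx_diag.
by congr (_ *m diag_mx _ *m _); apply/rowP => i; rewrite !mxE exprS.
Qed.

Lemma hankelmx_similar (F : fieldType) r (P : 'M[F]_r) (d : 'rV[F]_r) :
  P \in unitmx ->
  hankelmx (invmx P *m diag_mx d *m P) = Vandermonde r d *m (Vandermonde r d)^T.
Proof.
move=> uP; apply/matrixP => i j; rewrite !mxE exprmx_similar// mxtrace_mulC mulmxA.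
rewrite mulmxV// mul1mx mxtrace_diag; apply: eq_bigr => k _.
by rewrite !mxE exprD.
Qed.

Lemma hankelmx_distinct (F : fieldType) r (P : 'M[F]_r) (d : 'rV[F]_r) :
  P \in unitmx -> \det (hankelmx (invmx P *m diag_mx d *m P)) != 0 <->
  injective (fun i => d 0 i).
Proof.
move=> uP; rewrite hankelmx_similar// det_mulmx det_tr mulf_eq0 orbb det_Vandermonde.
split=> [dn0 i j dij|dinj].
  apply/eqP; apply: contraNT dn0 => ij.
  wlog lt_ij : i j dij ij / (i < j)%N.
    move=> H; case: (ltngtP i j) => [|ji|/val_inj E].
    - exact: H.
    - by apply: (H j i) => //; rewrite eq_sym.
    - by rewrite E eqxx in ij.
  by rewrite (bigD1 i)//= (bigD1 j)//= dij subrr !mul0r.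
apply/prodf_neq0 => i _; apply/prodf_neq0 => j ij; rewrite subr_eq0.
by apply/eqP => /dinj E; rewrite E ltnn in ij.
Qed.

End discriminant.

Section real_spectral.
Context (R : rcfType).

(** Over R[i] the matrix is hermitian, hence unitarily diagonalizable with real eigenvalues. They
    are distinct because the embedding preserves the nonvanishing of the Hankel determinant, and
    being roots of the characteristic polynomial they are eigenvalues over R as well. *)
Lemma symmetric_distinct_eigenvalues r (A : 'M[R]_r) : A^T = A ->
  \det (hankelmx A) != 0 ->
  exists s : seq R, [/\ size s = r, sorted >%R s & all (eigenvalue A) s].
Proof.
move=> symA hA; pose f := real_complex R; pose AC := map_mx f A.
have AC_real : AC \is a mxOver Num.real.
  by apply/mxOverP => i j; rewrite mxE complex_real.
have AC_sym : AC \is symmetricmx.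
  apply/is_hermitianmxP; rewrite expr0 scale1r.
  by apply/matrixP => i j; rewrite /AC !mxE/= -[in LHS]symA mxE.
have AC_herm := realsym_hermsym AC_sym AC_real.
have /orthomx_spectralP ACE := hermitian_normalmx AC_herm.
have dreal := hermitian_spectral_diag_real AC_herm.
have uP := spectral_unit AC.
set P := spectralmx AC in ACE uP; set d := spectral_diag AC in ACE dreal.
have hAC : \det (hankelmx AC) != 0.
  by rewrite /AC hankelmx_map det_map_mx fmorph_eq0.
rewrite ACE in hAC; have dinj := (hankelmx_distinct d uP).1 hAC.
pose x i := complex.Re (d 0 i).
have dx i : d 0 i = f (x i).
  have /complex_realP[y E] : d 0 i \is Num.real by exact: (mxOverP dreal).
  by rewrite /x E.
have xinj : injective x.
  by move=> i j E; apply: dinj; rewrite !dx E.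
have eig i : eigenvalue A (x i).
  suff : eigenvalue AC (d 0 i).
    by rewrite dx !eigenvalue_root_char -map_char_poly fmorph_root.
  apply/eigenvalueP; exists (row i P).
    rewrite -row_mul ACE !mulmxA mulmxV// mul1mx.
    by apply/rowP => j; rewrite mxE mul_diag_mx !mxE.
  apply/eqP => E; have := uP; rewrite -row_free_unit => /row_freeP[B PB].
  have := congr1 (row i) PB; rewrite row_mul E mul0mx row1.
  by move/rowP/(_ i); rewrite !mxE !eqxx/= => /esym/eqP; rewrite oner_eq0.
exists (rev (sort <=%R (codom x))); split.
- by rewrite size_rev size_sort size_codom card_ord.
- rewrite rev_sorted; have := sort_lt_sorted (codom x).
  by rewrite map_inj_uniq ?enum_uniq.
- by rewrite all_rev all_sort; apply/allP => _ /codomP[i ->].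
Qed.

(** Only the eigenvalues descend from R[i]; the eigenvectors are chosen afresh over R and
    normalized. Symmetry gives l_i <w_i, w_j> = l_j <w_i, w_j>, so distinct eigenvalues force
    orthogonality. *)
Lemma symmetric_distinct_spectral r (A : 'M[R]_r) : A^T = A -> \det (hankelmx A) != 0 ->
  exists U (l : 'I_r -> R), [/\ U^T *m U = 1%:M, A = U *m diag_mx (\row_i l i) *m U^T &
    forall i j : 'I_r, (i < j)%N -> l j < l i].
Proof.
move=> symA hA; have [s [ss srt alls]] := symmetric_distinct_eigenvalues symA hA.
pose l (i : 'I_r) := s`_i.
have lmono (i j : 'I_r) : (i < j)%N -> l j < l i.
  have tr : transitive (>%R : rel R) by move=> ? ? ? xy yz; exact: lt_trans yz xy.
  move=> ij; have := sorted_ltn_nth tr 0 srt; move=> /(_ i j).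
  by rewrite !inE !ss => /(_ (ltn_ord i) (ltn_ord j) ij).
have linj i j : i != j -> l i != l j.
  by case: (ltngtP i j) => [/lmono|/lmono|/val_inj ->]; [move/gt_eqF ->|move/lt_eqF ->|rewrite eqxx].
have eig i : exists v : 'rV[R]_r, v *m A = l i *: v /\ (v *m v^T) 0 0 = 1.
  have /allP/(_ (l i)) := alls; rewrite mem_nth ?ss// => /(_ isT) /eigenvalueP[v vA v0].
  pose c := Num.sqrt ((v *m v^T) 0 0).
  have n0 : 0 < (v *m v^T) 0 0.
    rewrite mxE; have [j vj] : exists j, v 0 j != 0.
      apply/existsP; rewrite -negb_forall; apply: contra v0 => /forallP v0.
      by apply/eqP/rowP => j; rewrite mxE; apply/eqP.
    rewrite (bigD1 j)//= ltr_wpDr ?sumr_ge0// => [k _|]; rewrite mxE ?sqr_ge0//.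
    by rewrite -expr2 exprn_even_gt0.
  have c0 : c != 0 by rewrite gt_eqF// sqrtr_gt0.
  exists (c^-1 *: v); split; first by rewrite -scalemxAl vA !scalerA mulrC.
  rewrite linearZ/= -scalemxAl -scalemxAr scalerA mxE.
  by rewrite -[X in _ * X]sqr_sqrtr ?(ltW n0)// -/c -expr2 exprVn mulVf// sqrf_eq0.
have [w wP] := choice eig.
pose P : 'M[R]_r := \matrix_i w i.
have PA : P *m A = diag_mx (\row_i l i) *m P.
  apply/row_matrixP => i; rewrite row_mul rowK (wP i).1.
  by apply/rowP => j; rewrite [RHS]mxE mul_diag_mx !mxE.
have PP : P *m P^T = 1%:M.
  apply/matrixP => i j; rewrite [RHS]mxE.
  have E : (P *m P^T) i j = (w i *m (w j)^T) 0 0.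
    by rewrite !mxE; apply: eq_bigr => k _; rewrite !mxE.
  rewrite E; have [->|ij] := eqVneq i j; first exact: (wP j).2.
  have : l i * (w i *m (w j)^T) 0 0 = l j * (w i *m (w j)^T) 0 0.
    transitivity ((w i *m A *m (w j)^T) 0 0); first by rewrite (wP i).1 -scalemxAl [RHS]mxE.
    by rewrite -mulmxA -[A]trmxK -trmx_mul symA (wP j).1 linearZ/= -scalemxAr [LHS]mxE.
  move/eqP; rewrite -subr_eq0 -mulrBl mulf_eq0 subr_eq0 (negbTE (linj _ _ ij))/=.
  by move/eqP.
exists P^T, l; split => //; first by rewrite trmxK.
by rewrite trmxK -mulmxA -PA mulmxA (mulmx1C PP) mul1mx.
Qed.

End real_spectral.

Section degenerate_null.
Context (R : realType) (q m p v r : nat).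

Local Notation V := ('M[R]_(q, p) * 'M[R]_(m, p))%type.
Local Notation mu := (@lebesgue_zu R q m p).

Lemma measurable_gendisc d (T : measurableType d) (F : T -> 'M[R]_r) :
  mmeas F -> measurable_fun [set: T] (fun x => gendisc (F x)).
Proof.
move=> mF; apply: measurable_funM; apply: measurable_det => // i j.
under [X in measurable_fun _ X]eq_fun do rewrite mxE.
by apply: mmeas_trace; exact: mmeas_pow.
Qed.

(** For r <= v its Gram matrix is diag (1, 4, ..., r^2), a witness that the discriminant is not
    identically zero. *)
Definition staircase : 'M[R]_(v, r) :=
  \matrix_(i, j) (if i == j :> nat then j.+1%:R else 0).

Lemma gendisc_staircase : (r <= v)%N -> gendisc (staircase^T *m staircase) != 0.
Proof.
move=> rv; pose d : 'rV[R]_r := \row_j j.+1%:R ^+ 2.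
have -> : staircase^T *m staircase = diag_mx d.
  apply/matrixP => i j; rewrite !mxE (bigD1 (widen_ord rv i))//= !mxE eqxx big1 ?addr0.
    rewrite -val_eqE/=; case: eqP => [->|_]; first by rewrite mulr1n.
    by rewrite mulr0 mulr0n.
  move=> k ki; rewrite !mxE ifF ?mul0r//; apply/negbTE; apply: contra ki => /eqP ki.
  by apply/eqP/val_inj.
have d0 i : d 0 i != 0 by rewrite mxE expf_neq0.
rewrite mulf_neq0//; first by rewrite det_diag prodf_seq_neq0; apply/allP => i _; exact: d0.
have E : diag_mx d = invmx 1%:M *m diag_mx d *m 1%:M by rewrite mulmx1 invmx1 mul1mx.
rewrite E; apply/(hankelmx_distinct d (unitmx1 _ _)) => i j; rewrite !mxE => /eqP.
rewrite eqrXn2 ?ler0n// eqr_nat => /eqP[]; exact: val_inj.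
Qed.

Variables (X : V -> 'M[R]_(v, r)).
Hypothesis X_lin : forall c x d, X (c *: x + d) = c *: X x + X d.
Hypothesis X_meas : mmeas X.

Let disc x := gendisc ((X x)^T *m X x).

Let bad : set V := [set x | disc x = 0].

Let mdisc : measurable_fun [set: V] disc.
Proof. by apply: measurable_gendisc; apply: mmeasM => //; exact: mmeas_tr. Qed.

Lemma measurable_degenerate : measurable bad.
Proof.
rewrite (_ : bad = disc @^-1` [set 0])// -[X in measurable X]setTI.
exact: mdisc.
Qed.

(* Along every line through a nondegenerate point d the discriminant is a
   nonzero polynomial. *)
Let line_finite (d x : V) : disc d != 0 ->
  finite_set [set t : R | disc (t *: x + d) = 0].
Proof.
move=> dd; pose XX : 'M[{poly R}]_(v, r) :=
  map_mx (@polyC R) (X d) + 'X *: map_mx (@polyC R) (X x).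
pose P := gendisc (XX^T *m XX).
have PE t : P.[t] = disc (t *: x + d).
  rewrite -horner_evalE /P -gendisc_map /disc; congr gendisc.
  rewrite map_mxM -map_trmx X_lin.
  suff -> : map_mx (horner_eval t) XX = t *: X x + X d by [].
  by apply/matrixP => i j; rewrite !mxE/= horner_evalE !hornerE addrC.
have P0 : P != 0.
  by apply: contra dd => /eqP P0; rewrite -[d]add0r -(scale0r x) -PE P0 horner0.
apply: (@sub_finite_set _ _ [set` rootsR P]); last exact: finite_seq.
by move=> t /= dt; rewrite -(roots_on_rootsR P0) in_itv/= rootE PE dt eqxx.
Qed.

(** Tonelli's theorem for the pairs (t, x) with 1 <= t <= 2 and degenerate t x + d. For fixed x
    there are finitely many t, so the set is null; for fixed t the section is an affine preimage of
    [bad], whose measure is therefore 0. *)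
Lemma degenerate_null (d : V) : gendisc ((X d)^T *m X d) != 0 -> mu bad = 0%E.
Proof.
move=> dd; pose T := (measurableTypeR R * V)%type.
pose A : set T := [set y | 1 <= y.1 <= 2 /\ disc (y.1 *: y.2 + d) = 0].
have mA : measurable A.
  have mline : measurable_fun [set: T] (fun y => disc (y.1 *: y.2 + d)).
    have mX : mmeas (fun y : T => X (y.1 *: y.2 + d)).
      rewrite (_ : (fun y : T => _) = fun y => y.1 *: X y.2 + X d); last first.
        by apply/funext => y; rewrite X_lin.
      apply: mmeasD; last exact: mmeas_cst.
      apply: mmeasZ; first exact: measurable_fst.
      by move=> i j; exact: measurableT_comp (X_meas i j) measurable_snd.
    by apply: measurable_gendisc; apply: mmeasM => //; exact: mmeas_tr.
  rewrite (_ : A = (fst @^-1` `[1, 2]) `&` ((fun y => disc (y.1 *: y.2 + d)) @^-1` [set 0])).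
    apply: measurableI.
      by rewrite -[X in measurable X]setTI; exact: measurable_fst.
    by rewrite -[X in measurable X]setTI; exact: mline.
  by apply/seteqP; split => y /=; rewrite in_itv.
have F0 : (\int[lebesgue_measure]_t mu (xsection A t) = 0)%E.
  have := @indic_fubini_tonelli _ _ _ _ R lebesgue_measure mu A mA.
  rewrite indic_fubini_tonelli_FE// indic_fubini_tonelli_GE// => ->.
  rewrite (_ : _ \o _ = cst 0%E) ?integral_cst0 ?integral0//; apply/funext => x /=.
  apply: countable_lebesgue_measure0; apply: finite_set_countable.
  by apply: sub_finite_set (line_finite x dd) => t; rewrite /ysection/= inE => -[].
have c0 : (0 <= (2 : R) ^+ ((q + m) * p))%R by rewrite exprn_ge0.
have mbad := measurable_degenerate.
(* The Jacobian t^N, with N the dimension, is at most 2^N on [1, 2]; this makes the bound uniform in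
   t. *)
have sec t : 1 <= t <= 2 -> (mu bad <= (2 ^+ ((q + m) * p))%:E * mu (xsection A t))%E.
  move=> t12; have /andP[t1 t2] := t12; have t0 : 0 < t by exact: lt_le_trans t1.
  rewrite -(rescales_lebesgue_zu t0 d mbad) (_ : xsection A t = affine_zu t d @^-1` bad).
    by rewrite lee_wpmul2r// lee_fin lerXn2r ?nnegrE// ltW.
  apply/seteqP; split => x; rewrite /xsection/= inE; first by case.
  by move=> ?; split.
have mF : measurable_fun [set: measurableTypeR R] (fun t => mu (xsection A t)).
  exact: measurable_fun_xsection.
have : (\int[lebesgue_measure]_(t in `[1%R, 2%R]) (mu bad) <=
    \int[lebesgue_measure]_(t in `[1%R, 2%R]) ((2 ^+ ((q + m) * p))%:E * mu (xsection A t)))%E.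
  apply: ge0_le_integral => //.
  by apply: measurable_funTS; exact: measurable_funeM.
rewrite ge0_integralZl//; last exact: measurable_funTS.
have -> : (\int[lebesgue_measure]_(t in `[1%R, 2%R]) mu (xsection A t) = 0)%E.
  apply/eqP; rewrite eq_le integral_ge0// andbT -F0.
  by apply: ge0_subset_integral.
rewrite mule0 integral_cst//= lebesgue_measure_itv/= lte_fin ltr1n/= -EFinB.
rewrite (_ : 2 - 1 = 1 :> R) ?mule1; last by rewrite -[2]/(1 + 1) addrK.
by move=> b0; apply/eqP; rewrite eq_le b0 measure_ge0.
Qed.

End degenerate_null.

Section gram_spectral.
Context (R : realType) (v r : nat).

(** The l_i are squared norms of the columns of X U, and the factor det A of [gendisc] excludes
    0. *)
Lemma gram_distinct_spectral (X : 'M[R]_(v, r)) : gendisc (X^T *m X) != 0 ->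
  exists U (l : 'I_r -> R), [/\ U^T *m U = 1%:M, X^T *m X = specmx U l,
    forall i, 0 < l i & forall i j : 'I_r, (i < j)%N -> l j < l i].
Proof.
rewrite mulf_eq0 negb_or => /andP[dA hA].
have symA : (X^T *m X)^T = X^T *m X by rewrite trmx_mul trmxK.
have [U [l [UU AE lmono]]] := symmetric_distinct_spectral symA hA.
exists U, l; split => // i; rewrite lt_neqAle; apply/andP; split.
  rewrite eq_sym; apply: contra dA => /eqP li0.
  have UUt : U *m U^T = 1%:M by exact: mulmx1C.
  rewrite AE !det_mulmx det_diag (bigD1 i)//= mxE li0 mul0r mulr0 mul0r//.
have E : U^T *m (X^T *m X) *m U = diag_mx (\row_i l i).
  by rewrite AE -/(specmx U l) specmx_conj.
have : 0 <= (U^T *m (X^T *m X) *m U) i i.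
  rewrite mulmxA -trmx_mul -mulmxA mxE sumr_ge0// => k _.
  by rewrite [X in X * _]mxE -expr2 sqr_ge0.
by rewrite E !mxE eqxx mulr1n.
Qed.

End gram_spectral.

(** * Estimators and losses *)

Section eigenvalue_decompositions.
Context (R : realType) (p r : nat).
Implicit Types (S : 'M[R]_p) (l : 'rV[R]_r) (Hl Km : ('M[R]_(p, r) * 'rV[R]_r)%type).

Definition fdiag (f : R -> R) l : 'M[R]_r := diag_mx (\row_i f (l 0 i)).

Lemma fdiag_id l : fdiag id l = diag_mx l.
Proof. by congr diag_mx; apply/rowP => i; rewrite mxE. Qed.

Lemma fdiagM f g l : fdiag f l *m fdiag g l = fdiag (fun t => f t * g t) l.
Proof. by rewrite mulmx_diag; congr diag_mx; apply/rowP => i; rewrite !mxE. Qed.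

Lemma fdiag_trace f l : \tr (fdiag f l) = \sum_i f (l 0 i).
Proof. by rewrite mxtrace_diag; apply: eq_bigr => i _; rewrite mxE. Qed.

(** Functional calculus on the range of H alone: when r < p the orthogonal complement is sent to 0
    whatever f is. Hence [GRing.inv] gives the Moore-Penrose inverse. *)
Definition spectralfun (f : R -> R) (Hl : 'M[R]_(p, r) * 'rV[R]_r) : 'M[R]_p :=
  Hl.1 *m fdiag f Hl.2 *m Hl.1^T.

Lemma spectralfunM f g Hl : Hl.1^T *m Hl.1 = 1%:M ->
  spectralfun f Hl *m spectralfun g Hl = spectralfun (fun t => f t * g t) Hl.
Proof.
move=> HH; rewrite /spectralfun !mulmxA -[_ *m Hl.1^T *m Hl.1]mulmxA HH mulmx1.
by rewrite -[Hl.1 *m _ *m fdiag g _]mulmxA fdiagM.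
Qed.

Lemma spectralfunD f g Hl :
  spectralfun f Hl + spectralfun g Hl = spectralfun (fun t => f t + g t) Hl.
Proof.
rewrite /spectralfun -mulmxDl -mulmxDr; congr (_ *m _ *m _).
by rewrite -raddfD; congr diag_mx; apply/rowP => i; rewrite !mxE.
Qed.

Lemma spectralfunZ c f Hl : c *: spectralfun f Hl = spectralfun (fun t => c * f t) Hl.
Proof.
rewrite /spectralfun scalemxAl scalemxAr; congr (_ *m _ *m _).
by rewrite -linearZ; congr diag_mx; apply/rowP => i; rewrite !mxE.
Qed.

Lemma trmx_spectralfun f Hl : (spectralfun f Hl)^T = spectralfun f Hl.
Proof. by rewrite /spectralfun !trmx_mul trmxK tr_diag_mx mulmxA. Qed.

Lemma spectralfun_trace f Hl : Hl.1^T *m Hl.1 = 1%:M ->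
  \tr (spectralfun f Hl) = \sum_i f (Hl.2 0 i).
Proof. by move=> HH; rewrite mxtrace_mulC mulmxA HH mul1mx fdiag_trace. Qed.

Lemma eq_spectralfun f g Hl : (forall i, f (Hl.2 0 i) = g (Hl.2 0 i)) ->
  spectralfun f Hl = spectralfun g Hl.
Proof.
move=> fg; rewrite /spectralfun /fdiag; congr (_ *m diag_mx _ *m _).
by apply/rowP => i; rewrite !mxE.
Qed.

Definition spectral_decomposition S Hl := [/\ Hl.1^T *m Hl.1 = 1%:M,
  S = spectralfun id Hl & forall i, 0 < Hl.2 0 i].

Lemma is_evdE S Hl : is_evd S Hl -> spectral_decomposition S Hl.
Proof. by case: Hl => H l [HH SE l0 _]; split => //; rewrite /spectralfun fdiag_id. Qed.

Lemma spectralfun_mulV Hl : Hl.1^T *m Hl.1 = 1%:M -> (forall i, 0 < Hl.2 0 i) ->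
  spectralfun id Hl *m spectralfun GRing.inv Hl = Hl.1 *m Hl.1^T.
Proof.
move=> HH l0; rewrite spectralfunM// (eq_spectralfun (g := fun=> 1)); last first.
  by move=> i; rewrite /= divff// gt_eqF.
rewrite /spectralfun (_ : fdiag _ _ = 1%:M) ?mulmx1//.
by rewrite -diag_const_mx; congr diag_mx; apply/rowP => i; rewrite !mxE.
Qed.

(* Two decompositions of S differ by an orthogonal matrix that intertwines the
   diagonal parts, so every function of S is well defined. *)
Lemma spectral_unique S Hl Km (f : R -> R) :
  spectral_decomposition S Hl -> spectral_decomposition S Km ->
  spectralfun f Hl = spectralfun f Km /\ \sum_i f (Hl.2 0 i) = \sum_i f (Km.2 0 i).
Proof.
move=> [HH SH l0] [KK SK m0].
(* The columns of each H lie in the range of S, on which the projection K K^T of the other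
   decomposition is the identity. *)
have range Hl' Km' : Hl'.1^T *m Hl'.1 = 1%:M -> (forall i, 0 < Hl'.2 0 i) ->
    Km'.1^T *m Km'.1 = 1%:M -> S = spectralfun id Hl' -> S = spectralfun id Km' ->
    Km'.1 *m Km'.1^T *m Hl'.1 = Hl'.1.
  move=> HH' l0' KK' SH' SK'.
  have E : Hl'.1 = S *m (spectralfun GRing.inv Hl' *m Hl'.1).
    by rewrite mulmxA SH' spectralfun_mulV// -mulmxA HH' mulmx1.
  rewrite E mulmxA; congr (_ *m _); rewrite SK' /spectralfun !mulmxA.
  by rewrite -[Km'.1 *m _ *m Km'.1]mulmxA KK' mulmx1.
have HKK := range Hl Km HH l0 KK SH SK.
have KHH := range Km Hl KK m0 HH SK SH.
have [C CE] : exists C, C = Hl.1^T *m Km.1 by eexists.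
have CCt : C *m C^T = 1%:M.
  by rewrite CE trmx_mul trmxK mulmxA -[_ *m Km.1 *m _]mulmxA -mulmxA HKK.
have LC : fdiag id Hl.2 *m C = C *m fdiag id Km.2.
  have -> : fdiag id Hl.2 *m C = Hl.1^T *m S *m Km.1.
    by rewrite SH /spectralfun CE !mulmxA HH mul1mx.
  by rewrite SK /spectralfun CE !mulmxA -mulmxA KK mulmx1.
(* Entrywise, intertwining says that C i j = 0 unless the i-th eigenvalue of one decomposition
   equals the j-th of the other; then f takes the same value at both. *)
have fC : fdiag f Hl.2 *m C = C *m fdiag f Km.2.
  apply/matrixP => i j; have := congr1 (fun M : 'M[R]_r => M i j) LC.
  rewrite !mul_diag_mx !mul_mx_diag !mxE => /eqP; rewrite mulrC -subr_eq0 -mulrBr mulf_eq0.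
  by case/orP => [/eqP ->|]; rewrite ?mulr0 ?mul0r// subr_eq0 => /eqP ->; rewrite mulrC.
have fE : fdiag f Hl.2 = C *m fdiag f Km.2 *m C^T.
  by rewrite -fC -mulmxA CCt mulmx1.
split; last first.
  by rewrite -!fdiag_trace fE mxtrace_mulC mulmxA (mulmx1C CCt) mul1mx.
have HC : Hl.1 *m C = Km.1 by rewrite CE mulmxA.
rewrite /spectralfun fE !mulmxA HC.
by rewrite -mulmxA -trmx_mul HC.
Qed.

Variables (a b : R).

Definition psifun l (t : R) : R := b / (\sum_k l 0 k `^ (- a)) * t `^ (- a).

Lemma PsiE l : Psi a b l = fdiag (psifun l) l.
Proof.
rewrite /Psi /diag_powN mxtrace_diag -linearZ/=; congr diag_mx; apply/rowP => i.
rewrite !mxE /psifun; congr (_ / _ * _); by apply: eq_bigr => k _; rewrite mxE.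
Qed.

Lemma evdP S Hl : is_evd S Hl -> is_evd S (evd r S).
Proof. by move=> SHl; apply: xgetPex; exists Hl. Qed.

(** [Km] only certifies that [evd] did not return its default. The value is then computed in any
    decomposition [Hl], ordered or not. *)
Lemma HPsiH_evd S Km Hl : is_evd S Km -> spectral_decomposition S Hl ->
  HPsiH r a b S = spectralfun (psifun Hl.2) Hl.
Proof.
move=> SKm SHl; have := is_evdE (evdP SKm).
rewrite /HPsiH; case: (evd r S) => K k SK.
rewrite PsiE -[LHS]/(spectralfun (psifun k) (K, k)).
have [_ E] := spectral_unique (fun t => t `^ (- a)) SK SHl.
have -> : psifun k = psifun Hl.2.
  by apply/funext => t; rewrite /psifun -[X in b / X]/(\sum_k0 (K, k).2 0 k0 `^ (- a)) E.
by have [] := spectral_unique (psifun Hl.2) SK SHl.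
Qed.

Lemma HLPsiH_evd S Km Hl : is_evd S Km -> spectral_decomposition S Hl ->
  HLPsiH r a b S = spectralfun (fun t => t * psifun Hl.2 t) Hl.
Proof.
move=> SKm SHl; have := is_evdE (evdP SKm).
rewrite /HLPsiH; case: (evd r S) => K k SK.
rewrite PsiE -fdiag_id -[K *m _ *m _]mulmxA fdiagM.
rewrite -[LHS]/(spectralfun (fun t => t * psifun k t) (K, k)).
have [_ E] := spectral_unique (fun t => t `^ (- a)) SK SHl.
have -> : psifun k = psifun Hl.2.
  by apply/funext => t; rewrite /psifun -[X in b / X]/(\sum_k0 (K, k).2 0 k0 `^ (- a)) E.
by have [] := spectral_unique (fun t => t * psifun Hl.2 t) SK SHl.
Qed.

Lemma is_evd_scale S (c : R) H l : 0 < c -> is_evd S (H, l) -> is_evd (c *: S) (H, c *: l).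
Proof.
move=> c0 [HH -> l0 ld]; split => //.
- by rewrite linearZ/= -scalemxAr -scalemxAl.
- by move=> i; rewrite mxE mulr_gt0.
- by move=> i j ij; rewrite !mxE ltr_pM2l// ld.
Qed.

(** Psi is homogeneous of degree 0, since the factor c^(-a) divides out of numerator and trace. If S
    has no decomposition, neither has c S, and both sides use the same default of [evd]. *)
Lemma HPsiH_scale S (c : R) : 0 < c -> HPsiH r a b (c *: S) = HPsiH r a b S.
Proof.
move=> c0; have [[[H l] SHl]|nS] := pselect (exists Hl, is_evd (r := r) S Hl).
  rewrite (HPsiH_evd SHl (is_evdE SHl)).
  rewrite (HPsiH_evd (is_evd_scale c0 SHl) (is_evdE (is_evd_scale c0 SHl))).
  have [_ _ l0 _] := SHl.
  rewrite /spectralfun /= /fdiag; congr (_ *m diag_mx _ *m _); apply/rowP => i.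
  rewrite !mxE /psifun (eq_bigr (fun k => c `^ (- a) * l 0 k `^ (- a))); last first.
    by move=> k _; rewrite mxE powRM// ltW.
  rewrite powRM ?(ltW c0) ?(ltW (l0 i))// -mulr_sumr invfM.
  have : c `^ (- a) != 0 by rewrite gt_eqF// powR_gt0.
  move: (c `^ (- a)) (\sum_k _) => u w u0.
  move: (l 0 i `^ (- a)) => z.
  have -> : b * (u^-1 * w^-1) * (u * z) = b / w * z * (u^-1 * u) by ring.
  by rewrite mulVf// mulr1.
have e0 T : ~ (exists Hl, is_evd (r := r) T Hl) -> evd r T = (0, 0).
  by move=> nT; apply: xgetPN => Hl THl; apply: nT; exists Hl.
rewrite /HPsiH e0//; last first.
  move=> [[H l] SHl]; apply: nS; exists (H, c^-1 *: l).
  have -> : S = c^-1 *: (c *: S) by rewrite scalerA mulVf ?scale1r// gt_eqF.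
  by apply: is_evd_scale SHl; rewrite invr_gt0.
by rewrite e0.
Qed.

Lemma is_moore_penrose_unique k n (A : 'M[R]_(k, n)) B C :
  is_moore_penrose A B -> is_moore_penrose A C -> B = C.
Proof.
move=> [ABA BAB AB BA] [ACA CAC AC CA].
have E1 : A *m B = A *m C.
  have h1 : A *m C *m (A *m B) = A *m B by rewrite mulmxA ACA.
  have h2 : A *m B *m (A *m C) = A *m C by rewrite mulmxA ABA.
  by rewrite -h2 -{1}AB -[in LHS]h1 trmx_mul AB AC.
have E2 : B *m A = C *m A.
  have h1 : B *m A *m (C *m A) = B *m A by rewrite -mulmxA [A *m _]mulmxA ACA.
  have h2 : C *m A *m (B *m A) = C *m A by rewrite -mulmxA [A *m _]mulmxA ABA.
  by rewrite -h2 -{1}BA -[in LHS]h1 trmx_mul BA CA.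
by rewrite -BAB E2 -mulmxA E1 mulmxA.
Qed.

Lemma moore_penrose_evd S Hl : is_evd S Hl -> moore_penrose S = spectralfun GRing.inv Hl.
Proof.
move=> /is_evdE[HH SE l0].
have SI := spectralfun_mulV HH l0.
have IS : spectralfun GRing.inv Hl *m spectralfun id Hl = Hl.1 *m Hl.1^T.
  by rewrite -[LHS]trmxK trmx_mul !trmx_spectralfun SI trmx_mul trmxK.
have MP : is_moore_penrose S (spectralfun GRing.inv Hl).
  have Hf f : Hl.1 *m Hl.1^T *m spectralfun f Hl = spectralfun f Hl.
    by rewrite /spectralfun !mulmxA -[_ *m Hl.1^T *m Hl.1]mulmxA HH mulmx1.
  by rewrite SE; split; rewrite ?SI ?IS ?Hf// trmx_mul trmxK.
by apply: (is_moore_penrose_unique _ MP); apply: xgetPex; exists (spectralfun GRing.inv Hl).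
Qed.

End eigenvalue_decompositions.

(** * Inequalities for positive definite matrices *)

Section positive_definite.
Context (R : realType) (p : nat).
Implicit Types (Sigma : 'M[R]_p).

Lemma posdef_unit Sigma : posdef Sigma -> Sigma \in unitmx.
Proof.
move=> [_ pos]; rewrite -row_free_unit -kermx_eq0; apply/eqP/row_matrixP => i.
rewrite row0; apply/eqP; apply: contraT => /pos.
by rewrite -row_mul mulmx_ker row0 mul0mx mxE ltxx.
Qed.

Lemma posdef_inv Sigma : posdef Sigma -> posdef (invmx Sigma).
Proof.
move=> pSigma; have uS := posdef_unit pSigma; have [symS pos] := pSigma.
split=> [|x x0]; first by rewrite trmx_inv symS.
have := pos (x *m invmx Sigma); rewrite mulmxKV// trmx_mul trmx_inv symS mulmxA; apply.
by apply: contra x0 => /eqP E; rewrite -[x](mulmxKV uS) E mul0mx.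
Qed.

Lemma posdef_ge0 Sigma (x : 'rV[R]_p) : posdef Sigma -> 0 <= (x *m Sigma *m x^T) 0 0.
Proof.
move=> [_ pos]; have [->|/pos/ltW//] := eqVneq x 0.
by rewrite !mul0mx mxE.
Qed.

Lemma posdef_quad_ge0 Sigma k (A : 'M[R]_(k, p)) i : posdef Sigma ->
  0 <= (A *m Sigma *m A^T) i i.
Proof.
move=> pS; have := posdef_ge0 (row i A) pS.
rewrite -row_mul (_ : (_ *m _) 0 0 = (A *m Sigma *m A^T) i i)//.
by rewrite !mxE; apply: eq_bigr => k0 _; rewrite !mxE.
Qed.

Lemma posdef_trace_ge0 Sigma k (A : 'M[R]_(k, p)) : posdef Sigma ->
  0 <= \tr (A *m Sigma *m A^T).
Proof. by move=> pS; apply: sumr_ge0 => i _; exact: posdef_quad_ge0. Qed.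

(* Cauchy-Schwarz for the pair x, e_j with respect to Sigma. *)
Lemma posdef_entry_le Sigma (x : 'rV[R]_p) j : posdef Sigma ->
  x 0 j ^+ 2 <= Sigma j j * (x *m invmx Sigma *m x^T) 0 0.
Proof.
move=> pS; have uS := posdef_unit pS; have [symS pos] := pS.
have pI := posdef_inv pS.
pose B := (x *m invmx Sigma *m x^T) 0 0.
pose ej : 'rV[R]_p := delta_mx 0 j.
have Sjj : Sigma j j = (ej *m Sigma *m ej^T) 0 0.
  by rewrite -rowE trmx_delta -colE !mxE.
have S0 : 0 < Sigma j j.
  rewrite Sjj; apply: pos; apply/eqP => /rowP/(_ j); rewrite !mxE !eqxx => /eqP.
  by rewrite oner_eq0.
(* Up to the factor [Sigma j j], the component of x orthogonal to Sigma e_j for the inner product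
   given by [invmx Sigma]. *)
pose y := Sigma j j *: x - x 0 j *: (ej *m Sigma).
have := posdef_ge0 y pI.
have -> : (y *m invmx Sigma *m y^T) 0 0 = Sigma j j * (Sigma j j * B - x 0 j ^+ 2).
  have yI : y *m invmx Sigma = Sigma j j *: (x *m invmx Sigma) - x 0 j *: ej.
    by rewrite /y mulmxBl -!scalemxAl mulmxK.
  have yT : y^T = Sigma j j *: x^T - x 0 j *: (Sigma *m ej^T).
    by rewrite /y linearB/= !linearZ/= trmx_mul symS.
  rewrite yI yT mulmxBl !mulmxBr -!scalemxAl -!scalemxAr !mulmxA mulmxKV//.
  have e1 : (x *m ej^T) 0 0 = x 0 j by rewrite trmx_delta -colE mxE.
  have e2 : (ej *m x^T) 0 0 = x 0 j by rewrite -rowE !mxE.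
  have mE (A C : 'M[R]_1) : (A - C) 0 0 = A 0 0 - C 0 0 by rewrite !mxE.
  have zE c (A : 'M[R]_1) : (c *: A) 0 0 = c * A 0 0 by rewrite mxE.
  rewrite !mE !zE e1 e2 -/B -Sjj; ring.
by rewrite pmulr_rge0// subr_ge0.
Qed.

Lemma posdef_diag_gt0 Sigma j : posdef Sigma -> 0 < Sigma j j.
Proof.
move=> [_ pos]; have := pos (delta_mx 0 j); rewrite -rowE trmx_delta -colE !mxE; apply.
by apply/eqP => /rowP/(_ j); rewrite !mxE !eqxx => /eqP; rewrite oner_eq0.
Qed.

Lemma posdef_entries_le Sigma k (A : 'M[R]_(k, p)) i j : posdef Sigma ->
  A i j ^+ 2 <= Sigma j j * \tr (A *m invmx Sigma *m A^T).
Proof.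
move=> pS; have pI := posdef_inv pS.
have := posdef_entry_le (row i A) j pS; rewrite mxE => /le_trans; apply.
rewrite ler_wpM2l ?(ltW (posdef_diag_gt0 j pS))//.
rewrite (_ : (_ *m _) 0 0 = (A *m invmx Sigma *m A^T) i i).
  by rewrite /mxtrace (bigD1 i)//= lerDl sumr_ge0// => l _; exact: posdef_quad_ge0.
by rewrite -row_mul !mxE; apply: eq_bigr => l _; rewrite !mxE.
Qed.

Lemma posdef_gram_le Sigma k (A : 'M[R]_(k, p)) : posdef Sigma ->
  \tr (A^T *m A) <= \tr Sigma * \tr (A *m invmx Sigma *m A^T).
Proof.
move=> pS; rewrite mxtrace_mulC mulr_sumr ler_sum// => i _.
rewrite mxE mulr_suml ler_sum// => j _.
rewrite [X in _ * X]mxE -expr2.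
have := posdef_entry_le (row i A) j pS; rewrite mxE.
rewrite (_ : (_ *m _) 0 0 = (A *m invmx Sigma *m A^T) i i)//.
by rewrite -row_mul !mxE; apply: eq_bigr => l _; rewrite !mxE.
Qed.

End positive_definite.

Section risk_integrand.
Context (R : realType) (p r : nat) (Sigma : 'M[R]_p) (a b ao : R).
Hypothesis pS : posdef Sigma.
Implicit Types (S : 'M[R]_p).

Definition loss S (Sh : 'M[R]_p) : R :=
  \tr (moore_penrose S *m Sigma *m (invmx Sigma *m Sh - 1%:M) ^+ 2).

(* tr (Sigma^-1 H L (2 Psi + Psi^2) H^T). *)
Definition shrinkage_term S : R :=
  \tr (invmx Sigma *m (S *m (2 *: HPsiH r a b S + HPsiH r a b S *m HPsiH r a b S))).

Let lossE S Sh : loss S Sh =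
  \tr (moore_penrose S *m Sh *m invmx Sigma *m Sh) - 2 * \tr (moore_penrose S *m Sh) +
  \tr (moore_penrose S *m Sigma).
Proof.
have uS := posdef_unit pS.
rewrite /loss expr2 -[X in _ *m _ *m X]/((invmx Sigma *m Sh - 1%:M) *m (invmx Sigma *m Sh - 1%:M)).
rewrite mulmxBl !mulmxBr !mulmx1 !mul1mx -!mulmxA.
have E A : Sigma *m (invmx Sigma *m A) = A by rewrite mulmxA mulmxV// mul1mx.
rewrite !E !raddfB/=; ring.
Qed.

Let trace_spectralfun f (Hl : 'M[R]_(p, r) * 'rV[R]_r) (B : 'M[R]_p) :
  \tr (spectralfun f Hl *m B) = \sum_i f (Hl.2 0 i) * (Hl.1^T *m B *m Hl.1) i i.
Proof.
rewrite /spectralfun -mulmxA mxtrace_mulC mulmxA mxtrace_mulC /mxtrace.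
by apply: eq_bigr => i _; rewrite mul_diag_mx !mxE.
Qed.

Lemma shrinkage_term_evd S (Km Hl : 'M[R]_(p, r) * 'rV[R]_r) : is_evd S Km -> spectral_decomposition S Hl ->
  shrinkage_term S = \sum_i weight (psifun a b Hl.2 (Hl.2 0 i)) *
    (Hl.2 0 i * (Hl.1^T *m invmx Sigma *m Hl.1) i i).
Proof.
move=> SKm SHl; have [HH SE l0] := SHl.
rewrite /shrinkage_term (HPsiH_evd _ _ SKm SHl) {1}SE spectralfunM// spectralfunZ spectralfunD.
rewrite spectralfunM// mxtrace_mulC trace_spectralfun.
apply: eq_bigr => i _; rewrite /weight; ring.
Qed.

Lemma shrinkage_term_scale S (c : R) : 0 < c ->
  shrinkage_term (c *: S) = c * shrinkage_term S.
Proof.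
by move=> c0; rewrite /shrinkage_term HPsiH_scale// -scalemxAl -scalemxAr mxtraceZ.
Qed.

Lemma psifun_sum (l : 'rV[R]_r) : (forall i, 0 < l 0 i) -> (0 < r)%N ->
  \sum_(i < r) psifun a b l (l 0 i) = b.
Proof.
move=> l0 r0; rewrite /psifun -mulr_sumr divfK// gt_eqF//.
rewrite (bigD1 (Ordinal r0))//= ltr_wpDr ?powR_gt0// sumr_ge0// => k _.
exact: powR_ge0.
Qed.

(** Both estimators have the form ao H L g(L) H^T, with g = 1 + psi and g = 1. In the loss, g^2
    enters the quadratic term and changes by [weight] of psi; g enters the linear term and changes
    by tr Psi = b. *)
Lemma loss_shrinkage S Hl : (0 < r)%N -> is_evd (r := r) S Hl ->
  loss S (Sigma_alpha_b r a b ao S) =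
  loss S (ao *: S) + (ao ^+ 2 * shrinkage_term S - 2 * ao * b).
Proof.
move=> r0 SHl; have [HH SE l0] := is_evdE SHl.
pose P := psifun a b Hl.2.
have Sab : Sigma_alpha_b r a b ao S = ao *: spectralfun (fun t => t * (1 + P t)) Hl.
  rewrite /Sigma_alpha_b (HLPsiH_evd _ _ SHl (is_evdE SHl)) {1}SE spectralfunD; congr (_ *: _).
  by apply: eq_spectralfun => i; rewrite mulrDr mulr1.
have aS : ao *: S = ao *: spectralfun (fun t => t * 1) Hl.
  by rewrite {1}SE; congr (_ *: _); apply: eq_spectralfun => i; rewrite mulr1.
have T (g : R -> R) : loss S (ao *: spectralfun (fun t => t * g t) Hl) =
    ao ^+ 2 * (\sum_i (Hl.2 0 i * g (Hl.2 0 i) ^+ 2) * (Hl.1^T *m invmx Sigma *m Hl.1) i i) -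
    2 * ao * (\sum_i g (Hl.2 0 i)) + \tr (moore_penrose S *m Sigma).
  have gE : \tr (spectralfun (fun t => t^-1 * (t * g t)) Hl) = \sum_i g (Hl.2 0 i).
    rewrite spectralfun_trace//.
    by apply: eq_bigr => i _; rewrite mulrA mulVf ?mul1r// gt_eqF.
  rewrite lossE (moore_penrose_evd SHl) -!scalemxAr spectralfunM// -!scalemxAl !mxtraceZ gE.
  rewrite mxtrace_mulC mulmxA spectralfunM// mulrA -expr2 mulrA.
  congr (_ * _ - _ + _); rewrite trace_spectralfun; apply: eq_bigr => i _; congr (_ * _).
  move: (Hl.2 0 i) (l0 i) => t t0; rewrite (mulrA _^-1) mulVf ?gt_eqF// mul1r; ring.
rewrite Sab aS !T (shrinkage_term_evd SHl (is_evdE SHl)).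
have -> : \sum_i (1 + P (Hl.2 0 i)) = \sum_(i < r) 1 + b.
  by rewrite big_split/= psifun_sum.
have -> : \sum_i Hl.2 0 i * (1 + P (Hl.2 0 i)) ^+ 2 * (Hl.1^T *m invmx Sigma *m Hl.1) i i =
    \sum_i Hl.2 0 i * 1 ^+ 2 * (Hl.1^T *m invmx Sigma *m Hl.1) i i +
    \sum_i weight (psifun a b Hl.2 (Hl.2 0 i)) *
      (Hl.2 0 i * (Hl.1^T *m invmx Sigma *m Hl.1) i i).
  by rewrite -big_split/=; apply: eq_bigr => i _; rewrite /weight -/(P _); ring.
move: (\sum_i _) (\sum_i _) (\sum_i _) => A B C; ring.
Qed.

(** With N = Sh - Sigma, which is symmetric, the loss is tr (S^+ N Sigma^-1 N). Nonnegativity makes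
    it possible to compare risks without integrability arguments. *)
Lemma loss_ge0 S Sh Hl : is_evd (r := r) S Hl -> Sh^T = Sh -> 0 <= loss S Sh.
Proof.
move=> SHl ShT; have [HH SE l0] := is_evdE SHl.
have pI := posdef_inv pS; have uS := posdef_unit pS; have [symS _] := pS.
have [N NE] : exists N, N = Sh - Sigma by eexists.
have NT : N^T = N by rewrite NE linearB/= symS ShT.
have E : invmx Sigma *m Sh - 1%:M = invmx Sigma *m N by rewrite NE mulmxBr mulVmx.
rewrite /loss E expr2 -[X in _ *m _ *m X]/(invmx Sigma *m N *m (invmx Sigma *m N)).
rewrite !mulmxA mulmxK// (moore_penrose_evd SHl) -2!mulmxA trace_spectralfun.
apply: sumr_ge0 => i _; rewrite mulr_ge0 ?invr_ge0 ?(ltW (l0 i))//.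
have := posdef_quad_ge0 (Hl.1^T *m N) i pI.
by rewrite trmx_mul trmxK NT !mulmxA.
Qed.

Lemma trmx_Sigma_alpha_b S Hl : is_evd (r := r) S Hl ->
  (Sigma_alpha_b r a b ao S)^T = Sigma_alpha_b r a b ao S.
Proof.
move=> SHl; have [_ SE _] := is_evdE SHl.
by rewrite /Sigma_alpha_b (HLPsiH_evd _ _ SHl (is_evdE SHl)) linearZ linearD/= {1}SE !trmx_spectralfun -SE.
Qed.

(** Here S^+ S is the projection H H^T of trace r. The formula serves to show that the loss of ao S
    is measurable on D. *)
Lemma loss_scaled S Hl : is_evd (r := r) S Hl ->
  loss S (ao *: S) =
  ao ^+ 2 * \tr (invmx Sigma *m S) - 2 * ao * r%:R + \tr (moore_penrose S *m Sigma).
Proof.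
move=> SHl; have [HH SE l0] := is_evdE SHl.
have PS : moore_penrose S *m S = Hl.1 *m Hl.1^T.
  rewrite (moore_penrose_evd SHl) {1}SE spectralfunM//.
  rewrite (eq_spectralfun (g := fun=> 1)) => [|i]; last by rewrite mulVf// gt_eqF.
  rewrite /spectralfun (_ : fdiag _ _ = 1%:M) ?mulmx1//.
  by rewrite -diag_const_mx; congr diag_mx; apply/rowP => i; rewrite !mxE.
have SHH : S *m (Hl.1 *m Hl.1^T) = S.
  by rewrite {1}SE /spectralfun !mulmxA -[_ *m Hl.1^T *m Hl.1]mulmxA HH mulmx1 [RHS]SE.
have trr : \tr (Hl.1 *m Hl.1^T) = r%:R by rewrite mxtrace_mulC HH mxtrace1.
have key : \tr (Hl.1 *m Hl.1^T *m invmx Sigma *m S) = \tr (invmx Sigma *m S).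
  by rewrite mxtrace_mulC mulmxA SHH mxtrace_mulC.
rewrite lossE -!scalemxAr -!scalemxAl !mxtraceZ PS key trr.
move: (\tr _) (\tr _) => A B; ring.
Qed.

Lemma shrinkage_term_ge0 S Hl : (0 < b) -> is_evd (r := r) S Hl -> 0 <= shrinkage_term S.
Proof.
move=> b0 SHl; have [_ _ l0] := is_evdE SHl; rewrite (shrinkage_term_evd SHl (is_evdE SHl)).
apply: sumr_ge0 => i _; rewrite mulr_ge0 ?weight_ge0//.
  by rewrite /psifun mulr_ge0 ?powR_ge0// divr_ge0 ?(ltW b0)// sumr_ge0// => k _; exact: powR_ge0.
rewrite mulr_ge0 ?(ltW (l0 i))//.
by have := posdef_quad_ge0 Hl.1^T i (posdef_inv pS); rewrite trmxK.
Qed.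

End risk_integrand.

Section gram_decompositions.
Context (R : realType) (v r : nat).
Implicit Types (X : 'M[R]_(v, r)).

Lemma moore_penrose_unit (A : 'M[R]_r) : A \in unitmx -> moore_penrose A = invmx A.
Proof.
move=> uA; have MP : is_moore_penrose A (invmx A).
  by split; rewrite ?mulmxV ?mulVmx ?mul1mx ?trmx1.
by apply: (is_moore_penrose_unique _ MP); apply: xgetPex; exists (invmx A).
Qed.

(** When m <= p the matrix S = X X^T may be singular, but X^T X is invertible off a null set. This
    makes S^+ a rational function of the data there, hence measurable. *)
Lemma moore_penrose_cogram X : X^T *m X \in unitmx ->
  moore_penrose (X *m X^T) = X *m invmx (X^T *m X) *m invmx (X^T *m X) *m X^T.
Proof.
move=> uA; have [A AE] : exists A, A = X^T *m X by eexists.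
rewrite -AE in uA *; have AT : A^T = A by rewrite AE trmx_mul trmxK.
have [I IE] : exists I, I = invmx A by eexists.
have IT : I^T = I by rewrite IE trmx_inv AT.
have IA : I *m A = 1%:M by rewrite IE mulVmx.
have AI : A *m I = 1%:M by rewrite IE mulmxV.
rewrite -IE; set P := X *m I *m I *m X^T.
have SP : X *m X^T *m P = X *m I *m X^T.
  by rewrite /P !mulmxA -[X *m X^T *m X]mulmxA -AE -[X *m A *m I]mulmxA AI mulmx1.
have PS : P *m (X *m X^T) = X *m I *m X^T.
  by rewrite /P !mulmxA -[_ *m X^T *m X]mulmxA -AE -[_ *m I *m A]mulmxA IA mulmx1.
have XT : (X *m I *m X^T)^T = X *m I *m X^T by rewrite !trmx_mul trmxK IT mulmxA.
have MP : is_moore_penrose (X *m X^T) P.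
  split; rewrite ?SP ?PS ?XT//.
    by rewrite !mulmxA -[_ *m X^T *m X]mulmxA -AE -[_ *m I *m A]mulmxA IA mulmx1.
  by rewrite /P !mulmxA -[_ *m X^T *m X]mulmxA -AE -[_ *m I *m A]mulmxA IA mulmx1.
by apply: (is_moore_penrose_unique _ MP); apply: xgetPex; exists P.
Qed.

Variables (X : 'M[R]_(v, r)) (U : 'M[R]_r) (l : 'I_r -> R).
Hypotheses (UU : U^T *m U = 1%:M) (XE : X^T *m X = specmx U l) (l0 : forall i, 0 < l i).

Lemma gram_spectral : spectral_decomposition (X^T *m X) (U, \row_i l i).
Proof. by split => //= [|i]; rewrite ?mxE// /spectralfun fdiag_id. Qed.

(** The left singular vectors of X: the columns of X U are orthogonal with squared norms l_i. *)
Definition cogram_basis : 'M[R]_(v, r) := X *m U *m diag_mx (\row_i Num.sqrt (l i)^-1).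

Lemma cogram_spectral : spectral_decomposition (X *m X^T) (cogram_basis, \row_i l i).
Proof.
have UU' : U *m U^T = 1%:M := mulmx1C UU.
have dE (f g : 'I_r -> R) :
  diag_mx (\row_i f i) *m diag_mx (\row_i g i) = diag_mx (\row_i (f i * g i)).
  by rewrite mulmx_diag; congr diag_mx; apply/rowP => i; rewrite !mxE.
have d1 (f : 'I_r -> R) : (forall i, f i = 1) -> diag_mx (\row_i f i) = 1%:M.
  move=> f1; rewrite -diag_const_mx; congr diag_mx; apply/rowP => i.
  by rewrite !mxE f1.
have s2 i : Num.sqrt (l i)^-1 * Num.sqrt (l i)^-1 = (l i)^-1.
  by rewrite -expr2 sqr_sqrtr// invr_ge0 ltW.
split => /=; rewrite ?/spectralfun /= ?fdiag_id.
- rewrite /cogram_basis !trmx_mul tr_diag_mx !mulmxA.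
  rewrite -[_ *m X^T *m X]mulmxA XE /specmx !mulmxA.
  rewrite -[_ *m U^T *m U]mulmxA UU mulmx1.
  rewrite -!mulmxA [U^T *m _]mulmxA UU mul1mx !dE d1// => i.
  by rewrite mulrCA s2 divff// gt_eqF.
- rewrite /cogram_basis !trmx_mul tr_diag_mx !mulmxA.
  rewrite -[_ *m diag_mx _ *m diag_mx (\row_i l i)]mulmxA dE.
  rewrite -[_ *m diag_mx _ *m diag_mx _]mulmxA dE d1 ?mulmx1; last first.
    by move=> i; rewrite mulrAC s2 mulVf// gt_eqF.
  by rewrite -[X *m U *m _]mulmxA UU' mulmx1.
- by move=> i; rewrite mxE.
Qed.

Hypothesis ld : forall i j : 'I_r, (i < j)%N -> l j < l i.

Lemma is_evd_sorted p (S : 'M[R]_p) H : spectral_decomposition S (H, \row_i l i) ->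
  is_evd S (H, \row_i l i).
Proof.
move=> [HH SE l0']; split => //; first by rewrite SE /spectralfun fdiag_id.
by move=> i j ij; rewrite !mxE ld.
Qed.

End gram_decompositions.

(** * Homogeneous measures on the line *)

Section weighted_pushforward.
Local Open Scope ereal_scope.
Context d (T : measurableType d) (R : realType) (mu : {measure set T -> \bar R}).
Variables (h : T -> \bar R) (Q : T -> R).

(** The proofs are arguments so that the measure structure can be attached to the term itself. *)
Definition weighted_pushforward of measurable_fun [set: T] h & (forall x, 0 <= h x) &
    measurable_fun [set: T] Q : set (measurableTypeR R) -> \bar R :=
  fun A => \int[mu]_(x in Q @^-1` A) h x.

Hypotheses (mh : measurable_fun [set: T] h) (h0 : forall x, 0 <= h x).
Hypothesis mQ : measurable_fun [set: T] Q.
Local Notation nu := (weighted_pushforward mh h0 mQ).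

Let mpre (A : set (measurableTypeR R)) : measurable A -> measurable (Q @^-1` A).
Proof. by move=> mA; rewrite -[X in measurable X]setTI; exact: mQ. Qed.

Let wp0 : nu set0 = 0.
Proof. by rewrite /weighted_pushforward preimage_set0 integral_set0. Qed.

Let wp_ge0 A : 0 <= nu A.
Proof. exact: integral_ge0. Qed.

Let wp_sigma_additive : semi_sigma_additive nu.
Proof.
move=> F mF tF mUF; rewrite /weighted_pushforward preimage_bigcup.
rewrite ge0_integral_bigcup//.
- by apply: is_cvg_ereal_nneg_natsum_cond => n _ _; exact: integral_ge0.
- by move=> k; exact: mpre.
- exact: measurable_funTS.
- apply/trivIsetP => i j _ _ ij; rewrite -preimage_setI.
  by move/trivIsetP : tF => /(_ _ _ Logic.I Logic.I ij) ->; rewrite preimage_set0.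
Qed.

HB.instance Definition _ := isMeasure.Build _ _ _ nu wp0 wp_ge0 wp_sigma_additive.

Let nuE A : measurable A -> nu A = \int[mu]_x ((\1_A (Q x))%:E * h x).
Proof.
move=> mA; rewrite /weighted_pushforward integral_mkcond; apply: eq_integral => x _.
by rewrite epatch_indic muleC.
Qed.

Import HBNNSimple.

Let integral_nnsfun (g : {nnsfun (measurableTypeR R) >-> R}) :
  \int[nu]_t (g t)%:E = \int[mu]_x ((g (Q x))%:E * h x).
Proof.
rewrite integral_nnsfun// patch_setT sintegralE.
have mg y : measurable (g @^-1` [set y]) by exact: measurable_sfunP.
have mi y : measurable_fun [set: T] (fun x => \1_(g @^-1` [set y]) (Q x) : R).
  by apply: (measurableT_comp (measurable_indic (mg y)) mQ).
have E x : (g (Q x))%:E * h x =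
    \sum_(y \in range g) ((y * \1_(g @^-1` [set y]) (Q x))%:E * h x).
  rewrite fimfunE -fsumEFin// ge0_mule_fsuml// => y.
  by rewrite EFinM (nnfun_muleindic_ge0 g).
rewrite (eq_integral _ _ (fun x _ => E x)) ge0_integral_fsum//; last 2 first.
- move=> y; apply: emeasurable_funM => //; apply/measurable_EFinP.
  exact: measurable_funM.
- by move=> y x _; rewrite mule_ge0// nnfun_muleindic_ge0.
apply: eq_fsbigr => y; rewrite inE => -[t _ gty].
under eq_integral do rewrite EFinM -muleA.
rewrite ge0_integralZl//; last 3 first.
- by apply: emeasurable_funM => //; exact/measurable_EFinP.
- by move=> x _; rewrite mule_ge0// lee_fin.
- by rewrite lee_fin -gty.
by rewrite [X in _ * X = _]nuE.
Qed.

Lemma ge0_integral_weighted_pushforward (f : measurableTypeR R -> \bar R) :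
  measurable_fun [set: measurableTypeR R] f -> (forall t, 0 <= f t) ->
  \int[nu]_t f t = \int[mu]_x (f (Q x) * h x).
Proof.
move=> mf f0.
pose g := nnsfun_approx measurableT mf.
have gf t : (g n t)%:E @[n --> \oo] --> f t.
  by apply: (cvg_nnsfun_approx measurableT mf) => // s _; exact: f0.
have ndg t : nondecreasing_seq (fun n => (g n t)%:E).
  by move=> a b ab; rewrite lee_fin; exact/lefP/nd_nnsfun_approx.
transitivity (limn (fun n => \int[nu]_t (g n t)%:E)).
  rewrite -monotone_convergence//; last 2 first.
  - by move=> n; apply/measurable_EFinP; exact: (measurable_funP (g n)).
  - by move=> n t _; rewrite lee_fin.
  - by apply: eq_integral => t _; apply/esym/cvg_lim => //; exact: gf.
have -> : (fun n => \int[nu]_t (g n t)%:E) = fun n => \int[mu]_x ((g n (Q x))%:E * h x).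
  by apply/funext => n; exact: (integral_nnsfun (g n)).
rewrite -monotone_convergence//; last 3 first.
- move=> n; apply: emeasurable_funM => //; apply/measurable_EFinP.
  exact: (measurableT_comp (measurable_funP (g n)) mQ).
- by move=> n x _; rewrite mule_ge0// lee_fin.
- by move=> x _ a b ab; rewrite lee_wpmul2r//; exact: ndg.
apply: eq_integral => x _; apply/cvg_lim => //.
have gQ : (g n (Q x))%:E @[n --> \oo] --> f (Q x) := gf (Q x).
(* The product of the limits may have the form 0 times +oo, so the zero cases are treated apart:
   increasing nonnegative approximations of 0 are all 0. *)
have [f0x|f0x] := eqVneq (f (Q x)) 0.
  have g0 n : (g n (Q x))%:E = 0.
    apply/eqP; rewrite eq_le; apply/andP; split; last by rewrite lee_fin.
    rewrite -f0x (cvg_unique _ gQ (ereal_nondecreasing_cvgn (ndg (Q x))))//.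
    by apply: ereal_sup_ubound; exists n.
  by rewrite f0x mul0e; under eq_fun do rewrite g0 mul0e; exact: cvg_cst.
have [h0x|h0x] := eqVneq (h x) 0.
  by rewrite h0x mule0; under eq_fun do rewrite mule0; exact: cvg_cst.
apply: cvgeM => //; last exact: cvg_cst.
by rewrite mule_defE (negbTE f0x) (negbTE h0x) !orbF.
Qed.

End weighted_pushforward.

Section homogeneous_measures.
Local Open Scope ereal_scope.
Context (R : realType).

(** The degree K refers to a dilation by t, which multiplies Q by t^2; hence the endpoint t^2. *)
Definition homogeneous_measure (K : nat) (nu : set (measurableTypeR R) -> \bar R) :=
  [/\ nu `]-oo, 0%R[%classic = 0, nu `]-oo, 1%R[%classic < +oo &
    forall t : R, (0 < t)%R ->
      nu `]-oo, (t ^+ 2)%R[%classic = (t ^+ K)%:E * nu `]-oo, 1%R[%classic].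

(** Each measure is multiplied by the mass that the other gives to ]-oo, 1[, which avoids dividing
    by a mass that could be 0. The results agree on all rays, a generating family closed under
    intersection and exhausting the line with finite mass. *)
Lemma homogeneous_measures_proportional K
    (nu kap : {measure set (measurableTypeR R) -> \bar R})
    (f : measurableTypeR R -> \bar R) :
  homogeneous_measure K nu -> homogeneous_measure K kap ->
  measurable_fun [set: measurableTypeR R] f -> (forall t, 0 <= f t) ->
  kap `]-oo, 1%R[%classic * \int[nu]_t f t = nu `]-oo, 1%R[%classic * \int[kap]_t f t.
Proof.
move=> [nu0 nuoo nuS] [kap0 kapoo kapS] mf f0.
have fin (m : {measure set (measurableTypeR R) -> \bar R}) : m `]-oo, 1%R[%classic < +oo ->
    (fine (m `]-oo, 1%R[%classic))%:E = m `]-oo, 1%R[%classic.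
  by move=> ?; rewrite fineK// ge0_fin_numE.
have ge0 (m : {measure set (measurableTypeR R) -> \bar R}) :
    (0 <= fine (m `]-oo, 1%R[%classic))%R by exact: fine_ge0.
pose a := NngNum (ge0 kap); pose b := NngNum (ge0 nu).
have E A : measurable A -> mscale a nu A = mscale b kap A.
  move=> mA; apply: (@measure_unique _ _ (measurableTypeR R) (@RGenInftyO.G R)
    (fun n => [set` `]-oo, n%:R[] : set (measurableTypeR R))) => //.
  - exact: RGenInftyO.measurableE.
  - move=> _ _ [x ->] [y ->]; exists (Num.min x y).
    by apply/seteqP; split => z /=; rewrite !in_itv/= lt_min => /andP.
  - by move=> i; exists i%:R.
  - apply/seteqP; split => // x _; exists (Num.bound `|x|) => //=.
    by rewrite in_itv/= (le_lt_trans (ler_norm x))// archi_boundP.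
  - move=> _ [x ->]; rewrite /= /mscale/= !fin//.
    have [x0|x0] := leP x 0%R.
      have z (m : {measure set (measurableTypeR R) -> \bar R}) :
          m `]-oo, 0%R[%classic = 0 -> m `]-oo, x[%classic = 0.
        move=> m0; apply/eqP; rewrite eq_le measure_ge0 andbT -m0.
        apply: le_measure; rewrite ?inE; [exact: measurable_itv|exact: measurable_itv|].
        by move=> t /=; rewrite !in_itv/= => /lt_le_trans; exact.
      by rewrite !z// !mule0.
    have -> : x = (Num.sqrt x ^+ 2)%R by rewrite sqr_sqrtr// ltW.
    rewrite nuS ?kapS ?sqrtr_gt0//.
    by rewrite muleCA [in RHS]muleCA; congr (_ * _); rewrite muleC.
  - move=> k; rewrite /= /mscale/= lte_mul_pinfty//.
    case: k => [|k]; first by rewrite nu0.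
    have -> : (k.+1%:R = Num.sqrt k.+1%:R ^+ 2 :> R)%R by rewrite sqr_sqrtr.
    by rewrite nuS ?sqrtr_gt0// lte_mul_pinfty// lee_fin exprn_ge0// sqrtr_ge0.
rewrite -(fin nu)// -(fin kap)//.
have sc (c : {nonneg R}) (m : {measure set (measurableTypeR R) -> \bar R}) :
    c%:num%:E * \int[m]_t f t = \int[mscale c m]_t f t.
  by rewrite ge0_integral_mscale.
rewrite [LHS](sc a nu) [RHS](sc b kap).
by apply: eq_measure_integral => A mA _; exact: E.
Qed.

Lemma weighted_pushforward_scale d (T : measurableType d) (mu : {measure set T -> \bar R})
    h Q mh h0 mQ (phi : T -> T) (k c s : R) :
  (0 <= k)%R -> (0 <= c)%R -> (0 < s)%R -> measurable_fun [set: T] phi -> rescales mu phi k ->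
  (forall x, Q (phi x) = s * Q x)%R -> (forall x, h (phi x) = c%:E * h x) ->
  @weighted_pushforward _ _ _ mu h Q mh h0 mQ `]-oo, s[%classic =
  (k * c)%:E * @weighted_pushforward _ _ _ mu h Q mh h0 mQ `]-oo, 1%R[%classic.
Proof.
move=> k0 c0 s0 mphi muphi Qphi hphi.
have E t : @weighted_pushforward _ _ _ mu h Q mh h0 mQ `]-oo, t[%classic =
    \int[mu]_x ((\1_(`]-oo, t[%classic : set (measurableTypeR R)) (Q x))%:E * h x).
  pose A : set (measurableTypeR R) := `]-oo, t[%classic.
  have mA : measurable A by exact: measurable_itv.
  rewrite -[RHS](@ge0_integral_weighted_pushforward _ _ _ mu h Q mh h0 mQ (fun y => (\1_A y)%:E)).
  - by rewrite integral_indic// setIT.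
  - by apply/measurable_EFinP; exact: measurable_indic.
  - by move=> ?; rewrite lee_fin.
have mind t : measurable_fun setT
    (fun x => (\1_(`]-oo, t[%classic : set (measurableTypeR R)) (Q x))%:E * h x).
  apply: emeasurable_funM => //; apply/measurable_EFinP.
  pose A : set (measurableTypeR R) := `]-oo, t[%classic.
  have mA : measurable A by exact: measurable_itv.
  exact: (measurableT_comp (measurable_indic mA) mQ).
rewrite !E -(ge0_integral_rescales k0 mphi muphi)//; last first.
  by move=> x; rewrite mule_ge0// lee_fin.
rewrite EFinM -muleA; congr (_ * _).
rewrite -ge0_integralZl//; last by move=> x _; rewrite mule_ge0// lee_fin.
apply: eq_integral => x _; rewrite Qphi hphi muleCA; congr (_ * (_%:E * _)).
rewrite !indicE; congr (_%:R); congr nat_of_bool.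
have sE t : (s * t < s)%R = (t < 1)%R by rewrite -[X in (_ < X)%R]mulr1 ltr_pM2l.
by apply/idP/idP; rewrite !inE/= !in_itv/= sE.
Qed.

End homogeneous_measures.

Section test_profile.
Local Open Scope ereal_scope.
Context (R : realType).

Lemma Fstar_profile_density (t : R) : Fstar (@profile_density R) t = (profile t)%:E.
Proof.
rewrite /Fstar (@ge0_continuous_FTC2y R (@profile_density R) (fun s => - 2 * profile s)%R t 0%R).
- rewrite -EFinB -EFinM; congr EFin; move: (profile t) => z; lra.
- by move=> x _; exact: profile_density_ge0.
- apply: continuous_subspaceT => x; rewrite /profile_density.
  apply: cvgM; first exact: cvg_cst.
  apply: (@continuous_max R R (fun t => 1 - t)%R (fun=> 0%R)); last exact: cvg_cst.
  by apply: cvgB; [exact: cvg_cst|exact: cvg_id].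
- apply/cvgrPdist_lt => e e0; near=> x.
  by rewrite /profile ifT ?mulr0 ?subrr ?normr0.
- move=> x _; apply: derivableM; first exact: derivable_cst.
  by case: (is_derive_profile x).
- apply: cvg_at_right_filter; apply: cvgM; first exact: cvg_cst.
  by apply/differentiable_continuous/derivable1_diffP; case: (is_derive_profile t).
- move=> x _; rewrite derive1E.
  have -> : (fun s => - 2 * profile s)%R = (- 2 : R) *: (@profile R) by [].
  have := @is_deriveZ _ _ _ (@profile R) (- 2)%R x 1%R _ (is_derive_profile x).
  by case=> _ ->; rewrite /GRing.scale/=; move: (profile_density x) => z; lra.
Unshelve. all: by end_near. Qed.

(** On ]-oo, 1/2[ the test density is at least 1, and homogeneity with t^2 = 1/2 relates that ray to
    ]-oo, 1[. This yields the finiteness of the masses. *)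
Lemma profile_density_finite (K : nat) (nu : {measure set (measurableTypeR R) -> \bar R}) :
  (forall t : R, (0 < t)%R ->
      nu `]-oo, (t ^+ 2)%R[%classic = (t ^+ K)%:E * nu `]-oo, 1%R[%classic) ->
  nu `]-oo, 1%R[%classic <=
    ((Num.sqrt 2^-1 ^+ K)^-1)%:E * \int[nu]_t (profile_density t)%:E.
Proof.
move=> nuS; have s0 : (0 < Num.sqrt 2^-1 :> R)%R by rewrite sqrtr_gt0.
have := nuS _ s0; rewrite sqr_sqrtr// => nu2.
rewrite muleC lee_pdivlMr ?exprn_gt0// muleC -nu2.
pose A : set (measurableTypeR R) := `]-oo, 2^-1%R[%classic.
have mA : measurable A by exact: measurable_itv.
have -> : nu A = \int[nu]_t (\1_A t)%:E by rewrite integral_indic// setIT.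
apply: ge0_le_integral => //.
- by apply/measurable_EFinP; exact: measurable_indic.
- by apply/measurable_EFinP; exact: measurable_profile_density.
move=> t _; rewrite lee_fin indicE; case: (boolP (t \in A)) => [|_].
  rewrite inE /A/= in_itv/= => t2; rewrite /profile_density.
  have : (1 - t <= Num.max (1 - t) 0)%R by rewrite le_max lexx.
  move: (Num.max _ _) => z; lra.
exact: profile_density_ge0.
Qed.

End test_profile.

Lemma measurable_ler_set d (T : measurableType d) (R : realType) (f g : T -> R) :
  measurable_fun setT f -> measurable_fun setT g -> measurable [set x | f x <= g x].
Proof.
move=> mf mg; have H := measurable_fun_ler mf mg.
rewrite (_ : [set _ | _] = setT `&` (fun x => f x <= g x) @^-1` [set true]).
  exact: H.
by rewrite setTI; apply/seteqP; split.
Qed.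

(** * From the test profile to an arbitrary density *)

Section radial_comparison.
Local Open Scope ereal_scope.
Context (R : realType) (q m p : nat).
Local Notation V := ('M[R]_(q, p) * 'M[R]_(m, p))%type.
Local Notation mu := (@lebesgue_zu R q m p).
Variables (Q h : V -> R) (o : R -> V) (B C : R).
Hypotheses (mQ : measurable_fun [set: V] Q) (Q0 : forall x, (0 <= Q x)%R).
Hypotheses (mh : measurable_fun [set: V] h) (h0 : forall x, (0 <= h x)%R).
Hypothesis QS : forall t x, (0 < t)%R -> Q (affine_zu t (o t) x) = (t ^+ 2 * Q x)%R.
Hypothesis hS : forall t x, (0 < t)%R -> h (affine_zu t (o t) x) = (t ^+ 2 * h x)%R.
Hypothesis QB : forall x, (Q x < 1)%R -> zu_box B x.

Let vol (t : measurableTypeR R) : \bar R := mu [set x | (Q x <= t)%R].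

Let mregion : measurable [set z : V * measurableTypeR R | (Q z.1 <= z.2)%R].
Proof.
apply: measurable_ler_set; last exact: measurable_snd.
exact: measurableT_comp mQ measurable_fst.
Qed.

Let vol_ge0 t : 0 <= vol t.
Proof. exact: measure_ge0. Qed.

Let measurable_vol : measurable_fun [set: measurableTypeR R] vol.
Proof.
have := measurable_fun_ysection mu mregion; congr (measurable_fun _ _).
by apply/funext => t; rewrite /vol; congr (mu _); apply/seteqP; split => x /=;
  rewrite /ysection /= inE.
Qed.

Let tail (f : measurableTypeR R -> R) (z : V * measurableTypeR R) : \bar R :=
  (f z.2)%:E * (\1_[set z : V * measurableTypeR R | (Q z.1 <= z.2)%R] z)%:E.

Let measurable_tail f : measurable_fun [set: measurableTypeR R] f ->
  measurable_fun [set: V * measurableTypeR R] (tail f).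
Proof.
move=> mf; apply: emeasurable_funM; apply/measurable_EFinP.
  exact: (measurableT_comp mf measurable_snd).
exact: measurable_indic.
Qed.

Let tail_ge0 f : (forall t, (0 <= f t)%R) -> forall z, 0 <= tail f z.
Proof. by move=> f0 z; rewrite /tail mule_ge0// lee_fin. Qed.

Let FstarE (f : measurableTypeR R -> R) x :
  Fstar f (Q x) = (2^-1)%:E * \int[lebesgue_measure]_t tail f (x, t).
Proof.
rewrite /Fstar; congr (_ * _); rewrite integral_mkcond; apply: eq_integral => t _.
rewrite epatch_indic /tail !indicE/=; congr (_ * (_%:R)%:E); congr nat_of_bool.
by apply/idP/idP; rewrite !inE/= in_itv/= andbT.
Qed.

Lemma measurable_Fstar (f : measurableTypeR R -> R) :
  measurable_fun [set: measurableTypeR R] f -> (forall t, (0 <= f t)%R) ->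
  measurable_fun [set: V] (fun x => Fstar f (Q x)).
Proof.
move=> mf f0; rewrite (funext (FstarE f)); apply: measurable_funeM.
exact: (measurable_fun_fubini_tonelli_F (tail f) (measurable_tail mf) (tail_ge0 f0)).
Qed.

(** Tonelli's theorem for f(t) on the region Q x <= t. The factor 2 undoes the 1/2 in the definition
    of F*. *)
Lemma integral_Fstar (f : measurableTypeR R -> R) :
  measurable_fun [set: measurableTypeR R] f -> (forall t, (0 <= f t)%R) ->
  \int[lebesgue_measure]_t ((f t)%:E * vol t) = 2%:E * \int[mu]_x Fstar f (Q x).
Proof.
move=> mf f0; have mF := measurable_tail mf; have F0 := tail_ge0 f0.
transitivity (\int[lebesgue_measure]_t \int[mu]_x tail f (x, t)).
  apply: eq_integral => t _; rewrite /tail /=.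
  rewrite ge0_integralZl ?lee_fin//; last first.
    apply/measurable_EFinP.
    exact: (measurableT_comp (measurable_indic mregion) (pair2_measurable t)).
  congr (_ * _); rewrite /vol -[X in mu X]setIT -integral_indic//.
  exact: measurable_ler_set.
rewrite -(fubini_tonelli (m1 := mu) (m2 := lebesgue_measure))//.
rewrite -ge0_integralZl//; last 2 first.
- exact: measurable_Fstar.
- by move=> x _; rewrite FstarE mule_ge0 ?lee_fin// integral_ge0.
apply: eq_integral => x _.
by rewrite FstarE muleA -EFinM mulfV ?mul1e.
Qed.

Let mEh : measurable_fun [set: V] (EFin \o h).
Proof. exact/measurable_EFinP. Qed.

Let Eh0 x : 0 <= (EFin \o h) x.
Proof. by rewrite lee_fin. Qed.

Let mid : measurable_fun [set: measurableTypeR R] (fun t : measurableTypeR R => t : R).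
Proof. exact: measurable_id. Qed.

(** Both measures are homogeneous of degree N + 2. The volume accounts for N in each; the remaining
    2 comes from h in [nu] and from dt in [kap]. *)
Let nu := weighted_pushforward mu mEh Eh0 mQ.
Let kap := weighted_pushforward (@lebesgue_measure R) measurable_vol vol_ge0 mid.
Let N := ((q + m) * p)%N.

Let nuS (t : R) : (0 < t)%R ->
  nu `]-oo, (t ^+ 2)%R[%classic = (t ^+ (N + 2))%:E * nu `]-oo, 1%R[%classic.
Proof.
move=> t0; rewrite exprD.
apply: (@weighted_pushforward_scale _ _ _ mu _ _ _ _ _ (affine_zu t (o t))).
- exact/exprn_ge0/ltW.
- exact: sqr_ge0.
- exact: exprn_gt0.
- exact: measurable_affine_zu.
- exact: rescales_lebesgue_zu.
- by move=> x; rewrite QS.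
- by move=> x; rewrite /= hS// EFinM.
Qed.

Let mscaled (c : R) : measurable_fun [set: measurableTypeR R]
  (fun t : measurableTypeR R => (c * t : measurableTypeR R)%R).
Proof. by apply: measurable_funM; [exact: measurable_cst|exact: measurable_id]. Qed.

Let kapS (t : R) : (0 < t)%R ->
  kap `]-oo, (t ^+ 2)%R[%classic = (t ^+ (N + 2))%:E * kap `]-oo, 1%R[%classic.
Proof.
move=> t0; rewrite addnC exprD.
apply: (@weighted_pushforward_scale _ _ _ (@lebesgue_measure R) _ _ _ _ _ (fun s => t ^+ 2 * s)%R).
- exact: sqr_ge0.
- exact/exprn_ge0/ltW.
- exact: exprn_gt0.
- exact: mscaled.
- have := @rescales_affine R (t ^+ 2) 0 (exprn_gt0 2 t0).
  by congr (rescales _ _ _); apply/funext => s; rewrite addr0.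
- by [].
- move=> s; rewrite /vol -(rescales_lebesgue_zu t0 (o t)).
    congr (_ * mu _); apply/seteqP; split => x /=; rewrite QS// ler_pM2l// exprn_gt0//.
  exact: measurable_ler_set.
Qed.

Let nu_integral (f : measurableTypeR R -> R) : measurable_fun [set: measurableTypeR R] f ->
  (forall t, (0 <= f t)%R) -> \int[nu]_t (f t)%:E = \int[mu]_x (f (Q x) * h x)%:E.
Proof.
move=> mf f0.
rewrite [LHS](@ge0_integral_weighted_pushforward _ _ _ mu _ _ mEh Eh0 mQ (fun t => (f t)%:E)).
- by apply: eq_integral => x _; rewrite EFinM.
- exact/measurable_EFinP.
- by move=> t; rewrite lee_fin.
Qed.

Let kap_integral (f : measurableTypeR R -> R) : measurable_fun [set: measurableTypeR R] f ->
  (forall t, (0 <= f t)%R) -> \int[kap]_t (f t)%:E = 2%:E * \int[mu]_x Fstar f (Q x).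
Proof.
move=> mf f0; rewrite -integral_Fstar//.
apply: (@ge0_integral_weighted_pushforward _ _ _ (@lebesgue_measure R) _ _ measurable_vol
  vol_ge0 mid (fun t => (f t)%:E)).
- exact/measurable_EFinP.
- by move=> t; rewrite lee_fin.
Qed.

Let nu_neg : nu `]-oo, 0%R[%classic = 0.
Proof.
rewrite /nu /weighted_pushforward (_ : Q @^-1` _ = set0) ?integral_set0//.
by rewrite -subset0 => x /=; rewrite in_itv/= ltNge Q0.
Qed.

Let kap_neg : kap `]-oo, 0%R[%classic = 0.
Proof.
rewrite /kap /weighted_pushforward; apply: integral0_eq => t /=.
rewrite in_itv/= => t0; rewrite /vol (_ : [set _ | _] = set0) ?measure0//.
by rewrite -subset0 => x /= /le_lt_trans/(_ t0); rewrite ltNge Q0.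
Qed.

Let mprofileQ : measurable_fun [set: V] (fun x => (profile (Q x))%:E).
Proof.
by apply/measurable_EFinP; apply: measurableT_comp mQ; exact: measurable_profile.
Qed.

Let integral_profile_lty : \int[mu]_x (profile (Q x))%:E < +oo.
Proof.
apply: (@le_lt_trans _ _ (\int[mu]_x (\1_(zu_box (q := q) (m := m) (p := p) B) x)%:E)); last first.
  by rewrite integral_indic ?setIT ?lebesgue_zu_box_lty//; exact: measurable_zu_box.
apply: ge0_le_integral => //.
- by move=> x _; rewrite lee_fin profile_ge0.
- by apply/measurable_EFinP; apply: measurable_indic; exact: measurable_zu_box.
move=> x _; rewrite lee_fin indicE /profile; have [//|Q1] := leP 1%R (Q x).
rewrite mem_set/=; last exact: QB.
have Q0x := Q0 x.
have : ((1 - Q x) ^+ 2 <= 1)%R by rewrite exprn_ile1//; lra.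
move: (_ ^+ 2)%R => z; lra.
Qed.

(** Excludes a vanishing mass on ]-oo, 1[: by homogeneity [kap] would be zero, and so would the
    integral of F*(Q). *)
Let kap1_zero (f : measurableTypeR R -> R) : measurable_fun [set: measurableTypeR R] f ->
  kap `]-oo, 1%R[%classic = 0 ->
  \int[kap]_t (f t)%:E = 0.
Proof.
move=> mf kap1.
have kapT : kap setT = 0.
  have -> : [set: measurableTypeR R] =
      \bigcup_k [set` `]-oo, (Num.sqrt k.+1%:R ^+ 2 : R)%R[] :> set (measurableTypeR R).
    apply/esym/seteqP; split => // x _; exists (Num.bound `|x|%R) => //=.
    rewrite in_itv/= sqr_sqrtr// (le_lt_trans (ler_norm x))// (lt_trans (archi_boundP _))//.
    by rewrite ltr_nat.
  apply/eqP; rewrite eq_le measure_ge0 andbT.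
  apply: (le_trans (measure_sigma_subadditive kap _ _ (@subset_refl _ _))) => //.
  - by apply: bigcupT_measurable.
  - by rewrite eseries0// => k _ _; apply: (etrans (kapS _)); rewrite ?kap1 ?mule0// sqrtr_gt0.
by apply: null_set_integral => //; exact/measurable_EFinP.
Qed.

Hypothesis profile_comparison : \int[mu]_x (profile_density (Q x) * h x)%:E <=
  C%:E * \int[mu]_x (profile (Q x))%:E.

(* The distributions of [Q] under the weight [h] and of the level sets of [Q] are
   homogeneous of the same degree, hence proportional: one test profile determines
   the constant for all of them. *)
Lemma radial_comparison (f : measurableTypeR R -> R) :
  measurable_fun [set: measurableTypeR R] f -> (forall t, (0 <= f t)%R) ->
  0 < \int[mu]_x Fstar f (Q x) ->
  \int[mu]_x (f (Q x) * h x)%:E <= C%:E * \int[mu]_x Fstar f (Q x).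
Proof.
move=> mf f0 F_gt0.
have mpd : measurable_fun [set: measurableTypeR R] (@profile_density R).
  exact: measurable_profile_density.
have pd0 t := @profile_density_ge0 R t.
have kpd : \int[kap]_t (profile_density t)%:E = 2%:E * \int[mu]_x (profile (Q x))%:E.
  rewrite kap_integral//; congr (_ * _); apply: eq_integral => x _.
  exact: Fstar_profile_density.
have npd := nu_integral mpd pd0.
have pi0 : 0 <= \int[mu]_x (profile (Q x))%:E.
  by apply: integral_ge0 => x _; rewrite lee_fin profile_ge0.
have [P PE] : exists P, \int[mu]_x (profile (Q x))%:E = P%:E.
  by exists (fine (\int[mu]_x (profile (Q x))%:E)); rewrite fineK// ge0_fin_numE.
have P0 : (0 <= P)%R by rewrite -lee_fin -PE.
have nu1 := profile_density_finite nuS; have kap1 : kap `]-oo, 1%R[%classic <= ((Num.sqrt 2^-1 ^+ (N + 2))^-1)%:E *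
    \int[kap]_t (profile_density t)%:E := profile_density_finite kapS.
have nuoo : nu `]-oo, 1%R[%classic < +oo.
  apply: le_lt_trans nu1 _; apply: lte_mul_pinfty => //.
  by rewrite npd (le_lt_trans profile_comparison)// PE -EFinM ltry.
have kapoo : kap `]-oo, 1%R[%classic < +oo.
  by apply: le_lt_trans kap1 _; rewrite kpd PE -!EFinM ltry.
have Hnu : homogeneous_measure (N + 2) nu by split.
have Hkap : homogeneous_measure (N + 2) kap by split.
have prop (g : measurableTypeR R -> R) : measurable_fun [set: measurableTypeR R] g -> (forall t, (0 <= g t)%R) ->
    kap `]-oo, 1%R[%classic * \int[mu]_x (g (Q x) * h x)%:E =
    nu `]-oo, 1%R[%classic * (2%:E * \int[mu]_x Fstar g (Q x)).
  move=> mg g0; rewrite -nu_integral// -kap_integral//.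
  apply: (homogeneous_measures_proportional Hnu Hkap); first exact/measurable_EFinP.
  by move=> t; rewrite lee_fin.
have [k kE] : exists k, kap `]-oo, 1%R[%classic = k%:E.
  by exists (fine (kap `]-oo, 1%R[%classic)); rewrite fineK// ge0_fin_numE.
have [n nE] : exists n, nu `]-oo, 1%R[%classic = n%:E.
  by exists (fine (nu `]-oo, 1%R[%classic)); rewrite fineK// ge0_fin_numE.
have k0 : (0 < k)%R.
  rewrite lt0r -lee_fin -kE measure_ge0 andbT; apply/eqP => k0.
  have := kap1_zero mf; rewrite kE k0 => /(_ erefl); rewrite kap_integral// => /eqP.
  by rewrite mule_eq0 (gt_eqF F_gt0) orbF eqe pnatr_eq0.
have P_gt0 : (0 < P)%R.
  rewrite lt0r P0 andbT; apply/eqP => P00.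
  by move: kap1; rewrite kpd PE kE P00 mule0 mule0 lee_fin leNgt k0.
(* The test profile turns its inequality into one between the masses on ]-oo, 1[, which no longer
   mentions a profile and so applies to any f. *)
have kn : (2 * n <= k * C)%R.
  have := prop _ mpd pd0; rewrite -kap_integral// kpd PE kE nE => E.
  have : k%:E * \int[mu]_x (profile_density (Q x) * h x)%:E <= k%:E * (C%:E * P%:E).
    by rewrite lee_pmul2l// -PE.
  rewrite E -!EFinM lee_fin => H; rewrite -(ler_pM2r P_gt0).
  by rewrite (_ : 2 * n * P = n * (2 * P))%R 1?(_ : k * C * P = k * (C * P))%R//; ring.
have := prop _ mf f0; rewrite kE nE => E.
rewrite -(@lee_pmul2l _ k%:E)// E !muleA -!EFinM.
by apply: lee_wpmul2r; [exact: ltW|rewrite lee_fin mulrC].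
Qed.

End radial_comparison.

(** * Risk comparison *)

Section null_complement.
Local Open Scope ereal_scope.
Context d (T : measurableType d) (R : realType) (mu : {measure set T -> \bar R}).
Variable D : set T.
Hypotheses (mD : measurable D) (D0 : mu (~` D) = 0).

Import HBNNSimple.

(** Here f need not be measurable: the integral is a supremum over simple functions below f, and
    cutting such a function off outside D keeps its integral. The risk integrand is of this kind,
    its values off D depending on what [evd] picks. *)
Let ge0_integral_null_complement (f : T -> \bar R) : (forall x, 0 <= f x) ->
  \int[mu]_x f x = \int[mu]_(x in D) f x.
Proof.
move=> f0; rewrite [RHS]integral_mkcond.
have fD0 x : 0 <= (f \_ D) x by exact: erestrict_ge0.
rewrite !ge0_integralTE//; apply/eqP; rewrite eq_le; apply/andP; split.
  apply: ub_ereal_sup => _ [g gf <-].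
  have mg : measurable_fun setT (EFin \o g) by exact/measurable_EFinP.
  have sE (k : {nnsfun T >-> R}) : sintegral mu k = \int[mu]_x (k x)%:E.
    by rewrite integral_nnsfun// patch_setT.
  have -> : sintegral mu g = sintegral mu (mul_nnsfun g (indic_nnsfun R mD)).
    rewrite !sE (ge0_negligible_integral (N := ~` D))//; last 2 first.
    - exact: measurableC.
    - by move=> x _; rewrite lee_fin.
    rewrite setTD setCK integral_mkcond; apply: eq_integral => x _.
    by rewrite epatch_indic.
  apply: ereal_sup_ubound; exists (mul_nnsfun g (indic_nnsfun R mD)) => //.
  move=> x; rewrite -[leLHS]/((g x * \1_D x)%:E) indicE /patch.
  by case: ifPn => xD; rewrite ?mulr1 ?mulr0.
apply: ub_ereal_sup => _ [g gf <-].
apply: ereal_sup_ubound; exists g => // x.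
apply: le_trans (gf x) _; rewrite /patch; case: ifPn => // _; exact: f0.
Qed.

Lemma integral_null_complement (f : T -> \bar R) : 
  \int[mu]_x f x = \int[mu]_(x in D) f x.
Proof.
rewrite [LHS]integralE [RHS]integralE.
by rewrite !ge0_integral_null_complement.
Qed.

End null_complement.
Section matrix_inverse_measurability.
Context d (T : measurableType d) (R : realType).

Lemma measurable_inv (c : T -> R) : measurable_fun [set: T] c ->
  measurable_fun [set: T] (fun x => (c x)^-1).
Proof.
move=> mc.
(* The power with exponent - 1 is the inverse only on nonnegative numbers, hence the square. *)
rewrite (_ : (fun x => _) = fun x => c x * (c x ^+ 2) `^ (- 1)).
  apply: measurable_funM => //.
  have mp : measurable_fun [set: R] (fun t : R => t `^ (-1)) by exact: measurable_powR.
  have mX : measurable_fun [set: T] (fun x => c x ^+ 2) by exact: measurable_funX.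
  exact: measurableT_comp mp mX.
apply/funext => x; rewrite powR_inv1 ?sqr_ge0//.
have [->|c0] := eqVneq (c x) 0; first by rewrite invr0 mul0r.
by rewrite expr2 invfM mulrA mulfV// mul1r.
Qed.

Lemma mmeas_adj k (F : T -> 'M[R]_k) : mmeas F ->
  mmeas (fun x => (\det (F x))^-1 *: \adj (F x)).
Proof.
move=> mF; apply: mmeasZ; first exact/measurable_inv/measurable_det.
move=> i j; under [X in measurable_fun _ X]eq_fun do rewrite mxE.
rewrite /cofactor; apply: measurable_funM => //; apply: measurable_det => i' j'.
by under [X in measurable_fun _ X]eq_fun do rewrite !mxE; exact: mF.
Qed.

End matrix_inverse_measurability.

Section elliptical_geometry.
Context (R : realType) (q m p : nat) (theta : 'M[R]_(q, p)) (Sigma : 'M[R]_p).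
Hypothesis pS : posdef Sigma.
Local Notation V := ('M[R]_(q, p) * 'M[R]_(m, p))%type.
Local Notation Q := (@quad R q m p theta Sigma).

(** The translation part of the dilation by t about (theta, 0), not its fixed point. *)
Definition dilation_centre (t : R) : V := ((1 - t) *: theta, 0).

Lemma Smx_dilation t x : Smx (affine_zu t (dilation_centre t) x) = t ^+ 2 *: Smx x.
Proof.
rewrite /Smx /affine_zu/= addr0 (_ : (t *: x.2)^T = t *: x.2^T); last by rewrite linearZ.
by rewrite -scalemxAl -scalemxAr scalerA expr2.
Qed.

Lemma quad_dilation t x : Q (affine_zu t (dilation_centre t) x) = t ^+ 2 * Q x.
Proof.
rewrite /quad /affine_zu/= addr0.
have -> : t *: x.1 + (1 - t) *: theta - theta = t *: (x.1 - theta).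
  by rewrite scalerBl scale1r scalerBr addrA addrAC addrK.
have E k (A : 'M[R]_(k, p)) : \tr (t *: A *m invmx Sigma *m (t *: A)^T) =
    t ^+ 2 * \tr (A *m invmx Sigma *m A^T).
  rewrite (_ : (t *: A)^T = t *: A^T); last by rewrite linearZ.
  rewrite -!scalemxAl -scalemxAr !mxtraceZ.
  by rewrite mulrA expr2.
by rewrite !E mulrDr.
Qed.

Lemma quad_ge0 x : 0 <= Q x.
Proof. by rewrite addr_ge0//; apply/posdef_trace_ge0/posdef_inv. Qed.

Lemma mmeas_zu1 : mmeas (fun x : V => x.1).
Proof. by move=> i j; exact: measurable_zu1. Qed.

Lemma mmeas_zu2 : mmeas (fun x : V => x.2).
Proof. by move=> i j; exact: measurable_zu2. Qed.

Lemma measurable_quad : measurable_fun [set: V] Q.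
Proof.
have mq k (F : V -> 'M[R]_(k, p)) : mmeas F ->
    measurable_fun [set: V] (fun x => \tr (F x *m invmx Sigma *m (F x)^T)).
  move=> mF; apply: mmeas_trace; apply: mmeasM; last exact: mmeas_tr.
  by apply: mmeasM => //; exact: mmeas_cst.
apply: measurable_funD; apply: mq; last exact: mmeas_zu2.
by apply: mmeasD; [exact: mmeas_zu1|exact: mmeas_cst].
Qed.

Lemma quad_lt1_entry k (A : 'M[R]_(k, p)) i j : \tr (A *m invmx Sigma *m A^T) < 1 ->
  `|A i j| <= 1 + \tr Sigma.
Proof.
move=> A1; have Sj := posdef_diag_gt0 j pS.
have Str : Sigma j j <= \tr Sigma.
  rewrite /mxtrace (bigD1 j)//= lerDl sumr_ge0// => l _.
  exact: ltW (posdef_diag_gt0 l pS).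
have E := posdef_entries_le A i j pS.
have A2 : `|A i j| ^+ 2 <= \tr Sigma.
  rewrite real_normK ?num_real// (le_trans E)// (le_trans _ Str)// -[leRHS]mulr1.
  by rewrite ler_pM2l// ltW.
have t0 : 0 <= \tr Sigma by rewrite (le_trans _ Str)// ltW.
rewrite -(ler_pXn2r (n := 2))// ?nnegrE// ?addr_ge0//.
apply: (le_trans A2); move: (\tr Sigma) t0 => z z0; nra.
Qed.

Lemma quad_lt1_box : exists B, forall x, Q x < 1 -> zu_box B x.
Proof.
exists (1 + \tr Sigma + \sum_i \sum_j `|theta i j|) => x Q1.
have g1 := posdef_trace_ge0 (x.1 - theta) (posdef_inv pS).
have g2 := posdef_trace_ge0 x.2 (posdef_inv pS).
have n0 : 0 <= \sum_i \sum_j `|theta i j| by apply: sumr_ge0 => i _; apply: sumr_ge0.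
split => i j.
  have le : `|theta i j| <= \sum_i0 \sum_j0 `|theta i0 j0|.
    rewrite (bigD1 i)//= (bigD1 j)//= -addrA lerDl addr_ge0//; apply: sumr_ge0 => // k _.
    exact: sumr_ge0.
  have := @quad_lt1_entry _ (x.1 - theta) i j (le_lt_trans _ Q1).
  rewrite lerDl => /(_ g2); rewrite !mxE => H.
  rewrite (_ : x.1 i j = (x.1 i j - theta i j) + theta i j); last by rewrite subrK.
  by rewrite (le_trans (ler_normD _ _))// lerD.
have := @quad_lt1_entry _ x.2 i j (le_lt_trans _ Q1).
by rewrite lerDr => /(_ g1) H; rewrite (le_trans H)// lerDl.
Qed.

Lemma quad_lt1_gram x : Q x < 1 -> \tr (x.2^T *m x.2) <= \tr Sigma + 1.
Proof.
move=> Q1; have g1 := posdef_trace_ge0 (x.1 - theta) (posdef_inv pS).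
have t0 : 0 <= \tr Sigma.
  by apply: sumr_ge0 => j _; exact: ltW (posdef_diag_gt0 j pS).
have le1 : \tr (x.2 *m invmx Sigma *m x.2^T) <= 1.
  by rewrite (le_trans _ (ltW Q1))// lerDr.
apply: le_trans (posdef_gram_le x.2 pS) _; move: le1 t0.
move: (\tr (_ *m _ *m _)) (\tr Sigma) => y z; nra.
Qed.

End elliptical_geometry.

(** Integrating J1 + t = J0 + g keeps all integrands nonnegative. Only the finite number t is
    cancelled, so both integrals of losses may be infinite. *)
Lemma weighted_integral_le d (T : measurableType d) (R : realType)
    (mu : {measure set T -> \bar R}) (D : set T) (J0 J1 g : T -> R) (e : T -> \bar R) (t : R) :
  measurable D -> measurable_fun D J0 -> measurable_fun D J1 -> measurable_fun D g ->
  measurable_fun D e -> (forall x, D x -> 0 <= J0 x) -> (forall x, D x -> 0 <= J1 x) ->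
  (forall x, D x -> 0 <= g x) -> (forall x, 0 <= e x)%E -> 0 <= t ->
  (forall x, D x -> J1 x + t = J0 x + g x) ->
  (\int[mu]_(x in D) e x = 1)%E -> (\int[mu]_(x in D) ((g x)%:E * e x) <= t%:E)%E ->
  (\int[mu]_(x in D) ((J1 x)%:E * e x) <= \int[mu]_(x in D) ((J0 x)%:E * e x))%E.
Proof.
move=> mD mJ0 mJ1 mg me J00 J10 g0 e0 t0 JE e1 gt.
have mM (k : T -> R) : measurable_fun D k -> measurable_fun D (fun x => (k x)%:E * e x)%E.
  by move=> mk; apply: emeasurable_funM => //; exact/measurable_EFinP.
have M0 (k : T -> R) : (forall x, D x -> 0 <= k x) -> forall x, D x -> (0 <= (k x)%:E * e x)%E.
  by move=> k0 x Dx; rewrite mule_ge0// lee_fin k0.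
have te : (\int[mu]_(x in D) (t%:E * e x) = t%:E)%E.
  by rewrite ge0_integralZl// e1 mule1.
rewrite -(@leeD2rE _ t%:E)// -{1}te -ge0_integralD//; last 4 first.
- exact: M0.
- exact: mM.
- by move=> x Dx; rewrite mule_ge0.
- exact: (mM (fun=> t)).
rewrite (eq_integral (fun x => (J0 x)%:E * e x + (g x)%:E * e x)%E); last first.
  move=> x; rewrite inE => Dx.
  by rewrite -!ge0_muleDl ?lee_fin ?J00 ?J10 ?g0// -!EFinD JE.
rewrite ge0_integralD//; [exact: leeD2l|exact: M0|exact: mM|exact: M0|exact: mM].
Qed.

Section improvement.
Local Open Scope ereal_scope.
Context (R : realType) (n q m p r v : nat) (theta : 'M[R]_(q, p)) (Sigma : 'M[R]_p).
Variables (f : R -> R) (Kstar a b : R).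
Local Notation V := ('M[R]_(q, p) * 'M[R]_(m, p))%type.
Local Notation mu := (@lebesgue_zu R q m p).
Local Notation Q := (@quad R q m p theta Sigma).
Local Notation S := (@Smx R q m p).
Local Notation ao := ((Kstar * v%:R)^-1)%R.
Local Notation C := ((v%:R - r%:R + 1) * (2 * b + b ^+ 2))%R.
Local Notation h := (fun x => shrinkage_term r Sigma a b (S x)).

Hypotheses (pS : posdef Sigma) (r0 : (0 < r)%N) (rv : (r <= v)%N) (b0 : (0 < b)%R).
Hypothesis bE : (b <= 2 * (r%:R - 1) / (v%:R - r%:R + 1))%R.
Hypotheses (mf : measurable_fun [set t : R | (0 <= t)%R] f)
  (f0 : forall t, (0 <= t)%R -> (0 <= f t)%R).
Hypothesis density_f : is_density (@elliptic R n q m p (EFin \o f) theta Sigma).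
Hypothesis density_Fstar :
  is_density (fun x => (Kstar^-1)%:E * @elliptic R n q m p (Fstar f) theta Sigma x).

Variable D : set V.
Hypotheses (mD : measurable D) (D0 : mu (~` D) = 0).
Hypothesis evdD : forall x, D x -> exists Hl, is_evd (r := r) (S x) Hl.
Hypothesis mMP : measurable_fun D (fun x => \tr (moore_penrose (S x) *m Sigma)).
Hypothesis mh : measurable_fun D h.
Hypothesis coneD : forall t x, (0 < t)%R ->
  D (affine_zu t (dilation_centre m theta t) x) <-> D x.
Hypothesis profile_comparison : \int[mu]_(x in D) (profile_density (Q x) * h x)%:E <=
  C%:E * \int[mu]_x (profile (Q x))%:E.

(** f is controlled only on [0, +oo[. Extending it by 0 changes nothing along Q, which is
    nonnegative, and makes it measurable and nonnegative on the whole line. *)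
Let f' : measurableTypeR R -> R := (f \_ [set t : R | (0 <= t)%R])%R.

Let mf' : measurable_fun [set: measurableTypeR R] f'.
Proof.
have m0 : measurable [set t : R | (0 <= t)%R].
  by rewrite (_ : [set _ | _] = `[0%R, +oo[%classic)// set_itvE.
exact/(measurable_restrictT f m0).
Qed.

Let f'E t : (0 <= t)%R -> f' t = f t.
Proof. by move=> t0; rewrite /f' patchE mem_set. Qed.

Let f'0 t : (0 <= f' t)%R.
Proof. by rewrite /f' patchE; case: ifPn => // /set_mem; exact: f0. Qed.

Let Q0 x : (0 <= Q x)%R := quad_ge0 theta pS x.
Let mQ : measurable_fun [set: V] Q := measurable_quad theta Sigma.

Let FstarE x : Fstar f (Q x) = Fstar f' (Q x).
Proof.
rewrite /Fstar; congr (_ * _); apply: eq_integral => t.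
by rewrite inE/= in_itv/= andbT => Qt; rewrite f'E// (le_trans (Q0 x)).
Qed.

Let c : R := (\det Sigma `^ (- n%:R / 2))%R.
Let G := \int[mu]_x Fstar f' (Q x).

Let Fstar_ge0 t : 0 <= Fstar f' t.
Proof.
by rewrite /Fstar mule_ge0 ?lee_fin// integral_ge0// => s _; rewrite lee_fin f'0.
Qed.

Let mFstar : measurable_fun [set: V] (fun x => Fstar f' (Q x)).
Proof. exact: measurable_Fstar. Qed.

Let G_ge0 : 0 <= G.
Proof. exact: integral_ge0. Qed.

Let c0 : (0 <= c)%R.
Proof. exact: powR_ge0. Qed.

(** An integral equal to 1 excludes every degenerate case: [Kstar^-1] <= 0 or c = 0 would make it at
    most 0, and G = +oo with c > 0 would make it infinite. *)
Let normalization : exists K, [/\ (0 < Kstar)%R, (0 < c)%R, (0 < K)%R, G = K%:E & (c * K)%R = Kstar].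
Proof.
have [pos] := density_Fstar.
have [Kle|K0] := leP (Kstar^-1)%R 0%R.
  rewrite integral0_eq => [/eqP|x _]; first by rewrite eq_sym onee_eq0.
  apply/eqP; rewrite eq_le pos andbT mule_le0_ge0 ?lee_fin//.
  by rewrite /elliptic FstarE mule_ge0// lee_fin.
have -> : (fun x => (Kstar^-1)%:E * @elliptic R n q m p (Fstar f) theta Sigma x) =
    fun x => (Kstar^-1 * c)%:E * Fstar f' (Q x).
  by apply/funext => x; rewrite /elliptic FstarE EFinM muleA.
rewrite ge0_integralZl//; last by rewrite lee_fin mulr_ge0// ltW.
rewrite -/G; move: G_ge0; case: G => [K K0'| |] //; last first.
  move=> _; have [->|cn] := eqVneq c 0%R; first by rewrite mulr0 mul0e => /eqP; rewrite eq_sym onee_eq0.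
  by rewrite gt0_muley// lte_fin mulr_gt0// lt_neqAle eq_sym cn.
rewrite -EFinM => -[E].
have KK : (c * K = Kstar)%R.
  have Kn : Kstar != 0%R by rewrite -invr_eq0 gt_eqF.
  by rewrite -[LHS]mul1r -(mulfV Kn) -mulrA [X in (_ * X)%R]mulrA E mulr1.
have Kp : (0 < Kstar)%R by rewrite -invr_gt0.
exists K; split => //.
  rewrite lt_neqAle c0 andbT; apply: contraTneq Kp => c00.
  by rewrite -KK -c00 mul0r ltxx.
rewrite lt_neqAle -lee_fin K0' andbT; apply: contraTneq Kp => c00.
by rewrite -KK -c00 mulr0 ltxx.
Qed.

Let hD : V -> R := (h \_ D)%R.

Let h_ge0 x : D x -> (0 <= h x)%R.
Proof. by move=> /evdD[Hl SHl]; exact: (shrinkage_term_ge0 _ pS b0 SHl). Qed.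

Let weighted_comparison : \int[mu]_x (f' (Q x) * hD x)%:E <= C%:E * G.
Proof.
have [K [Kp cp K0 GE _]] := normalization.
have [B QB] := @quad_lt1_box R q m p theta Sigma pS.
apply: (radial_comparison (o := dilation_centre m theta) (B := B) mQ) => //.
- exact/(measurable_restrictT h mD).
- by move=> x; rewrite /hD patchE; case: ifPn => // /set_mem; exact: h_ge0.
- by move=> t x t0; rewrite quad_dilation.
- move=> t x t0; rewrite /hD !patchE.
  have -> : (affine_zu t (dilation_centre m theta t) x \in D) = (x \in D).
    by apply/idP/idP; rewrite !inE => /(coneD x t0).
  case: ifPn => _; last by rewrite mulr0.
  by rewrite Smx_dilation shrinkage_term_scale// exprn_gt0.
- apply: le_trans profile_comparison; rewrite [leRHS]integral_mkcond.
  rewrite le_eqVlt; apply/orP; left; apply/eqP; apply: eq_integral => x _.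
  by rewrite /hD /patch; case: ifPn => // _; rewrite mulr0.
- by rewrite -/G GE lte_fin.
Qed.

(** Since c K = Kstar, the left side is ao^2 Kstar C; with ao Kstar v = 1 the claim becomes C <= 2 b
    v. *)
Let constant_le K : (0 < Kstar)%R -> (c * K)%R = Kstar ->
  (ao ^+ 2 * c * (C * K) <= 2 * ao * b)%R.
Proof.
move=> Kp KE; have v0 : (0 < v%:R :> R)%R by rewrite ltr0n (leq_trans r0).
have rvR : (r%:R <= v%:R :> R)%R by rewrite ler_nat.
have H : ((v%:R - r%:R + 1) * (2 * b + b ^+ 2) <= 2 * b * v%:R :> R)%R.
  have w0 : (0 < v%:R - r%:R + 1 :> R)%R by lra.
  have : ((v%:R - r%:R + 1) * b <= 2 * (r%:R - 1))%R by rewrite mulrC -ler_pdivlMr.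
  move=> /(ler_wpM2l (ltW b0)); move: (v%:R : R) (r%:R : R) => V' r'; lra.
have -> : (ao ^+ 2 * c * (C * K) = ao ^+ 2 * Kstar * C)%R by rewrite -{3}KE; ring.
have -> : (2 * ao * b = ao ^+ 2 * Kstar * (2 * b * v%:R))%R.
  by field; rewrite !gt_eqF.
by rewrite ler_wpM2l// mulr_ge0 ?sqr_ge0// ltW.
Qed.


Let e x := @elliptic R n q m p (EFin \o f) theta Sigma x.

Let eE x : e x = (c * f' (Q x))%:E.
Proof. by rewrite /e /elliptic /= f'E. Qed.

Let e_ge0 x : 0 <= e x.
Proof. by rewrite eE lee_fin mulr_ge0. Qed.

Let me : measurable_fun D e.
Proof.
apply: measurable_funTS; rewrite (funext eE); apply/measurable_EFinP.
apply: measurable_funM => //.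
exact: (measurableT_comp mf' mQ).
Qed.

Let J0 x := loss Sigma (S x) (ao *: S x).
Let Jb x := loss Sigma (S x) (Sigma_alpha_b r a b ao (S x)).

Let mJ0 : measurable_fun D J0.
Proof.
pose g x := (ao ^+ 2 * \tr (invmx Sigma *m S x) - 2 * ao * r%:R +
  \tr (moore_penrose (S x) *m Sigma))%R.
apply: (eq_measurable_fun g) => [x|].
  by rewrite inE => /evdD[Hl SHl]; rewrite /J0 (loss_scaled _ pS SHl).
apply: measurable_funD => //; apply: measurable_funTS; apply: measurable_funB => //.
apply: measurable_funM => //; apply: mmeas_trace; apply: mmeasM; first exact: mmeas_cst.
by apply: mmeasM; [apply: mmeas_tr|]; exact: mmeas_zu2.
Qed.

Let JbE x : D x -> Jb x = (J0 x + (ao ^+ 2 * h x - 2 * ao * b))%R.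
Proof. by move=> /evdD[Hl SHl]; exact: (loss_shrinkage _ _ _ pS r0 SHl). Qed.

Let mJb : measurable_fun D Jb.
Proof.
apply: (eq_measurable_fun (fun x => J0 x + (ao ^+ 2 * h x - 2 * ao * b)))%R => [x|].
  by rewrite inE => /JbE.
apply: measurable_funD => //; apply: measurable_funB => //; exact: measurable_funM.
Qed.

Let J0_ge0 x : D x -> (0 <= J0 x)%R.
Proof.
move=> /evdD[Hl SHl]; apply: (loss_ge0 pS SHl).
by rewrite linearZ/= /Smx trmx_mul trmxK.
Qed.

Let Jb_ge0 x : D x -> (0 <= Jb x)%R.
Proof.
by move=> /evdD[Hl SHl]; apply: (loss_ge0 pS SHl); exact: trmx_Sigma_alpha_b SHl.
Qed.

Let riskE (Sh : V -> 'M[R]_p) : risk n f theta Sigma Sh =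
  \int[mu]_(x in D) ((loss Sigma (S x) (Sh x))%:E * e x).
Proof. exact: integral_null_complement. Qed.

Let integral_e : \int[mu]_(x in D) e x = 1.
Proof. by rewrite -integral_null_complement//; case: density_f. Qed.

Let integral_h_le :
  \int[mu]_(x in D) ((ao ^+ 2 * h x)%:E * e x) <= (2 * ao * b)%:E.
Proof.
have [K [Kp cp K0 GE KE]] := normalization.
have -> : \int[mu]_(x in D) ((ao ^+ 2 * h x)%:E * e x) =
    \int[mu]_x ((ao ^+ 2 * c)%:E * (f' (Q x) * hD x)%:E).
  rewrite integral_mkcond; apply: eq_integral => x _.
  rewrite /hD /patch; case: ifPn => _; last by rewrite mulr0 mule0.
  by rewrite eE -!EFinM; congr EFin; ring.
have cc : (0 <= ao ^+ 2 * c)%R by rewrite mulr_ge0 ?sqr_ge0.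
rewrite ge0_integralZl//; last 2 first.
- apply/measurable_EFinP; apply: measurable_funM; first exact: (measurableT_comp mf' mQ).
  exact/(measurable_restrictT h mD).
- move=> x _; rewrite lee_fin mulr_ge0// /hD patchE.
  by case: ifPn => // /set_mem; exact: h_ge0.
apply: (le_trans (lee_wpmul2l _ weighted_comparison)); first by rewrite lee_fin.
by rewrite GE -!EFinM lee_fin constant_le.
Qed.

Lemma risk_improvement :
  risk n f theta Sigma (fun x => Sigma_alpha_b r a b ao (S x)) <=
  risk n f theta Sigma (fun x => ao *: S x).
Proof.
have [K [Kp _ _ _ _]] := normalization.
rewrite (riskE (fun x => Sigma_alpha_b r a b ao (S x))) (riskE (fun x => ao *: S x)).
apply: (@weighted_integral_le _ _ R mu D J0 Jb (fun x => ao ^+ 2 * h x)%R e (2 * ao * b)) => //.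
- exact: measurable_funM.
- by move=> x Dx; rewrite mulr_ge0 ?sqr_ge0//; exact: h_ge0.
- by rewrite !mulr_ge0 ?invr_ge0 ?mulr_ge0// ltW.
- by move=> x Dx; rewrite JbE//; ring.
Qed.

End improvement.

(** The Hankel matrix of c A is that of A multiplied on both sides by diag (c^i). This makes the set
    of nondegenerate points invariant under the dilations. *)
Lemma gendisc_scale (R : realType) r (A : 'M[R]_r) (c : R) : c != 0 ->
  (gendisc (c *: A) != 0) = (gendisc A != 0).
Proof.
move=> c0; pose d : 'rV[R]_r := \row_i c ^+ i.
have powZ k : (c *: A) ^+ k = c ^+ k *: A ^+ k.
  elim: k => [|k IH]; first by rewrite !expr0 scale1r.
  rewrite !exprS IH -[LHS]/(c *: A *m (c ^+ k *: A ^+ k)) -scalemxAl -scalemxAr scalerA.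
  by [].
have -> : gendisc (c *: A) = c ^+ r * \det A * \det (diag_mx d *m hankelmx A *m diag_mx d).
  rewrite /gendisc detZ; congr (_ * \det _); apply/matrixP => i j.
  rewrite mul_mx_diag mul_diag_mx !mxE powZ mxtraceZ exprD; ring.
have d0 : \det (diag_mx d) != 0.
  by rewrite det_diag; apply/prodf_neq0 => i _; rewrite mxE expf_neq0.
rewrite /gendisc !det_mulmx !mulf_eq0 expf_eq0 (negbTE c0) andbF (negbTE d0) orbF.
by [].
Qed.

(** * The cases p <= m and m <= p *)

Section two_regimes.
Context (R : realType) (n q m p : nat) (theta : 'M[R]_(q, p)) (Sigma : 'M[R]_p).
Variables (f : R -> R) (Kstar a b : R).
Local Notation V := ('M[R]_(q, p) * 'M[R]_(m, p))%type.
Local Notation mu := (@lebesgue_zu R q m p).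
Local Notation Q := (@quad R q m p theta Sigma).
Local Notation S := (@Smx R q m p).

Hypotheses (pS : posdef Sigma) (a1 : 1 <= a) (b0 : 0 < b).
Hypotheses (mf : measurable_fun [set t : R | 0 <= t] f)
  (f0 : forall t, 0 <= t -> 0 <= f t).
Hypothesis density_f : is_density (@elliptic R n q m p (EFin \o f) theta Sigma).
Hypothesis density_Fstar :
  is_density (fun x => (Kstar^-1)%:E * @elliptic R n q m p (Fstar f) theta Sigma x)%E.

Let mxtrace_delta k (M : 'M[R]_(k, p)) i j : \tr (M *m (delta_mx i j)^T) = M i j.
Proof.
rewrite mxtrace_mulC trace_trmx_mul (bigD1 i)//= (bigD1 j)//= !mxE !eqxx mul1r.
rewrite big1 => [|j' j'j]; last by rewrite mxE eqxx (negbTE j'j) mul0r.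
rewrite big1 ?addr0// => i' i'i; apply: big1 => j' _.
by rewrite mxE (negbTE i'i) mul0r.
Qed.

Let mcdiff_zu2 (e : V) : mcdiff e (fun x => x.2) (fun=> e.2).
Proof. by move=> i j; exact: cdiff_entry2. Qed.

Let mcdiff_zu1 (e : V) : mcdiff e (fun x => x.1) (fun=> e.1).
Proof. by move=> i j; exact: cdiff_entry1. Qed.

(** Only directions in u are differentiated, because the field depends on the data through u
    alone. *)
Lemma cdiff_quad (i : 'I_m) (j : 'I_p) :
  cdiff (0 : 'M[R]_(q, p), delta_mx i j) Q (fun x => 2 * (x.2 *m invmx Sigma) i j).
Proof.
pose e : V := (0, delta_mx i j).
have [PT _] := posdef_inv pS.
have dt k (F F' : V -> 'M[R]_(k, p)) : mcdiff e F F' ->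
    cdiff e (fun x => \tr (F x *m invmx Sigma *m (F x)^T))
      (fun x => 2 * \tr (F x *m invmx Sigma *m (F' x)^T)).
  move=> dF; have := cdiff_trace (mcdiffM (mcdiffM dF (mcdiff_cst e (invmx Sigma))) (mcdiff_tr dF)).
  apply: eq_cdiff => // x; rewrite mulmx0 addr0 linearD/= -[\tr (F' x *m _ *m _)]mxtrace_tr.
  by rewrite !trmx_mul trmxK PT mulmxA mulr_natl mulr2n.
have d1 := dt _ _ _ (mcdiffD (mcdiff_zu1 e) (mcdiff_cst e (- theta))).
have d2 := dt _ _ _ (mcdiff_zu2 e).
apply: eq_cdiff (cdiffD d1 d2) => // x.
by rewrite /= addr0 trmx0 mulmx0 mxtrace0 mulr0 add0r mxtrace_delta.
Qed.

Let psiE r' (l : 'I_r' -> R) i : psifun a b (\row_i l i) ((\row_i l i) 0 i) = psi a b l i.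
Proof.
rewrite /psifun /psi !mxE; congr (b / _ * _).
by apply: eq_bigr => k _; rewrite mxE.
Qed.

Section regime.
Variables (r v : nat) (X W : V -> 'M[R]_(v, r)) (e : 'I_v -> 'I_r -> V).
Hypotheses (r0 : (0 < r)%N) (rv : (r <= v)%N).
Hypothesis bE : b <= 2 * (r%:R - 1) / (v%:R - r%:R + 1).
Hypotheses (X_lin : forall c x d, X (c *: x + d) = c *: X x + X d) (X_meas : mmeas X).
Hypothesis dX : forall i j, mcdiff (e i j) X (fun=> delta_mx i j).
Hypothesis dQ : forall i j, cdiff (e i j) Q (fun x => 2 * W x i j).
Hypothesis X_tr : forall x, \tr ((X x)^T *m X x) = \tr (x.2^T *m x.2).
Hypothesis X_staircase : exists x, X x = staircase R v r.
Hypothesis X_dilation : forall t x, X (affine_zu t (dilation_centre m theta t) x) = t *: X x.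
(* [basis X U l] holds the eigenvectors of S when U and l decompose X^T X. *)
Variable basis : V -> 'M[R]_r -> ('I_r -> R) -> 'M[R]_(p, r).
Hypothesis basisP : forall x U l, gram_spec X x U l ->
  spectral_decomposition (S x) (basis x U l, \row_i l i).
Hypothesis weightP : forall x U l i, gram_spec X x U l ->
  l i * ((basis x U l)^T *m invmx Sigma *m basis x U l) i i =
  (U^T *m ((W x)^T *m X x) *m U) i i.
Hypothesis mMP : measurable_fun [set x | gendisc ((X x)^T *m X x) != 0]
  (fun x => \tr (moore_penrose (S x) *m Sigma)).

Let D : set V := [set x | gendisc ((X x)^T *m X x) != 0].

Let DC : ~` D = [set x | gendisc ((X x)^T *m X x) = 0].
Proof.
apply/seteqP; split => x /=; first by move/negP; rewrite negbK => /eqP.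
by move=> E; rewrite /D /setC/= E eqxx.
Qed.

Let mD : measurable D.
Proof. by rewrite -[D]setCK DC; apply: measurableC; exact: measurable_degenerate. Qed.

Let D0 : mu (~` D) = 0%E.
Proof.
rewrite DC; have [x xE] := X_staircase.
by apply: (degenerate_null X_lin X_meas (d := x)); rewrite xE gendisc_staircase.
Qed.

Let specD x : D x -> exists U l, gram_spec X x U l /\ is_evd (S x) (basis x U l, \row_i l i).
Proof.
move=> /gram_distinct_spectral[U [l [UU XE l0 ld]]]; exists U, l.
have g : gram_spec X x U l by split.
by split => //; apply: is_evd_sorted => //; exact: basisP.
Qed.

Let w0 x U l i : gram_spec X x U l -> 0 <= (U^T *m ((W x)^T *m X x) *m U) i i.
Proof.
move=> g; have [_ _ l0] := g; rewrite -(weightP i g) mulr_ge0 ?(ltW (l0 i))//.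
by have := posdef_quad_ge0 (basis x U l)^T i (posdef_inv pS); rewrite trmxK.
Qed.

Let hE x U l : D x -> gram_spec X x U l -> shrinkage_term r Sigma a b (S x) =
  \sum_i weight (psi a b l i) * (U^T *m ((W x)^T *m X x) *m U) i i.
Proof.
move=> /specD[U' [l' [_ evd']]] g; rewrite (shrinkage_term_evd _ _ _ evd' (basisP g)).
apply: eq_bigr => i _; rewrite psiE; congr (_ * _).
by rewrite -(weightP i g) /= mxE.
Qed.

Lemma regime_improvement :
  (risk n f theta Sigma (fun x => Sigma_alpha_b r a b (Kstar * v%:R)^-1 (S x)) <=
   risk n f theta Sigma (fun x => (Kstar * v%:R)^-1 *: S x))%E.
Proof.
have specD' x : D x -> exists U l, gram_spec X x U l.
  by move=> /specD[U [l [g _]]]; exists U, l.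
have [B QB] := @quad_lt1_box R q m p theta Sigma pS.
have QM x : Q x < 1 -> \tr ((X x)^T *m X x) <= \tr Sigma + 1.
  by move=> /(quad_lt1_gram pS); rewrite X_tr.
have M0 : 0 < \tr Sigma + 1.
  by rewrite ltr_wpDl// sumr_ge0// => j _; exact: ltW (posdef_diag_gt0 j pS).
apply: (risk_improvement pS r0 rv b0 bE mf f0 density_f density_Fstar mD D0) => //.
- by move=> x /specD[U [l [_ evdS]]]; eexists; exact: evdS.
- exact: (measurable_weighted a1 r0 dX dQ specD' hE).
- move=> t x t0; rewrite /D/= X_dilation.
  rewrite (_ : (t *: X x)^T = t *: (X x)^T); last by rewrite linearZ.
  rewrite -scalemxAl -scalemxAr scalerA.
  by rewrite gendisc_scale// mulf_neq0 ?gt_eqF.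
- exact: (profile_inequality a1 b0 M0 r0 rv dX dQ QB QM mD D0 specD' w0 hE).
Qed.


End regime.

Let quad_dil_zu2 t x : (affine_zu t (dilation_centre m theta t) x).2 = t *: x.2.
Proof. by rewrite /affine_zu/= addr0. Qed.

Let invmx_adj k (A : 'M[R]_k) : A \in unitmx -> invmx A = (\det A)^-1 *: \adj A.
Proof. by move=> uA; rewrite /invmx uA. Qed.

Let unit_gendisc k l (X : 'M[R]_(k, l)) : gendisc (X^T *m X) != 0 -> X^T *m X \in unitmx.
Proof. by rewrite /gendisc mulf_eq0 negb_or unitmxE unitfE => /andP[]. Qed.

Lemma tall_improvement : (0 < p)%N -> (p <= m)%N ->
  b <= 2 * (p%:R - 1) / (m%:R - p%:R + 1) ->
  (risk n f theta Sigma (fun x => Sigma_alpha_b p a b (Kstar * m%:R)^-1 (S x)) <=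
   risk n f theta Sigma (fun x => (Kstar * m%:R)^-1 *: S x))%E.
Proof.
move=> p0 pm bE; have [PT _] := posdef_inv pS.
pose X (x : V) : 'M[R]_(m, p) := x.2.
pose W (x : V) : 'M[R]_(m, p) := x.2 *m invmx Sigma.
pose e (i : 'I_m) (j : 'I_p) : V := (0, delta_mx i j).
apply: (@regime_improvement p m X W e p0 pm bE _ _ _ _ _ _ _ (fun _ U _ => U)) => //.
- by move=> i j; exact: mmeas_zu2.
- by move=> i j; exact: cdiff_quad.
- by exists (0, staircase R m p).
- by move=> x U l [UU XE l0]; exact: gram_spectral.
- move=> x U l i [UU XE l0].
  have -> : (W x)^T *m X x = invmx Sigma *m specmx U l.
    by rewrite /W trmx_mul PT -mulmxA -XE.
  rewrite /specmx !mulmxA -[_ *m U^T *m U]mulmxA UU mulmx1.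
  by rewrite mul_mx_diag_entry mulrC.
(* On nondegenerate points S is invertible, and the cofactor formula shows that its inverse is
   measurable. *)
- pose g (x : V) : R := \tr ((\det (S x))^-1 *: \adj (S x) *m Sigma).
  apply: (eq_measurable_fun g) => [x|].
    rewrite inE => /unit_gendisc uA.
    by rewrite /g -invmx_adj// moore_penrose_unit.
  apply: measurable_funTS; apply: mmeas_trace; apply: mmeasM; last exact: mmeas_cst.
  by apply: mmeas_adj; apply: mmeasM; [apply: mmeas_tr|]; exact: mmeas_zu2.
Qed.

Lemma wide_improvement : (0 < m)%N -> (m <= p)%N ->
  b <= 2 * (m%:R - 1) / (p%:R - m%:R + 1) ->
  (risk n f theta Sigma (fun x => Sigma_alpha_b m a b (Kstar * p%:R)^-1 (S x)) <=
   risk n f theta Sigma (fun x => (Kstar * p%:R)^-1 *: S x))%E.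
Proof.
move=> m0 mp bE; have [PT _] := posdef_inv pS.
pose X (x : V) : 'M[R]_(p, m) := x.2^T.
pose W (x : V) : 'M[R]_(p, m) := invmx Sigma *m x.2^T.
pose e (i : 'I_p) (j : 'I_m) : V := (0, delta_mx j i).
have SE x : S x = X x *m (X x)^T by rewrite /X trmxK.
have mX : mmeas X by apply: mmeas_tr; exact: mmeas_zu2.
apply: (@regime_improvement m p X W e m0 mp bE _ _ _ _ _ _ _ (fun x U l => cogram_basis (X x) U l)) => //.
- by move=> c x d; rewrite /X /= linearP.
- move=> i j; rewrite -[delta_mx i j]trmxK trmx_delta.
  exact: (mcdiff_tr (mcdiff_zu2 (e i j))).
- move=> i j; apply: eq_cdiff (cdiff_quad j i) => // x.
  by rewrite /W -[in RHS]PT -trmx_mul [in RHS]mxE.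
- by move=> x; rewrite /X trmxK mxtrace_mulC.
- by exists (0, (staircase R p m)^T); rewrite /X trmxK.
- by move=> t x; rewrite /X quad_dil_zu2 linearZ.
- by move=> x U l [UU XE l0]; rewrite SE; exact: cogram_spectral.
(* The two factors l_i^(-1/2) from the normalization of the singular vectors cancel the eigenvalue
   l_i in front. *)
- move=> x U l i [UU XE l0].
  have -> : (cogram_basis (X x) U l)^T *m invmx Sigma *m cogram_basis (X x) U l =
      diag_mx (\row_i Num.sqrt (l i)^-1) *m (U^T *m ((W x)^T *m X x) *m U) *m
      diag_mx (\row_i Num.sqrt (l i)^-1).
    by rewrite /cogram_basis /W !trmx_mul tr_diag_mx PT !mulmxA.
  rewrite mul_mx_diag_entry mul_diag_mx [in LHS]mxE [X in X * _ * _]mxE.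
  have := sqr_sqrtr (_ : 0 <= (l i)^-1); rewrite invr_ge0 ltW// => /(_ isT).
  rewrite expr2; move: (Num.sqrt _) (_ i i) => s z s2.
  have -> : l i * (s * z * s) = l i * (s * s) * z by ring.
  by rewrite s2 mulfV ?mul1r// gt_eqF.
- pose I (x : V) : 'M[R]_m := (\det ((X x)^T *m X x))^-1 *: \adj ((X x)^T *m X x).
  pose g (x : V) : R := \tr (X x *m I x *m I x *m (X x)^T *m Sigma).
  have mI : mmeas I by apply: mmeas_adj; apply: mmeasM => //; exact: mmeas_tr.
  apply: (eq_measurable_fun g) => [x|].
    rewrite inE => /unit_gendisc uA.
    by rewrite /g /I -invmx_adj// SE moore_penrose_cogram.
  apply: measurable_funTS; apply: mmeas_trace; apply: mmeasM; last exact: mmeas_cst.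
  apply: mmeasM; last exact: mmeas_tr.
  by apply: mmeasM => //; exact: mmeasM.
Qed.

End two_regimes.

Theorem mainTheorem2 (R : realType) (n p q : nat)
    (p_gt0 : (0 < p)%N) (q_gt0 : (0 < q)%N) (q_lt_n : (q < n)%N)
    (f : R -> R) (Kstar alpha b : R) :
  let m := (n - q)%N in
  let r := minn p m in
  let v := maxn p m in
  let ao := (Kstar * v%:R)^-1 in
  let S := @Smx R q m p in
  let E := @expect R n q m p f in
  measurable_fun [set t : R | 0 <= t] f ->
  (forall t, 0 <= t -> 0 <= f t) ->
  (forall (theta : 'M[R]_(q, p)) (Sigma : 'M[R]_p), posdef Sigma ->
     is_density (@elliptic R n q m p (EFin \o f) theta Sigma)) ->
  (forall (theta : 'M[R]_(q, p)) (Sigma : 'M[R]_p), posdef Sigma ->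
     is_density (fun x =>
       (Kstar^-1)%:E * @elliptic R n q m p (Fstar f) theta Sigma x)%E) ->
  1 <= alpha ->
  0 < b ->
  (forall (theta : 'M[R]_(q, p)) (Sigma : 'M[R]_p), posdef Sigma ->
     [/\ E theta Sigma (fun x => \tr (invmx Sigma *m S x)) \is a fin_num,
         E theta Sigma (fun x => \tr (Sigma *m moore_penrose (S x)))
           \is a fin_num,
         E theta Sigma (fun x =>
           frobenius (invmx Sigma *m HLPsiH r alpha b (S x)) ^+ 2)
           \is a fin_num &
         E theta Sigma (fun x => frobenius (HPsiH r alpha b (S x)) ^+ 2)
           \is a fin_num]) ->
  b <= 2 * (r%:R - 1) / (v%:R - r%:R + 1) ->
  forall (theta : 'M[R]_(q, p)) (Sigma : 'M[R]_p), posdef Sigma ->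
    (risk n f theta Sigma (fun x => Sigma_alpha_b r alpha b ao (S x)) <=
     risk n f theta Sigma (fun x => ao *: S x))%E.
Proof.
move=> m r v ao S E mf f0 density_f density_Fstar alpha1 b0 _ bE theta Sigma pS.
have m0 : (0 < m)%N by rewrite subn_gt0.
have df := density_f theta Sigma pS; have dF := density_Fstar theta Sigma pS.
rewrite /ao /v /r; rewrite /v /r in bE.
have [pm|/ltnW mp] := leqP p m.
  rewrite (minn_idPl pm) (maxn_idPr pm) in bE *.
  exact: (tall_improvement pS alpha1 b0 mf f0 df dF p_gt0 pm bE).
rewrite (minn_idPr mp) (maxn_idPl mp) in bE *.
exact: (wide_improvement pS alpha1 b0 mf f0 df dF m0 mp bE).
Qed.
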